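(* Let $X$ be a Banach space and let $f:\mathbb{R}^n\to X$ be a smooth function such that $$\|f(x)\|_X\le \exp(-\pi|x|^2)\quad\forall x\in\mathbb{R}^n,\qquad \|\hat f(\xi)\|_X\le \exp(-\pi|\xi|^2)\quad\forall \xi\in\mathbb{R}^n.$$ Then $f(x)=f(0)\exp(-\pi|x|^2)$ for all $x\in\mathbb{R}^n$.
   Context: For an $X$-valued integrable function $f$ on $\mathbb{R}^n$, its Fourier transform is the $X$-valued (Bochner) integral $\hat f(\xi)=\int_{\mathbb{R}^n}f(x)\exp(-2\pi i\xi\cdot x)\,dx$. *)

(* Defs.v *)
From HB Require Import structures.
From mathcomp Require Import all_boot all_order all_algebra.
From mathcomp Require Import all_classical all_reals all_analysis.
From mathcomp Require Import complex.
Set Implicit Arguments. Unset Strict Implicit. Unset Printing Implicit Defensive.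
Import Order.TTheory GRing.Theory Num.Theory.
Import numFieldNormedType.Exports.
Local Open Scope classical_set_scope.
Local Open Scope ring_scope.
Local Open Scope complex_scope.

Section Defs.
Variable R : realType.
Local Notation C := R[i].

Definition expi (t : R) : C := (cos t) +i* (sin t).

Definition dotR n (x y : 'rV[R]_n) : R := \sum_(i < n) x ord0 i * y ord0 i.
Definition sqnorm n (x : 'rV[R]_n) : R := dotR x x.

(* identification of n-tuples (carrying the product Borel sigma-algebra)
   with row vectors *)
Definition rv_of_tuple n (t : n.-tuple R) : 'rV[R]_n := \row_i tnth t i.

Variable X : normedModType C.

(* Lebesgue measure on R^n (Borel sets), characterized as the unique measure
   giving every half-open box its volume *)
Definition is_lebesgue_Rn n (mu : {measure set (n.-tuple R) -> \bar R}) :=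
  forall a b : n.-tuple R, (forall i, tnth a i <= tnth b i) ->
    mu [set t | forall i, tnth a i < tnth t i <= tnth b i] =
    (\prod_(i < n) (tnth b i - tnth a i))%:E.


(* real-valued norm on X (the library norm of a normedModType C lives in C) *)
Definition nrm (v : X) : R := complex.Re `|v|.

Section Bochner.
Context d (T : measurableType d) (mu : {measure set T -> \bar R}).

Definition sfun_eval k (A : 'I_k -> set T) (c : 'I_k -> X) (x : T) : X :=
  \sum_(i < k) ((\1_(A i) x : R)%:C *: c i).

Definition sfun_int k (A : 'I_k -> set T) (c : 'I_k -> X) : X :=
  \sum_(i < k) ((fine (mu (A i)))%:C *: c i).

Definition is_bochner_integral (f : T -> X) (y : X) : Prop :=
  exists (k : nat -> nat) (A : forall m, 'I_(k m) -> set T)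
         (c : forall m, 'I_(k m) -> X),
    (forall m i, measurable (A m i) /\ (mu (A m i) < +oo)%E) /\
    {ae mu, forall x, sfun_eval (A m) (c m) x @[m --> \oo] --> f x} /\
    (\int[mu]_x (nrm (f x - sfun_eval (A m) (c m) x))%:E)%E @[m --> \oo]
      --> (0%:E)%E /\
    sfun_int (A m) (c m) @[m --> \oo] --> y.

(* the Bochner integral (0 if f is not Bochner integrable) *)
Definition bochner_integral (f : T -> X) : X :=
  xget 0 [set y | is_bochner_integral f y].
End Bochner.

Definition fourier n (mu : {measure set (n.-tuple R) -> \bar R})
  (f : 'rV[R]_n -> X) (xi : 'rV[R]_n) : X :=
  bochner_integral mu
    (fun t => expi (- (2 * pi) * dotR xi (rv_of_tuple t)) *: f (rv_of_tuple t)).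

Definition dquot n (f : 'rV[R]_n -> X) (v x : 'rV[R]_n) (h : R) : X :=
  (h^-1)%:C *: (f (x + h *: v) - f x).
Definition dderiv n (f : 'rV[R]_n -> X) (v : 'rV[R]_n) (x : 'rV[R]_n) : X :=
  lim (dquot f v x @ (0 : R)^').
Definition has_dderiv n (f : 'rV[R]_n -> X) (v x : 'rV[R]_n) : Prop :=
  cvg (dquot f v x @ (0 : R)^').
Definition iterD n (vs : seq 'rV[R]_n) (f : 'rV[R]_n -> X) : 'rV[R]_n -> X :=
  foldr (fun v g => dderiv g v) f vs.
Definition smooth n (f : 'rV[R]_n -> X) : Prop :=
  forall vs : seq 'rV[R]_n,
    continuous (iterD vs f) /\ (forall v x, has_dderiv (iterD vs f) v x).

End Defs.

(* Main.v *)
(* For a real vector v, F(z) = exp(pi |v|^2 z^2) * fhat(z v) is an entire X-valued function of z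
   with |F(x)| <= C on the real line and |F(x + iy)| <= C exp(pi |v|^2 x^2) on the plane. The
   Phragmen-Lindelof principle, applied in sectors exhausting each quadrant, bounds F, so F is
   constant by Liouville's theorem; at z = i this computes the moments
     int exp(2 pi v.x) f(x) dx = exp(pi |v|^2) int f.
   Hence for each s the functions exp(2 pi s.x + pi |s|^2) f(x + s) and f(x) have the same
   Laplace transform. A Gaussian-dominated function with zero Laplace transform stays so after
   multiplication by polynomials (differentiate), hence by exp(- k |x - y|^2 / 2), and letting
   k grow it must vanish. Evaluating at x = 0 gives exp(pi |s|^2) f(s) = f(0). *)
Require Import Defs.
From HB Require Import structures.
From mathcomp Require Import all_boot all_order all_algebra.
From mathcomp Require Import all_classical all_reals all_analysis.
From mathcomp Require Import complex.
From mathcomp Require Import zify ring lra.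
From mathcomp Require Import measurable_realfun.
Set Implicit Arguments. Unset Strict Implicit. Unset Printing Implicit Defensive.
Import Order.TTheory GRing.Theory Num.Theory.
Import numFieldNormedType.Exports.
Local Open Scope classical_set_scope.
Local Open Scope ring_scope.
Local Open Scope complex_scope.

(** * Complex norms and the exponential *)

Section ComplexNorms.
Context {R : realType}.
Local Notation C := R[i].

(** A quadrant is exactly the critical opening for growth of order 2, so Phragmen-Lindelof cannot be
    used on it directly. On the sector of opening pi/2 - d, the factor exp(i kappa z^2) with kappa =
    b cos(pi/2 - d) <= b d repairs the outer ray, where only the growth bound is known, and its cost
    exp(b d |z|^2) disappears as d tends to 0. Everything is done in X itself, without functionals.
    Subharmonicity of the norm and Cauchy's estimates come from averages of approximating
    polynomials over roots of unity, so no contour integral appears. The exponential enters as the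
    limit of (1 + z/N)^N: inside the integral this makes the transform entire, and later it turns
    polynomial multipliers into Gaussian ones. That last step costs a factor exp(3/2 |x|^2), against
    which decay exp(-2 |x|^2) is required; it is available because pi >= 2. Comparing f with its own
    translates means that no Gaussian integral is ever evaluated: integrability, translation
    invariance and a lower bound are enough. *)

Definition cabs (z : C) : R := complex.Re `|z|.

Lemma normcR (z : C) : `|z| = (cabs z)%:C.
Proof. by rewrite /cabs normc_def. Qed.

Lemma cabsR (x : R) : cabs x%:C = `|x|.
Proof. by rewrite /cabs normc_def /= expr0n addr0 sqrtr_sqr. Qed.

Lemma cabsM (z w : C) : cabs (z * w) = cabs z * cabs w.
Proof. by apply: complexI; rewrite rmorphM -!normcR normrM. Qed.

Lemma cabsX (z : C) k : cabs (z ^+ k) = cabs z ^+ k.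
Proof. by apply: complexI; rewrite rmorphXn -!normcR normrX. Qed.

Lemma cabsD (z w : C) : cabs (z + w) <= cabs z + cabs w.
Proof. by rewrite -lecR rmorphD -!normcR ler_normD. Qed.

Lemma cabsN (z : C) : cabs (- z) = cabs z.
Proof. by rewrite /cabs normrN. Qed.

Lemma cabs_ge0 (z : C) : 0 <= cabs z.
Proof. by rewrite -lecR -normcR normr_ge0. Qed.

Lemma cabs0 : cabs 0 = 0.
Proof. by rewrite /cabs normr0. Qed.

Lemma cabs1 : cabs 1 = 1.
Proof. by rewrite /cabs normr1. Qed.

Lemma cabsE (x y : R) : cabs (x +i* y) = Num.sqrt (x ^+ 2 + y ^+ 2).
Proof. by rewrite /cabs normc_def. Qed.

Lemma cabs_sqr (z : C) : cabs z ^+ 2 = complex.Re z ^+ 2 + complex.Im z ^+ 2.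
Proof. by case: z => x y; rewrite cabsE sqr_sqrtr ?addr_ge0 ?sqr_ge0. Qed.

Lemma Re_le_cabs (z : C) : `|complex.Re z| <= cabs z.
Proof.
rewrite -(@ler_pXn2r _ 2) ?nnegrE ?cabs_ge0 // cabs_sqr real_normK ?num_real //.
by rewrite lerDl sqr_ge0.
Qed.

Lemma Im_le_cabs (z : C) : `|complex.Im z| <= cabs z.
Proof.
rewrite -(@ler_pXn2r _ 2) ?nnegrE ?cabs_ge0 // cabs_sqr real_normK ?num_real //.
by rewrite lerDr sqr_ge0.
Qed.

Lemma cabs_le_ReIm (z : C) : cabs z <= `|complex.Re z| + `|complex.Im z|.
Proof.
rewrite -(@ler_pXn2r _ 2) ?nnegrE ?cabs_ge0 ?addr_ge0 // cabs_sqr.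
rewrite sqrrD !real_normK ?num_real // addrAC lerDl.
by rewrite mulrn_wge0 // mulr_ge0.
Qed.

Context {X : normedModType C}.

Lemma normX (v : X) : `|v| = (nrm v)%:C.
Proof.
have := normr_ge0 v; rewrite /nrm lecE /= => /andP[/eqP i0 _].
by case: (`|v|) i0 => a b /= ->.
Qed.

Lemma nrm_ge0 (v : X) : 0 <= nrm v.
Proof. by rewrite -lecR -normX normr_ge0. Qed.

Lemma nrm0 : nrm (0 : X) = 0.
Proof. by rewrite /nrm normr0. Qed.

Lemma nrm_eq0 (v : X) : nrm v = 0 -> v = 0.
Proof. by move=> v0; apply/eqP; rewrite -normr_eq0 normX v0. Qed.

Lemma nrmN (v : X) : nrm (- v) = nrm v.
Proof. by rewrite /nrm normrN. Qed.

Lemma nrmB (v w : X) : nrm (v - w) = nrm (w - v).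
Proof. by rewrite /nrm distrC. Qed.

Lemma nrmD (v w : X) : nrm (v + w) <= nrm v + nrm w.
Proof. by rewrite -lecR rmorphD /= -!normX; exact: ler_normD. Qed.

Lemma nrm_triangle (u v w : X) : nrm (v - w) <= nrm (v - u) + nrm (u - w).
Proof. by rewrite -(subrK u v) -addrA (le_trans (nrmD _ _))// addrK. Qed.

Lemma nrmZ (a : C) (v : X) : nrm (a *: v) = cabs a * nrm v.
Proof. by apply: complexI; rewrite rmorphM /= -normcR -!normX; exact: normrZ. Qed.

Lemma nrmZR (a : R) (v : X) : nrm (a%:C *: v) = `|a| * nrm v.
Proof. by rewrite nrmZ cabsR. Qed.

Lemma nrm_sum I (r : seq I) (P : pred I) (F : I -> X) :
  nrm (\sum_(i <- r | P i) F i) <= \sum_(i <- r | P i) nrm (F i).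
Proof.
elim/big_ind2: _ => [|x a y b xa yb|//]; first by rewrite nrm0.
by rewrite (le_trans (nrmD _ _)) // lerD.
Qed.

Lemma nrm_small (v : X) : (forall e, 0 < e -> nrm v <= e) -> v = 0.
Proof.
move=> ve; apply: nrm_eq0; apply: le_anti; rewrite nrm_ge0 andbT.
by apply/ler_addgt0Pl => e /ve; rewrite addr0.
Qed.

Lemma nrm_cvgP (u : nat -> X) (l : X) :
  u m @[m --> \oo] --> l <-> (nrm (u m - l)) @[m --> \oo] --> (0 : R).
Proof.
split.
- move/cvgrPdist_lt => ul; apply/cvgrPdist_lt => e e0.
  have e0C : 0 < e%:C :> C by rewrite ltcR.
  near=> m; rewrite sub0r normrN ger0_norm ?nrm_ge0 //.
  rewrite -ltcR -normX distrC.
  near: m; exact: ul.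
- move/cvgrPdist_lt => ul; apply/cvgrPdist_lt => e e0.
  (* In [R[i]] only elements with equal imaginary parts are comparable, so a positive [e] is
     real. *)
  have [a a0 ->] : exists2 a : R, 0 < a & e = a%:C.
    by case: e e0 => a b; rewrite ltcE /= => /andP[/eqP -> ?]; exists a.
  near=> m; rewrite distrC normX ltcR.
  have : `|0 - nrm (u m - l)| < a by near: m; exact: ul.
  by rewrite sub0r normrN ger0_norm ?nrm_ge0.
Unshelve. all: by end_near. Qed.

End ComplexNorms.

(** * The complex exponential and its approximation by powers *)

Section ComplexExponential.
Context {R : realType}.
Local Notation C := R[i].

Definition cexp (z : C) : C := (expR (complex.Re z))%:C * expi (complex.Im z).

Lemma expiD (s t : R) : expi (s + t) = expi s * expi t.
Proof.
rewrite /expi sinD cosD; apply/eqP; rewrite eq_complex /=.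
by apply/andP; split; apply/eqP; ring.
Qed.

Lemma expi0 : expi (0 : R) = 1.
Proof. by rewrite /expi cos0 sin0. Qed.

Lemma cabs_expi (t : R) : cabs (expi t) = 1.
Proof. by rewrite cabsE cos2Dsin2 sqrtr1. Qed.

Lemma cexpD (z w : C) : cexp (z + w) = cexp z * cexp w.
Proof.
rewrite /cexp !raddfD /= expRD expiD rmorphM.
by rewrite mulrACA.
Qed.

Lemma cexp0 : cexp 0 = 1.
Proof. by rewrite /cexp /= expR0 expi0 mul1r. Qed.

Lemma cexpMn (z : C) k : cexp (z *+ k) = cexp z ^+ k.
Proof. by elim: k => [|k ih]; rewrite ?mulr0n ?cexp0 // mulrS cexpD ih exprS. Qed.

Lemma cabs_cexp (z : C) : cabs (cexp z) = expR (complex.Re z).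
Proof. by rewrite cabsM cabs_expi mulr1 cabsR ger0_norm ?expR_ge0. Qed.

Lemma cexpR (x : R) : cexp x%:C = (expR x)%:C.
Proof. by rewrite /cexp /= expi0 mulr1. Qed.

Lemma cexpI (y : R) : cexp (0 +i* y) = expi y.
Proof. by rewrite /cexp /= expR0 mul1r. Qed.

(** Only the tangent inequality [expR_ge1Dx] is used. At [- x] it gives e^x - 1 <= x e^x, hence e^x
    - 1 - x <= x (e^x - 1); a second use, at a point depending on the sign of [x], bounds the last
    factor. *)
Lemma expR_remainder (x : R) : `|expR x - 1 - x| <= x ^+ 2 * expR `|x|.
Proof.
have ge : 0 <= expR x - 1 - x by have := expR_ge1Dx x; lra.
have le : expR x - 1 <= x * expR x.
  have /(ler_wpM2r (expR_ge0 x)) := expR_ge1Dx (- x).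
  by rewrite -expRD addNr expR0; lra.
rewrite ger0_norm //; have [x0|x0] := leP 0 x.
  rewrite ger0_norm //.
  have : x * (expR x - 1) <= x * (x * expR x) by rewrite ler_wpM2l.
  by rewrite expr2; lra.
have e1 : 1 <= expR `|x| by rewrite -expR0 ler_expR.
have : x ^+ 2 <= x ^+ 2 * expR `|x| by rewrite ler_peMr // sqr_ge0.
have := expR_ge1Dx x; rewrite -subr_ge0 => h.
have : 0 <= (- x) * (expR x - (1 + x)) by rewrite mulr_ge0 // oppr_ge0 ltW.
by rewrite expr2; lra.
Qed.

Lemma sin_le (x : R) : 0 <= x -> sin x <= x.
Proof.
rewrite le_eqVlt => /predU1P[<-|x0]; first by rewrite sin0.
have [|c _] := @MVT _ sin cos 0 x x0 (fun y _ => is_derive_sin y).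
  by apply: continuous_subspaceT => ?; exact: continuous_sin.
by rewrite sin0 !subr0 => ->; rewrite ler_piMl ?cos_le1 ?ltW.
Qed.

Lemma abs_sin_le (x : R) : `|sin x| <= `|x|.
Proof.
wlog x0 : x / 0 <= x.
  by have [x0 /(_ x)->//|/ltW x0] := leP 0 x => /(_ (- x)); rewrite sinN !normrN oppr_ge0; apply.
have [x1|x1] := leP x 1.
  have p1 : x <= pi by rewrite (le_trans x1)// ; have := @pi_ge2 R; lra.
  by rewrite !ger0_norm ?sin_ge0_pi ?x0 // sin_le.
by rewrite (le_trans (sin_max _)) // ger0_norm // ltW.
Qed.

Lemma cos_remainder (x : R) : `|cos x - 1| <= x ^+ 2.
Proof.
have -> : cos x - 1 = - (sin (x / 2) ^+ 2 *+ 2).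
  have {1}-> : x = (x / 2) *+ 2 by rewrite -mulr_natr divfK.
  by rewrite cos_mulr2n; have := cos2Dsin2 (x / 2); lra.
rewrite normrN normrMn normrX.
have : `|sin (x / 2)| ^+ 2 <= `|x / 2| ^+ 2.
  by rewrite ler_pXn2r ?nnegrE // abs_sin_le.
by rewrite [`|x / 2| ^+ 2]real_normK ?num_real // exprMn; have := sqr_ge0 x; lra.
Qed.

(** For x > 0 the mean value theorem gives sin x = x cos c with 0 < c < x, and 1 - cos c = 2
    sin^2(c/2) <= 2 |sin(c/2)| <= c. *)
Lemma sin_remainder (x : R) : `|sin x - x| <= x ^+ 2.
Proof.
wlog : x / 0 <= x.
  have [x0 /(_ x)->//|/ltW x0] := leP 0 x => /(_ (- x)).
  by rewrite sinN -opprD normrN sqrrN oppr_ge0; apply.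
rewrite le_eqVlt => /predU1P[<-|x0]; first by rewrite sin0 subrr normr0 expr0n.
have [|c] := @MVT _ sin cos 0 x x0 (fun y _ => is_derive_sin y).
  by apply: continuous_subspaceT => ?; exact: continuous_sin.
rewrite in_itv /= sin0 !subr0 => /andP[c0 cx] ->.
have -> : cos c * x - x = (cos c - 1) * x by lra.
rewrite normrM expr2 (ger0_norm (ltW x0)) ler_wpM2r ?ltW //.
have -> : cos c - 1 = - (sin (c / 2) ^+ 2 *+ 2).
  have {1}-> : c = (c / 2) *+ 2 by rewrite -mulr_natr divfK.
  by rewrite cos_mulr2n; have := cos2Dsin2 (c / 2); lra.
rewrite normrN normrMn normrX expr2.
have := abs_sin_le (c / 2).
rewrite (@ger0_norm _ (c / 2)); last by rewrite divr_ge0 // ltW.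
move=> h1.
have := sin_max (c / 2) => h2.
have : `|sin (c / 2)| * `|sin (c / 2)| <= `|sin (c / 2)| * 1 by rewrite ler_wpM2l.
by lra.
Qed.

Lemma cexp_remainder (z : C) :
  cabs (cexp z - 1 - z) <= 4 * cabs z ^+ 2 * expR (cabs z).
Proof.
case: z => x y; set r := cabs (x +i* y).
have hx : `|x| <= r := Re_le_cabs (x +i* y).
have hy : `|y| <= r := Im_le_cabs (x +i* y).
have r0 : 0 <= r := cabs_ge0 _.
have x2 : x ^+ 2 <= r ^+ 2.
  by rewrite -[x ^+ 2]real_normK ?num_real // ler_pXn2r ?nnegrE.
have y2 : y ^+ 2 <= r ^+ 2.
  by rewrite -[y ^+ 2]real_normK ?num_real // ler_pXn2r ?nnegrE.
have xy : `|x| * `|y| <= r ^+ 2 by rewrite expr2 ler_pM.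
have ex : expR x <= expR r by rewrite ler_expR (le_trans (ler_norm _)).
have eax : expR `|x| <= expR r by rewrite ler_expR.
have e1x : `|expR x - 1| <= `|x| * expR r.
  rewrite ler_norml; apply/andP; split.
    have : `|x| * 1 <= `|x| * expR r.
      by rewrite ler_wpM2l // -expR0 ler_expR.
    by have := expR_ge1Dx x; have := ler_norm (- x); rewrite normrN; lra.
  have /(ler_wpM2r (expR_ge0 x)) := expR_ge1Dx (- x).
  rewrite -expRD addNr expR0 => h.
  have : x * expR x <= `|x| * expR r.
    rewrite (le_trans (ler_norm _)) // normrM ler_wpM2l //.
    by rewrite ger0_norm ?expR_ge0.
  by lra.
have e0 := expR_ge0 r.
(* Each of the four summands below is at most r^2 e^r, whence the constant 4. *)
have -> : cexp (x +i* y) - 1 - (x +i* y) =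
   ((expR x - 1 - x) + expR x * (cos y - 1)) +i*
   (expR x * (sin y - y) + (expR x - 1) * y).
  apply/eqP; rewrite eq_complex /cexp /expi /=; apply/andP; split; apply/eqP; ring.
rewrite (le_trans (cabs_le_ReIm _)) //=.
have h1 : `|expR x - 1 - x| <= r ^+ 2 * expR r.
  by rewrite (le_trans (expR_remainder _)) // ler_pM ?sqr_ge0 ?expR_ge0.
have h2 : `|expR x * (cos y - 1)| <= r ^+ 2 * expR r.
  rewrite normrM mulrC ler_pM // ?(le_trans (cos_remainder _)) //.
  by rewrite ger0_norm ?expR_ge0.
have h3 : `|expR x * (sin y - y)| <= r ^+ 2 * expR r.
  rewrite normrM mulrC ler_pM // ?(le_trans (sin_remainder _)) //.
  by rewrite ger0_norm ?expR_ge0.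
have h4 : `|(expR x - 1) * y| <= r ^+ 2 * expR r.
  rewrite normrM (le_trans (ler_wpM2r _ e1x)) //.
  by rewrite mulrAC ler_wpM2r.
have := ler_normD (expR x - 1 - x) (expR x * (cos y - 1)).
have := ler_normD (expR x * (sin y - y)) ((expR x - 1) * y).
lra.
Qed.

(** Telescoping by induction. It serves both the power approximation of [cexp] and the Lipschitz
    bound for polynomials. *)
Lemma cabs_subX (a b : C) (M : R) N : cabs a <= M -> cabs b <= M ->
  cabs (a ^+ N - b ^+ N) <= N%:R * M ^+ N.-1 * cabs (a - b).
Proof.
move=> aM bM; have M0 : 0 <= M := le_trans (cabs_ge0 _) aM.
elim: N => [|N ih]; first by rewrite !expr0 subrr cabs0 !mul0r.
have -> : a ^+ N.+1 - b ^+ N.+1 = a * (a ^+ N - b ^+ N) + (a - b) * b ^+ N.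
  by rewrite !exprS; ring.
rewrite (le_trans (cabsD _ _)) // !cabsM cabsX.
have h1 : cabs a * cabs (a ^+ N - b ^+ N) <= N%:R * M ^+ N * cabs (a - b).
  rewrite (le_trans (ler_pM _ _ aM ih)) ?cabs_ge0 //.
  case: N {ih} => [|N /=]; first by rewrite !mul0r mulr0.
  by rewrite [in leRHS]exprS -!mulrA [leLHS]mulrCA.
have h2 : cabs (a - b) * cabs b ^+ N <= cabs (a - b) * M ^+ N.
  rewrite ler_wpM2l ?cabs_ge0 //.
  by case: N {ih h1} => [//|N]; rewrite ler_pXn2r ?nnegrE ?cabs_ge0.
by rewrite -natr1 /=; lra.
Qed.

(* [(1 + z/N)^N] rather than the Taylor polynomials: the error then follows
   from [cexp (z/N) ^+ N = cexp z] and the second-order remainder alone. *)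
Lemma cexp_approx (z : C) N :
  cabs (cexp z - (1 + z / N.+1%:R) ^+ N.+1) <=
  4 * cabs z ^+ 2 * expR (2 * cabs z) / N.+1%:R.
Proof.
set n := N.+1; set w := z / n%:R.
have n0 : (n%:R : R) != 0 by rewrite pnatr_eq0.
have n0' : 0 < (n%:R : R) by rewrite ltr0n.
have zw : z = w *+ n by rewrite -mulr_natr divfK // pnatr_eq0.
have rw : cabs z = n%:R * cabs w.
  rewrite zw -mulr_natr cabsM mulrC; congr (_ * _).
  by rewrite -(rmorph_nat (real_complex R)) cabsR ger0_norm.
set r := cabs w in rw *; have r0 : 0 <= r := cabs_ge0 _.
have e1 : cabs (cexp w) <= expR r.
  by rewrite cabs_cexp ler_expR (le_trans (ler_norm _)) // Re_le_cabs.
have e2 : cabs (1 + w) <= expR r.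
  by rewrite (le_trans (cabsD _ _)) // cabs1 expR_ge1Dx.
rewrite {1}zw cexpMn (le_trans (cabs_subX _ e1 e2)) //=.
have -> : cexp w - (1 + w) = cexp w - 1 - w by rewrite opprD addrA.
have h := ler_wpM2l (mulr_ge0 (ltW n0') (exprn_ge0 N (expR_ge0 r))) (cexp_remainder w).
rewrite (le_trans h) // -/r -expRM_natl.
have -> : n%:R * expR (N%:R * r) * (4 * r ^+ 2 * expR r) =
   4 * cabs z ^+ 2 / n%:R * expR (cabs z).
  have -> : expR (cabs z) = expR (N%:R * r) * expR r.
    by rewrite -expRD rw /n -natr1; congr expR; ring.
  rewrite rw; field.
  by rewrite n0.
rewrite [leLHS]mulrAC ler_wpM2r ?invr_ge0 ?(ltW n0') //.
apply: ler_wpM2l; first by rewrite mulr_ge0 ?sqr_ge0.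
rewrite ler_expR.
by have := cabs_ge0 z; lra.
Qed.

End ComplexExponential.

(** * Vector-valued entire functions *)

Section EntireFunctions.
Context {R : realType}.
Local Notation C := R[i].
Context {X : normedModType C}.

(** The scalar parts are arbitrary polynomials rather than monomials, which makes multiplication by,
    and composition with, a scalar polynomial immediate; [is_poly_coef] returns to monomials. *)
Definition is_poly (P : C -> X) := exists (d : nat) (q : nat -> {poly C}) (a : nat -> X),
  forall z, P z = \sum_(k < d) (q k).[z] *: a k.

(* Locally uniform limits of X-valued polynomials, i.e. entire functions;
   this form makes the closure properties and Cauchy's estimates algebraic. *)
Definition entire (F : C -> X) := forall r e : R, 0 < e ->
  exists2 P, is_poly P & forall z, cabs z <= r -> nrm (F z - P z) <= e.

Lemma is_polyM (p : {poly C}) P : is_poly P -> is_poly (fun z => p.[z] *: P z).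
Proof.
move=> [d [q [a Pq]]]; exists d, (fun k => p * q k), a => z.
by rewrite Pq scaler_sumr; apply: eq_bigr => k _; rewrite hornerM scalerA.
Qed.

Lemma is_poly_comp (p : {poly C}) P : is_poly P -> is_poly (fun z => P p.[z]).
Proof.
move=> [d [q [a Pq]]]; exists d, (fun k => q k \Po p), a => z.
by rewrite Pq; apply: eq_bigr => k _; rewrite horner_comp.
Qed.

(** The expansion may be padded to any length [N >= d], so that a caller can force [N] to be
    positive or larger than 1. *)
Lemma is_poly_coef P : is_poly P -> exists (d : nat) (b : nat -> X),
  forall N z, (d <= N)%N -> P z = \sum_(k < N) z ^+ k *: b k.
Proof.
move=> [d [q [a Pq]]].
exists (\max_(k < d) size (q k)), (fun l => \sum_(k < d) (q k)`_l *: a k) => N z dN.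
rewrite Pq.
under [RHS]eq_bigr do rewrite scaler_sumr.
rewrite exchange_big /=; apply: eq_bigr => k _.
rewrite (@horner_coef_wide _ N); last first.
  by rewrite (leq_trans _ dN) // (leq_bigmax k).
by rewrite scaler_suml; apply: eq_bigr => l _; rewrite scalerA mulrC.
Qed.

(** A primitive [N]-th root of unity. Averages over its powers replace circle integrals, exactly so
    for polynomials of degree below [N]. *)
Definition unity (N : nat) : C := expi (2 * pi / N%:R).

Lemma expiX (t : R) k : expi t ^+ k = expi (k%:R * t).
Proof.
elim: k => [|k ih]; first by rewrite mul0r expi0.
by rewrite exprS ih -expiD -natr1 mulrDl mul1r addrC.
Qed.

Lemma expi_2pi : expi (2 * pi) = 1 :> C.
Proof. by rewrite /expi mulr_natl cos2pi sin2pi. Qed.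

Lemma unityX N : (0 < N)%N -> unity N ^+ N = 1.
Proof. by move=> N0; rewrite expiX mulrCA mulfV ?mulr1 ?expi_2pi // pnatr_eq0 -lt0n. Qed.

Lemma cabs_unityX N k : cabs (unity N ^+ k) = 1.
Proof. by rewrite cabsX cabs_expi expr1n. Qed.

(** The angle is 2a with 0 < a < pi, and cos 2a = 1 - 2 sin^2 a < 1. *)
Lemma unityX_neq1 N k : (0 < k < N)%N -> unity N ^+ k != 1.
Proof.
move=> /andP[k0 kN]; have N0 : (0 < N)%N by exact: leq_trans kN.
have N0' : 0 < N%:R :> R by rewrite ltr0n.
pose a : R := k%:R * pi / N%:R.
have a0 : 0 < a by rewrite divr_gt0 // mulr_gt0 ?pi_gt0 ?ltr0n.
have api : a < pi.
  by rewrite ltr_pdivrMr // mulrC ltr_pM2l ?pi_gt0 // ltr_nat.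
apply/eqP; rewrite expiX => -[] ca _.
have : cos (a *+ 2) = 1 by rewrite -ca /a; congr cos; rewrite -mulr_natl; ring.
rewrite cos_mulr2n => c1.
have s0 : 0 < sin a by rewrite sin_gt0_pi // a0 api.
have : 0 < sin a ^+ 2 by rewrite exprn_gt0.
by have := cos2Dsin2 a; lra.
Qed.

Lemma sum_unityX N k : ~~ (N %| k)%N -> \sum_(j < N) (unity N ^+ j) ^+ k = 0.
Proof.
case: N => [|N] Nk; first by rewrite big_ord0.
have x1 : unity N.+1 ^+ k != 1.
  rewrite {1}(divn_eq k N.+1) exprD mulnC exprM unityX // expr1n mul1r.
  by rewrite unityX_neq1 // lt0n ltn_pmod // andbT.
under eq_bigr do rewrite exprAC.
have := subrX1 (unity N.+1 ^+ k) N.+1.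
rewrite exprAC unityX // expr1n subrr => /esym/eqP.
by rewrite mulf_eq0 subr_eq0 (negbTE x1) /= => /eqP.
Qed.

(** Discrete Cauchy formula: the weight with exponent [N - k] stands for the inverse [k]-th power,
    and orthogonality of the roots of unity isolates [b k]. *)
Lemma unity_average (b : nat -> X) N k : (k < N)%N ->
  \sum_(j < N) (unity N ^+ j) ^+ (N - k) *:
     (\sum_(l < N) (unity N ^+ j) ^+ l *: b l) = N%:R *: b k.
Proof.
move=> kN.
under eq_bigr do rewrite scaler_sumr.
rewrite exchange_big /= (bigD1 (Ordinal kN)) //= [X in _ + X]big1 ?addr0.
  under eq_bigr => j _ do
    rewrite scalerA -exprD subnK ?(ltnW kN) // exprAC unityX ?(leq_trans _ kN) // expr1n.
  by rewrite -scaler_suml sumr_const card_ord.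
move=> l lk.
under eq_bigr do rewrite scalerA -exprD.
rewrite -scaler_suml sum_unityX ?scale0r //.
(* N - k + l lies strictly between 0 and 2N, so if [N] divides it, it equals [N] and l = k. *)
apply/negP => /dvdnP[m mE]; move/negP: lk; apply; apply/eqP/val_inj => /=.
have := ltn_ord l; case: m mE => [|[|m]] mE; try lia.
Qed.

Lemma cabs_nat N : cabs (N%:R : C) = N%:R.
Proof. by rewrite -(rmorph_nat (real_complex R)) cabsR ger0_norm. Qed.

(** Applied to the coefficients r^l b_l, [unity_average] writes N r^k b_k as a sum of [N] values on
    the circle of radius [r], with weights of modulus 1. *)
Lemma cauchy_estimate (b : nat -> X) (N k : nat) (r M : R) : 0 <= r -> (k < N)%N ->
  (forall z, cabs z = r -> nrm (\sum_(l < N) z ^+ l *: b l) <= M) ->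
  nrm (b k) * r ^+ k <= M.
Proof.
move=> r0 kN PM; have N0 : 0 < N%:R :> R by rewrite ltr0n (leq_trans _ kN).
have := unity_average (fun l => (r%:C) ^+ l *: b l) kN.
move=> /(congr1 (@nrm R X)); rewrite nrmZ cabs_nat nrmZ cabsX cabsR ger0_norm //.
move=> E; rewrite mulrC -(ler_pM2l N0) -E (le_trans (nrm_sum _ _ _)) //.
have -> : N%:R * M = \sum_(j < N) M by rewrite sumr_const card_ord mulr_natl.
apply: ler_sum => j _; rewrite nrmZ cabsX cabs_unityX expr1n mul1r.
have -> : \sum_(l < N) (unity N ^+ j) ^+ l *: (r%:C ^+ l *: b l) =
    \sum_(l < N) (r%:C * unity N ^+ j) ^+ l *: b l.
  by apply: eq_bigr => l _; rewrite scalerA exprMn mulrC.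
by apply: PM; rewrite cabsM cabs_unityX mulr1 cabsR ger0_norm.
Qed.

(** Mean value property, from the coefficient of index 0 of the recentred polynomial. The condition
    [1 < N] makes the roots of unity sum to 0 in [sum_cabs2_circle]. *)
Lemma poly_mean P (c : C) : is_poly P -> forall rho : R, exists2 N : nat, (1 < N)%N &
  N%:R *: P c = \sum_(j < N) P (c + rho%:C * unity N ^+ j).
Proof.
move=> Pp rho; have := is_poly_comp (c%:P + rho%:C *: 'X) Pp.
move=> /is_poly_coef[d [b Qb]]; exists d.+2 => //.
have hE z : (c%:P + rho%:C *: 'X).[z] = c + rho%:C * z by rewrite !hornerE.
have := @unity_average b d.+2 0 isT.
have -> : b 0%N = P c.
  have := Qb d.+2 0 (leqW (leqnSn d)); rewrite hE mulr0 addr0 => ->.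
  rewrite big_ord_recl expr0 scale1r big1 ?addr0 // => i _.
  by rewrite expr0n scale0r.
move=> <-; apply: eq_bigr => j _.
rewrite subn0 exprAC unityX // expr1n scale1r -hE.
by rewrite (Qb d.+2) ?leqW.
Qed.

Lemma is_poly_lipschitz P : is_poly P -> forall r : R, exists2 L : R, 0 <= L &
  forall z w, cabs z <= r -> cabs w <= r -> nrm (P z - P w) <= L * cabs (z - w).
Proof.
move=> /is_poly_coef[d [b Pb]] r; pose r' := Num.max r 0.
have r'0 : 0 <= r' by rewrite le_max lexx orbT.
exists (\sum_(k < d) k%:R * r' ^+ k.-1 * nrm (b k)).
  by apply: sumr_ge0 => k _; rewrite !mulr_ge0 ?exprn_ge0 ?nrm_ge0.
move=> z w zr wr; rewrite !(Pb d) // -sumrB mulr_suml (le_trans (nrm_sum _ _ _)) //.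
apply: ler_sum => k _; rewrite -scalerBl nrmZ mulrAC ler_wpM2r ?nrm_ge0 //.
by rewrite cabs_subX // le_max ?zr ?wr.
Qed.

Lemma entire_ucontinuous F : entire F -> forall r e : R, 0 < e -> exists2 d : R, 0 < d &
  forall z w, cabs z <= r -> cabs w <= r -> cabs (z - w) <= d -> nrm (F z - F w) <= e.
Proof.
move=> Fe r e e0; have e3 : 0 < e / 3 by rewrite divr_gt0.
have [P Pp FP] := Fe r _ e3; have [L L0 PL] := is_poly_lipschitz Pp r.
have L1 : 0 < L + 1 by rewrite ltr_wpDl.
exists (e / 3 / (L + 1)); first by rewrite divr_gt0.
move=> z w zr wr zw.
have h1 := FP _ zr; have h2 := FP _ wr; have h3 := PL _ _ zr wr.
have h4 : L * cabs (z - w) <= e / 3.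
  rewrite (@le_trans _ _ ((L + 1) * cabs (z - w))) //.
    by rewrite ler_wpM2r ?cabs_ge0 // lerDl.
  by move: zw; rewrite ler_pdivlMr // mulrC.
have h5 := nrm_triangle (P z) (F z) (F w).
have h6 := nrm_triangle (P w) (P z) (F w).
rewrite nrmB in h2; lra.
Qed.

Lemma entire_bounded F : entire F -> forall r : R, exists2 M : R, 0 <= M &
  forall z, cabs z <= r -> nrm (F z) <= M.
Proof.
move=> Fe r; have [P Pp FP] := Fe r 1 ltr01.
have [L L0 PL] := is_poly_lipschitz Pp (Num.max r 0).
exists (1 + nrm (P 0) + L * Num.max r 0).
  by rewrite !addr_ge0 ?nrm_ge0 ?mulr_ge0 // le_max lexx orbT.
move=> z zr; have h1 := FP _ zr.
have zr' : cabs z <= Num.max r 0 by rewrite le_max zr.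
have /PL : cabs z <= Num.max r 0 by rewrite le_max zr.
move=> /(_ 0); rewrite cabs0 le_max lexx orbT subr0 => /(_ isT) h2.
have h3 : L * cabs z <= L * Num.max r 0 by rewrite ler_wpM2l.
have := nrmD (F z - P z) (P z); rewrite subrK.
have := nrmD (P z - P 0) (P 0); rewrite subrK.
lra.
Qed.

Lemma entire_comp (p : {poly C}) F : entire F -> entire (fun z => F p.[z]).
Proof.
move=> Fe r e e0.
pose B := \sum_(k < size p) cabs p`_k * (Num.max r 0) ^+ k.
have [P Pp FP] := Fe B _ e0; exists (fun z => P p.[z]); first exact: is_poly_comp.
move=> z zr; apply: FP; rewrite horner_coef.
apply: (@le_trans _ _ (\sum_(k < size p) cabs (p`_k * z ^+ k))).
  elim/big_ind2: _ => [|x a y b xa yb|//]; first by rewrite cabs0.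
  by rewrite (le_trans (cabsD _ _)) // lerD.
apply: ler_sum => k _; rewrite cabsM cabsX ler_wpM2l ?cabs_ge0 //.
apply: lerXn2r; rewrite ?nnegrE ?cabs_ge0 ?le_max ?lexx ?orbT //.
by rewrite zr.
Qed.

(** The approximant is the polynomial (1 + c z^p / (N+1))^(N+1) times a polynomial [P] close to [F].
    Capping the error of [P] by 1 gives the bound M + 1 on [P] before [N] is used; each factor then
    contributes at most e/2. *)
Lemma entire_cexpM (c : C) p F : entire F -> entire (fun z => cexp (c * z ^+ p) *: F z).
Proof.
move=> Fe r e e0.
have [s s0 cs] : exists2 s : R, 0 <= s & forall z, cabs z <= r -> cabs (c * z ^+ p) <= s.
  have r0 : 0 <= Num.max r 0 by rewrite le_max lexx orbT.
  exists (cabs c * (Num.max r 0) ^+ p); first by rewrite mulr_ge0 ?cabs_ge0 ?exprn_ge0.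
  move=> z zr; rewrite cabsM cabsX ler_wpM2l ?cabs_ge0 // lerXn2r ?nnegrE ?cabs_ge0 //.
  by rewrite le_max zr.
have [M M0 FM] := entire_bounded Fe r.
have e2 : 0 < e / 2 / expR s by rewrite !divr_gt0 ?expR_gt0.
have e2' : 0 < Num.min (e / 2 / expR s) 1 by rewrite lt_min e2 ltr01.
have [P Pp FP] := Fe r _ e2'.
pose K := 4 * s ^+ 2 * expR (2 * s) * (M + 1).
have K0 : 0 <= K by rewrite !mulr_ge0 ?sqr_ge0 ?expR_ge0 ?addr_ge0.
pose N := (Num.truncn (K / (e / 2))).
have KN : K / N.+1%:R <= e / 2.
  rewrite ler_pdivrMr // mulrC -ler_pdivrMr ?divr_gt0 //.
  by rewrite ltW // truncnS_gt.
exists (fun z => ((1 + (c / N.+1%:R) *: 'X^p) ^+ N.+1).[z] *: P z).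
  exact: is_polyM.
move=> z zr.
have cz := cs _ zr.
have -> : ((1 + (c / N.+1%:R) *: 'X^p) ^+ N.+1).[z] = (1 + (c * z ^+ p) / N.+1%:R) ^+ N.+1.
  by rewrite horner_exp !hornerE mulrAC.
set w := c * z ^+ p in cz *; set t := (1 + _) ^+ _.
have := FP _ zr; rewrite le_min => /andP[h1 h1'].
have h2 : cabs (cexp w - t) * (M + 1) <= e / 2.
  apply: le_trans KN; rewrite /K mulrAC ler_wpM2r ?addr_ge0 //.
  rewrite (le_trans (cexp_approx _ _)) // ler_wpM2r ?invr_ge0 //.
  have hA : 4 * cabs w ^+ 2 <= 4 * s ^+ 2.
    by rewrite ler_wpM2l // lerXn2r ?nnegrE ?cabs_ge0.
  have hB : expR (2 * cabs w) <= expR (2 * s) by rewrite ler_expR ler_wpM2l.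
  by rewrite ler_pM ?expR_ge0 // mulr_ge0 // exprn_ge0 ?cabs_ge0.
have PM : nrm (P z) <= M + 1.
  have := nrmD (P z - F z) (F z); rewrite subrK nrmB; have := FM _ zr; lra.
have h3 : cabs (cexp w) <= expR s.
  by rewrite cabs_cexp ler_expR (le_trans (ler_norm _)) // (le_trans (Re_le_cabs _)).
have -> : cexp w *: F z - t *: P z = cexp w *: (F z - P z) + (cexp w - t) *: P z.
  by rewrite scalerBr scalerBl addrA subrK.
rewrite (le_trans (nrmD _ _)) // !nrmZ.
have h4 : cabs (cexp w) * nrm (F z - P z) <= expR s * (e / 2 / expR s).
  by rewrite ler_pM ?cabs_ge0 ?nrm_ge0.
rewrite [leRHS]mulrC divfK ?gt_eqF ?expR_gt0 // in h4.
have h5 : cabs (cexp w - t) * nrm (P z) <= cabs (cexp w - t) * (M + 1).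
  by rewrite ler_wpM2l ?cabs_ge0.
lra.
Qed.

Lemma sum_geometric_le (t : R) N : 0 <= t <= 2^-1 -> \sum_(k < N) t ^+ k.+1 <= 2 * t.
Proof.
move=> /andP[t0 t2].
have -> : \sum_(k < N) t ^+ k.+1 = t * \sum_(k < N) t ^+ k.
  by rewrite mulr_sumr; apply: eq_bigr => k _; rewrite exprS.
rewrite mulrC ler_wpM2r //.
have := subrX1 t N; have := exprn_ge0 N t0.
have : 0 <= \sum_(k < N) t ^+ k by apply: sumr_ge0 => k _; rewrite exprn_ge0.
set S := \sum_(k < N) _ => S0 tN E.
have : (1 - t) * S <= 1 by lra.
have : 2^-1 * S <= (1 - t) * S by rewrite ler_wpM2r //; lra.
lra.
Qed.

(** The bound on [F] passes, up to 1, to a polynomial close to it on a large disc. Cauchy's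
    estimates on its coefficients leave a geometric series of ratio |z|/r. *)
Lemma liouville F (M : R) : entire F -> (forall z, nrm (F z) <= M) -> forall z, F z = F 0.
Proof.
move=> Fe FM z; apply/eqP; rewrite -subr_eq0; apply/eqP/nrm_small => e e0.
have M0 : 0 <= M by rewrite (le_trans _ (FM 0)) ?nrm_ge0.
have z0 := cabs_ge0 z.
(* The first term makes the series at most e/2, the second keeps the ratio |z|/r below 1/2, and the
   last keeps [r] positive. *)
pose r := 4 * (M + 1) * cabs z / e + 2 * cabs z + 1.
have A0 : 0 <= 4 * (M + 1) * cabs z / e.
  by rewrite divr_ge0 ?(ltW e0) // !mulr_ge0 // addr_ge0.
have r0 : 0 < r by rewrite /r; lra.
have e4 : 0 < e / 4 by rewrite divr_gt0.
have e4' : 0 < Num.min (e / 4) 1 by rewrite lt_min e4 ltr01.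
have [P Pp FP] := Fe r _ e4'.
have [d [b Pb]] := is_poly_coef Pp.
have PM w : cabs w <= r -> nrm (P w) <= M + 1.
  move=> wr; have := FP _ wr; rewrite le_min => /andP[_ h].
  have := nrmD (P w - F w) (F w); rewrite subrK nrmB; have := FM w; lra.
have bM k : (k < d.+1)%N -> nrm (b k) * r ^+ k <= M + 1.
  move=> kd; apply: (cauchy_estimate (ltW r0) kd) => w wr.
  by rewrite -Pb // PM // wr.
have rz : 2 * cabs z <= r by rewrite /r; lra.
have zr : cabs z <= r by lra.
have tr : 0 <= cabs z / r <= 2^-1.
  by rewrite divr_ge0 ?(ltW r0) //= ler_pdivrMr //; lra.
have PP : nrm (P z - P 0) <= (M + 1) * (2 * (cabs z / r)).
  rewrite !(Pb d.+1) // !big_ord_recl !expr0 [X in _ - (_ + X)]big1 ?addr0; last first.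
    by move=> i _; rewrite expr0n scale0r.
  rewrite addrAC subrr add0r (le_trans (nrm_sum _ _ _)) //.
  apply: (@le_trans _ _ (\sum_(i < d) (M + 1) * (cabs z / r) ^+ i.+1)); last first.
    by rewrite -mulr_sumr ler_wpM2l ?addr_ge0 // sum_geometric_le.
  apply: ler_sum => i _; rewrite nrmZ cabsX exprMn exprVn.
  have := bM i.+1 (ltn_ord i); rewrite -ler_pdivlMr ?exprn_gt0 // => h.
  by rewrite [leRHS]mulrCA ler_wpM2l ?exprn_ge0.
have PP2 : (M + 1) * (2 * (cabs z / r)) <= e / 2.
  rewrite !mulrA ler_pdivrMr //.
  have : 4 * (M + 1) * cabs z / e * (e / 2) = 2 * ((M + 1) * cabs z) by field; lra.
  have : 0 <= e / 2 * (2 * cabs z + 1) by rewrite mulr_ge0 ?divr_ge0 ?ltW // ltr_wpDl // mulr_ge0.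
  by rewrite /r; lra.
have := FP _ zr; rewrite le_min => /andP[h1 _].
have c0r : cabs 0 <= r by rewrite cabs0 ltW.
have := FP _ c0r; rewrite le_min => /andP[h2 _].
have h3 := nrm_triangle (P z) (F z) (F 0).
have h4 := nrm_triangle (P 0) (P z) (F 0).
rewrite nrmB in h2; lra.
Qed.

End EntireFunctions.

(** * The Phragmen-Lindelof principle *)

Section PhragmenLindelof.
Context {R : realType}.
Local Notation C := R[i].
Context {X : normedModType C}.
Implicit Types F : C -> X.

(** The cross terms cancel because the roots of unity sum to 0. The excess rho^2 over the value at
    the centre is the strictness that [no_interior_max] exploits. *)
Lemma sum_cabs2_circle (c : C) (rho : R) N : (1 < N)%N ->
  \sum_(j < N) cabs (c + rho%:C * unity N ^+ j) ^+ 2 = N%:R * (cabs c ^+ 2 + rho ^+ 2).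
Proof.
move=> N1; have N0 : (0 < N)%N by exact: ltn_trans N1.
have S0 : \sum_(j < N) (unity N : C) ^+ j = 0.
  have := @sum_unityX R N 1; rewrite dvdn1 gtn_eqF // => /(_ isT) h; rewrite -[RHS]h.
  by apply: eq_bigr => j _; rewrite expr1.
have E j : cabs (c + rho%:C * unity N ^+ j) ^+ 2 = (cabs c ^+ 2 + rho ^+ 2) +
   2 * rho * complex.Re (c^*%C * unity N ^+ j).
  have h : cabs ((unity N : C) ^+ j) ^+ 2 = 1 by rewrite cabs_unityX expr1n.
  case: (_ ^+ j) h => a b; rewrite !cabs_sqr /= => h.
  case: c => u v /=.
  have -> : rho ^+ 2 = rho ^+ 2 * (a ^+ 2 + b ^+ 2) by rewrite h mulr1.
  by ring.
under eq_bigr do rewrite E.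
rewrite big_split /= -mulr_sumr -raddf_sum -mulr_sumr S0 mulr0 /= mulr0 addr0.
by rewrite sumr_const card_ord mulr_natl.
Qed.

(* [nrm (F z) + e * cabs z ^+ 2] is strictly subharmonic, hence has no interior maximum. *)
Lemma no_interior_max F (c : C) (e rho : R) : entire F -> 0 < e -> 0 < rho ->
  ~ (forall w, cabs w = 1 -> nrm (F (c + rho%:C * w)) + e * cabs (c + rho%:C * w) ^+ 2 <=
     nrm (F c) + e * cabs c ^+ 2).
Proof.
move=> Fe e0 rho0 maxc.
(* The approximation error enters twice, on the circle and at the centre, and 2d < e rho^2 gives the
   contradiction. *)
pose d := e * rho ^+ 2 / 4.
have d0 : 0 < d by rewrite divr_gt0 // mulr_gt0 // exprn_gt0.
have [P Pp FP] := Fe (cabs c + rho) _ d0.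
have [N N1 PN] := poly_mean c Pp rho.
have N0 : 0 < N%:R :> R by rewrite ltr0n (ltn_trans _ N1).
have cr : cabs c <= cabs c + rho by rewrite lerDl ltW.
have wr w : cabs w = 1 -> cabs (c + rho%:C * w) <= cabs c + rho.
  by move=> w1; rewrite (le_trans (cabsD _ _)) // cabsM w1 mulr1 cabsR ger0_norm // ltW.
have h1 : N%:R * nrm (P c) <= \sum_(j < N) (nrm (F c) + e * cabs c ^+ 2 + d
    - e * cabs (c + rho%:C * unity N ^+ j) ^+ 2).
  rewrite -cabs_nat -nrmZ PN (le_trans (nrm_sum _ _ _)) //; apply: ler_sum => j _.
  have u1 := @cabs_unityX R N j.
  have := maxc _ u1; have := FP _ (wr _ u1); set z := c + _.
  have := nrmD (P z - F z) (F z); rewrite subrK nrmB; lra.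
rewrite sumrB sumr_const card_ord -mulr_sumr sum_cabs2_circle // -[X in X - _]mulr_natl in h1.
rewrite [X in _ - X]mulrCA -mulrBr ler_pM2l // in h1.
have := nrmD (F c - P c) (P c); rewrite subrK; have := FP _ cr.
have : d * 4 = e * rho ^+ 2 by rewrite divfK.
lra.
Qed.

(** The triangle |y| <= T x, 0 <= x <= r is the image of the rectangle [0, r] x [-1, 1], so its
    compactness reduces to that of segments. The side x = 0 of the rectangle collapses to the
    vertex. *)
Lemma complex_of_param (T : R) : exists z : R * R -> C,
  (forall p, z p = p.1 +i* (p.2 * T * p.1)) /\
  (forall p (d : R), 0 < d -> \forall q \near p, cabs (z p - z q) < d).
Proof.
exists (fun p => p.1 +i* (p.2 * T * p.1)); split => // p d d0.
pose g (q : R * R) := `|p.1 - q.1| + `|p.2 * T * p.1 - q.2 * T * q.1|.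
have gc : {for p, continuous g}.
  apply: continuousD.
    apply: continuous_comp; last exact: norm_continuous.
    by apply: continuousB; [exact: cst_continuous|exact: cvg_fst].
  apply: continuous_comp; last exact: norm_continuous.
  apply: continuousB; first exact: cst_continuous.
  apply: continuousM; last exact: cvg_fst.
  by apply: continuousM; [exact: cvg_snd|exact: cst_continuous].
have g0 : g p = 0 by rewrite /g !subrr normr0 addr0.
have := gc => /cvgrPdist_lt /(_ d d0); rewrite g0.
apply: filterS => q; rewrite sub0r normrN => h.
by rewrite (le_lt_trans (cabs_le_ReIm _)) //= (le_lt_trans (ler_norm _)).
Qed.

(** The perturbed norm [u] attains its maximum on the compact parameter rectangle, and
    [no_interior_max] sends the maximum point to the boundary. The perturbation is at most e (r + T
    r)^2, and [e] is arbitrary. *)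
Lemma max_principle_triangle F (T r M : R) : entire F -> 0 < T -> 0 < r ->
  (forall x y, 0 <= x <= r -> `|y| = T * x -> nrm (F (x +i* y)) <= M) ->
  (forall y, `|y| <= T * r -> nrm (F (r +i* y)) <= M) ->
  forall x y, 0 <= x <= r -> `|y| <= T * x -> nrm (F (x +i* y)) <= M.
Proof.
move=> Fe T0 r0 Mside Mend.
have [z [zE zc]] := complex_of_param T.
pose A : set (R * R) := `[0, r]%classic `*` `[-1, 1]%classic.
have A0 : A !=set0 by exists (0, 0); split; rewrite /= in_itv /= ?lexx ?(ltW r0) //; lra.
have Ac : compact A by apply: compact_setX; exact: segment_compact.
suff H xa sa e : 0 < e -> A (xa, sa) ->
    nrm (F (z (xa, sa))) <= M + e * (r + T * r) ^+ 2.
  move=> x y /andP[x0 xr] yx.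
  pose s := if x == 0 then 0 else y / (T * x).
  have sE : y = s * T * x.
    rewrite /s; case: eqVneq => [xE|xN].
      by move: yx; rewrite xE !mulr0 normr_le0 => /eqP.
    by rewrite -mulrA divfK // mulf_neq0 // gt_eqF.
  have Axs : A (x, s).
    split; rewrite /= in_itv /= ?x0 ?xr //.
    rewrite /s; case: eqVneq => [xE|xN]; first lra.
    have x1 : 0 < x by rewrite lt_neqAle eq_sym xN.
    rewrite -ler_norml normrM normfV [`|T * x|]ger0_norm ?ler_pdivrMr ?mul1r ?mulr_gt0 //.
    by rewrite ltW // mulr_gt0.
  have rT : 0 < (r + T * r) ^+ 2 by rewrite exprn_gt0 // addr_gt0 // mulr_gt0.
  apply/ler_addgt0Pr => e e0.
  have := H x s (e / (r + T * r) ^+ 2) (divr_gt0 e0 rT) Axs.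
  by rewrite zE /= -sE divfK // gt_eqF.
move=> e0 Axs.
pose u p := nrm (F (z p)) + e * cabs (z p) ^+ 2.
have uc : continuous u.
  move=> p; apply: cvgD.
    apply/cvgrPdist_le => d d0.
    have [dl dl0 Fd] := entire_ucontinuous Fe (cabs (z p) + 1) d0.
    near=> q.
    have h1 : cabs (z p - z q) < dl by near: q; exact: zc.
    have h2 : cabs (z p - z q) < 1 by near: q; exact: zc.
    have h3 : cabs (z q) <= cabs (z p) + 1.
      have := cabsD (z p) (z q - z p); rewrite addrC subrK => h.
      by rewrite (le_trans h) // lerD2l -cabsN opprB ltW.
    have h4 : cabs (z p) <= cabs (z p) + 1 by rewrite lerDl.
    have := Fd _ _ h4 h3 (ltW h1) => h5.
    have := nrmD (F (z p) - F (z q)) (F (z q)); rewrite subrK.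
    have := nrmD (F (z q) - F (z p)) (F (z p)); rewrite subrK nrmB.
    by rewrite ler_norml => *; apply/andP; split; lra.
  have cc : cabs (z q) @[q --> p] --> cabs (z p).
    apply/cvgrPdist_le => d d0; near=> q.
    have h1 : cabs (z p - z q) < d by near: q; exact: zc.
    have := cabsD (z p - z q) (z q); rewrite subrK.
    have := cabsD (z q - z p) (z p); rewrite subrK -(cabsN (z q - _)) opprB.
    by rewrite ler_norml => *; apply/andP; split; lra.
  by apply: cvgM; [exact: cvg_cst|exact: (cvgM cc cc)].
have [[x s] Ac0 umax] := compact_EVT_max A0 Ac (continuous_subspaceT uc).
move: Ac0; rewrite inE => -[/=]; rewrite !in_itv /= => /andP[x0 xr] /andP[s1 s1'].
have zn (w : C) : 0 <= complex.Re w <= r -> `|complex.Im w| <= T * complex.Re w ->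
   cabs w <= r + T * r.
  move=> /andP[w0 wr] wT; rewrite (le_trans (cabs_le_ReIm _)) // lerD //.
    by rewrite ger0_norm.
  by rewrite (le_trans wT) // ler_wpM2l // ltW.
have sT : `|s * T * x| <= T * x.
  rewrite -mulrA normrM (ger0_norm (mulr_ge0 (ltW T0) x0)).
  by rewrite ler_piMl ?mulr_ge0 ?(ltW T0) // ler_norml s1.
have key : nrm (F (z (x, s))) <= M.
  rewrite zE /=.
  have [xE|x0'] := eqVneq x 0.
    by apply: Mside; rewrite ?x0 // xE !mulr0 normr0.
  have [xE|xr'] := eqVneq x r.
    by rewrite xE; apply: Mend; rewrite -xE.
  have [sE|ss] := eqVneq `|s| 1.
    apply: Mside; rewrite ?x0 //.
    by rewrite -mulrA normrM sE mul1r ger0_norm // mulr_ge0 // ltW.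
  exfalso.
  have x1 : 0 < x by rewrite lt_neqAle eq_sym x0'.
  have xr1 : x < r by rewrite lt_neqAle xr'.
  have ss1 : `|s| < 1 by rewrite lt_neqAle ss ler_norml s1.
  (* A displacement of size rho raises |y| by at most rho and lowers the height T x by at most T
     rho; rho (1 + T) <= T x (1 - |s|) therefore keeps the circle between the slanted sides. *)
  pose m := T * x * (1 - `|s|) / (1 + T).
  have m0 : 0 < m by rewrite divr_gt0 ?mulr_gt0 ?subr_gt0 // addr_gt0.
  pose rho := Num.min (Num.min x (r - x)) m.
  have rho0 : 0 < rho by rewrite !lt_min x1 m0 subr_gt0 xr1.
  have rx : rho <= x by rewrite !ge_min lexx.
  have rrx : rho <= r - x by rewrite !ge_min lexx orbT.
  have rm : rho * (1 + T) <= T * x * (1 - `|s|).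
    by rewrite -ler_pdivlMr ?addr_gt0 // ge_min lexx orbT.
  apply: (@no_interior_max F (z (x, s)) e rho Fe e0 rho0) => -[a b] ab.
  have ha : `|a| <= 1 by rewrite -ab; exact: (Re_le_cabs (a +i* b)).
  have hb : `|b| <= 1 by rewrite -ab; exact: (Im_le_cabs (a +i* b)).
  pose x' := x + rho * a; pose y' := s * T * x + rho * b.
  have zE' : z (x, s) + rho%:C * (a +i* b) = x' +i* y'.
    rewrite zE /x' /y'; apply/eqP; rewrite eq_complex /=.
    by apply/andP; split; apply/eqP; ring.
  have ra : `|rho * a| <= rho by rewrite normrM ger0_norm ?(ltW rho0) // ler_piMr // ltW.
  have rb : `|rho * b| <= rho by rewrite normrM ger0_norm ?(ltW rho0) // ler_piMr // ltW.
  have ra' := ra; rewrite ler_norml in ra'; case/andP: ra' => ra1 ra2.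
  have x'0 : 0 <= x' by rewrite /x'; lra.
  have x'r : x' <= r by rewrite /x'; lra.
  have y'x : `|y'| <= T * x'.
    rewrite (le_trans (ler_normD _ _)) // -mulrA normrM (ger0_norm (mulr_ge0 (ltW T0) x0)).
    have : T * (x - rho) <= T * x' by rewrite ler_wpM2l ?(ltW T0) // /x'; lra.
    have : `|s| * (T * x) = T * x - T * x * (1 - `|s|) by ring.
    lra.
  (* At the vertex the second parameter cannot be recovered by division; [(0, 0)] represents that
     point. *)
  have [x'E|x'N] := eqVneq x' 0.
    have y'E : y' = 0 by move: y'x; rewrite x'E mulr0 normr_le0 => /eqP.
    have := umax (0, 0) ltac:(by rewrite inE; split; rewrite /= in_itv /= ?lexx ?(ltW r0) //; lra).
    by rewrite /u !zE' x'E y'E [z (0, 0)]zE /= mulr0.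
  have x'1 : 0 < x' by rewrite lt_neqAle eq_sym x'N.
  have Tx' : 0 < T * x' by rewrite mulr_gt0.
  have : (x', y' / (T * x')) \in A.
    rewrite inE; split; rewrite /= in_itv /= ?x'0 ?x'r // -ler_norml normrM normfV.
    by rewrite [`|T * x'|]ger0_norm ?(ltW Tx') // ler_pdivrMr // mul1r.
  move/umax; rewrite /u !zE'.
  by rewrite [z (x', _)]zE /= -[_ / _ * T * _]mulrA divfK // gt_eqF.
have := umax (xa, sa) (mem_set Axs); rewrite /u => h.
have : e * cabs (z (x, s)) ^+ 2 <= e * (r + T * r) ^+ 2.
  rewrite ler_wpM2l ?(ltW e0) // lerXn2r ?nnegrE ?cabs_ge0 //.
    by rewrite addr_ge0 ?mulr_ge0 ?ltW.
  by apply: zn; rewrite zE /= ?x0.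
have : 0 <= e * cabs (z (xa, sa)) ^+ 2 by rewrite mulr_ge0 ?(ltW e0) // exprn_ge0 ?cabs_ge0.
lra.
Unshelve. all: by end_near. Qed.

Lemma polar (x y : R) : 0 < x -> exists2 t : R, `|t| < pi / 2 /\ tan t = y / x
  & exists2 r : R, x <= r & x +i* y = r%:C * expi t.
Proof.
move=> x0; set t := y / x; exists (atan t).
  by split; [rewrite ltr_norml atan_ltpi2 andbT atan_gtNpi2|rewrite atanK].
have s1 : 1 <= Num.sqrt (1 + t ^+ 2).
  by rewrite -[leLHS]sqrtr1 ler_sqrt ?addr_ge0 ?sqr_ge0 // lerDl sqr_ge0.
have s0 : Num.sqrt (1 + t ^+ 2) != 0 by rewrite gt_eqF // (lt_le_trans _ s1).
have c0 : cos (atan t) != 0 by rewrite cos_atan invr_eq0.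
exists (x * Num.sqrt (1 + t ^+ 2)); first by rewrite ler_peMr // ltW.
have sE : sin (atan t) = t * cos (atan t) by rewrite -{2}(atanK t) /tan divfK.
apply/eqP; rewrite eq_complex /= sE cos_atan !mul0r subr0 addr0.
apply/andP; split; apply/eqP; first by rewrite mulfK.
by rewrite mulrACA mulfV // mulr1 mulrC /t divfK // gt_eqF.
Qed.

Lemma cos_pos (t : R) : `|t| < pi / 2 -> 0 < cos t.
Proof. by rewrite ltr_norml => h; rewrite cos_gt0_pihalf. Qed.

Lemma cos_abs (t : R) : cos `|t| = cos t.
Proof. by have [_|_] := ger0P t; rewrite ?cosN. Qed.

Lemma cos_le_abs (s t : R) : `|s| <= t -> t <= pi -> cos t <= cos s.
Proof.
move=> st tp; rewrite -(cos_abs s).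
have [->//|ne] := eqVneq `|s| t.
rewrite ltW // ltr_cos ?in_itv /= ?normr_ge0 ?(le_trans st tp) ?tp ?andbT //.
  by rewrite lt_neqAle ne.
by rewrite (le_trans _ st).
Qed.

Lemma polarX (r t : R) k : (r%:C * expi t) ^+ k = (r ^+ k)%:C * expi (k%:R * t) :> C.
Proof. by rewrite exprMn expiX rmorphXn. Qed.

(** Removes an auxiliary factor by letting [e] tend to 0, for [m] of either sign: a (1 - e m) <= a
    exp(- e m) <= A. *)
Lemma le_of_exp_le (a A m : R) : 0 <= a ->
  (forall e, 0 < e -> a <= A * expR (e * m)) -> a <= A.
Proof.
move=> a0 H; apply/ler_addgt0Pr => d d0.
pose e := d / (a * `|m| + 1).
have n0 : 0 < a * `|m| + 1 by rewrite ltr_wpDl // mulr_ge0.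
have e0 : 0 < e by rewrite divr_gt0.
have E : expR (e * m) * expR (- (e * m)) = 1 by rewrite -expRD subrr expR0.
have := ler_wpM2r (expR_ge0 (- (e * m))) (H e e0); rewrite -[leRHS]mulrA E mulr1 => h.
have : a * (1 + (- (e * m))) <= a * expR (- (e * m)) by rewrite ler_wpM2l // expR_ge1Dx.
have : e * (a * `|m| + 1) = d by rewrite divfK // gt_eqF.
have : a * (e * m) <= e * (a * `|m|).
  by rewrite mulrCA ler_wpM2l ?(ltW e0) // ler_wpM2l // ler_norm.
lra.
Qed.

(** On the sector the real part of z^(q+1) is at least |z|^(q+1) cos((q+1) g), which is positive
    away from 0; hence exp(- e z^(q+1)) is bounded by 1 and beats growth of order [q]. An integer
    exponent keeps this factor entire. The maximum principle is applied to the triangle cut off at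
    abscissa [L], then [e] tends to 0. *)
Lemma phragmen_lindelof F (g A B : R) (q : nat) : entire F -> 0 < g ->
  q.+1%:R * g < pi / 2 -> 0 <= B ->
  (forall r t : R, 0 <= r -> `|t| <= g -> nrm (F (r%:C * expi t)) <= A * expR (B * r ^+ q)) ->
  (forall r t : R, 0 <= r -> `|t| = g -> nrm (F (r%:C * expi t)) <= A) ->
  forall r t : R, 0 <= r -> `|t| <= g -> nrm (F (r%:C * expi t)) <= A.
Proof.
move=> Fe g0 pg B0 growth rays r0 t0 r00 t0g.
have A0 : 0 <= A by rewrite (le_trans _ (rays 0 g (lexx _) _)) ?nrm_ge0 // ger0_norm // ltW.
have g2 : g < pi / 2.
  by rewrite (le_lt_trans _ pg) // ler_peMl ?(ltW g0) // ler1n.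
have cg : 0 < cos g by rewrite cos_pos // ger0_norm // ltW.
have cpg : 0 < cos (q.+1%:R * g) by rewrite cos_pos // ger0_norm // mulr_ge0 // ltW.
have sg : 0 < sin g by rewrite sin_gt0_pihalf // g0.
pose T := sin g / cos g.
have T0 : 0 < T by rewrite divr_gt0.
have pi0 := @pi_gt0 R.
have pgpi : q.+1%:R * g <= pi by lra.
have cost (t : R) : `|t| <= g -> cos (q.+1%:R * g) <= cos (q.+1%:R * t).
  by move=> tg; rewrite cos_le_abs // normrM ger0_norm // ler_wpM2l.
have modE (e r t : R) : cabs (cexp ((- e)%:C * (r%:C * expi t) ^+ q.+1)) =
    expR (- (e * (r ^+ q.+1 * cos (q.+1%:R * t)))).
  by rewrite cabs_cexp polarX /=; congr expR; ring.
apply: (@le_of_exp_le _ A (r0 ^+ q.+1 * cos (q.+1%:R * t0))); first exact: nrm_ge0.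
move=> e e0.
pose G (z : C) := cexp ((- e)%:C * z ^+ q.+1) *: F z.
have Ge : entire G by exact: entire_cexpM.
suff : nrm (G (r0%:C * expi t0)) <= A.
  rewrite nrmZ modE mulrC -ler_pdivlMr ?expR_gt0 //.
  by rewrite expRN invrK.
have ec : 0 < e * cos (q.+1%:R * g) by rewrite mulr_gt0.
(* The last term makes e cos((q+1) g) r >= B on the far edge, where r >= L, so the factor dominates
   the growth there; [r0] puts the given point inside the triangle. *)
pose L : R := 1 + r0 + B / (e * cos (q.+1%:R * g)).
have Bec : 0 <= B / (e * cos (q.+1%:R * g)) by rewrite divr_ge0 // ltW.
have L0 : 0 < L by rewrite /L; lra.
have Grt (r t : R) : 0 <= r -> `|t| = g -> nrm (G (r%:C * expi t)) <= A.
  move=> rr tg; have tg' : `|t| <= g by rewrite tg.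
  have c0 : 0 <= cos (q.+1%:R * t) := le_trans (ltW cpg) (cost _ tg').
  rewrite nrmZ modE -[leRHS]mul1r.
  apply: ler_pM; rewrite ?expR_ge0 ?nrm_ge0 //; last exact: rays.
  rewrite -[leRHS]expR0 ler_expR oppr_le0.
  by apply: mulr_ge0; [exact: ltW|apply: mulr_ge0 => //; exact: exprn_ge0].
have E : r0%:C * expi t0 = (r0 * cos t0) +i* (r0 * sin t0).
  by apply/eqP; rewrite eq_complex /=; apply/andP; split; apply/eqP; ring.
have ct0 : 0 < cos t0 by rewrite cos_pos // (le_lt_trans t0g).
rewrite E; apply: (max_principle_triangle Ge T0 L0).
- move=> x y /andP[x0 _] yT.
  pose t := if 0 <= y then g else - g.
  have -> : x +i* y = (x / cos g)%:C * expi t.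
    apply/eqP; rewrite eq_complex /= !mul0r subr0 addr0.
    have -> : cos t = cos g by rewrite /t; case: ifP; rewrite ?cosN.
    apply/andP; split; apply/eqP; first by rewrite divfK // gt_eqF.
    rewrite /t; have [y0|y0] := leP 0 y.
      by rewrite -[LHS]ger0_norm // yT /T; field; rewrite gt_eqF.
    rewrite sinN -[LHS]opprK -[- y]ltr0_norm // yT /T; field; by rewrite gt_eqF.
  apply: Grt; first by rewrite divr_ge0 // ltW.
  by rewrite /t; case: ifP => _; rewrite ?normrN ger0_norm ?ltW.
- move=> y yT; have [t [t2 tE] [r rL ->]] := polar y L0.
  have ct : 0 < cos t by exact: cos_pos.
  have tg : `|t| <= g.
    have tT : `|tan t| <= tan g.
      by rewrite tE normrM normfV [`|L|]ger0_norm ?(ltW L0) // ler_pdivrMr.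
    have tI : `|t| \in `](- (pi / 2)), (pi / 2)[.
      by rewrite in_itv /= t2 andbT (lt_le_trans _ (normr_ge0 t)) //; lra.
    have gI : g \in `](- (pi / 2)), (pi / 2)[.
      by rewrite in_itv /= g2 andbT; lra.
    rewrite -(tanK tI) -(tanK gI) le_atan //.
    have -> // : tan `|t| = `|tan t|.
    rewrite /tan cos_abs normrM normfV [`|cos t|]ger0_norm ?(ltW ct) //; congr (_ / _).
    have [tt|tt] := ger0P t; last first.
      rewrite sinN -normrN ger0_norm // -sinN sin_ge0_pi // oppr_ge0 (ltW tt) /=.
      by move: t2; rewrite ltr0_norm //; lra.
    by rewrite ger0_norm // sin_ge0_pi // tt /=; move: t2; rewrite ger0_norm //; lra.
  have r0' : 0 <= r by rewrite (le_trans _ rL) // ltW.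
  rewrite nrmZ modE (le_trans (ler_wpM2l (expR_ge0 _) (growth _ _ r0' tg))) //.
  rewrite mulrCA -expRD -[leRHS]mulr1 ler_wpM2l // -[leRHS]expR0 ler_expR.
  have h1 : e * (r ^+ q.+1 * cos (q.+1%:R * g)) <= e * (r ^+ q.+1 * cos (q.+1%:R * t)).
    by rewrite ler_wpM2l ?(ltW e0) // ler_wpM2l ?exprn_ge0 // cost.
  have h2 : B <= e * cos (q.+1%:R * g) * r.
    rewrite mulrC -ler_pdivrMr // (le_trans _ rL) // /L; lra.
  have h3 : B * r ^+ q <= e * cos (q.+1%:R * g) * r * r ^+ q by rewrite ler_wpM2r ?exprn_ge0.
  have h4 : e * (r ^+ q.+1 * cos (q.+1%:R * g)) = e * cos (q.+1%:R * g) * r * r ^+ q.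
    by rewrite exprS; ring.
  lra.
- rewrite mulr_ge0 ?(ltW ct0) //= (@le_trans _ _ r0) //.
    by rewrite ler_piMr // cos_le1.
  by rewrite /L; lra.
rewrite normrM (ger0_norm r00) mulrCA ler_wpM2l //.
rewrite /T mulrAC ler_pdivlMr //.
rewrite -[cos g in leLHS](ger0_norm (ltW cg)) -normrM ler_norml.
move: t0g; rewrite ler_norml => /andP[t1 t2].
(* The point lies under the slanted sides: |cos g sin t0| <= sin g cos t0 is the nonnegativity of
   sin(g - t0) and sin(g + t0). *)
have h1 : 0 <= sin (g - t0) by rewrite sin_ge0_pi //; lra.
have h2 : 0 <= sin (g + t0) by rewrite sin_ge0_pi //; lra.
rewrite sinB in h1; rewrite sinD in h2; apply/andP; split; lra.
Qed.

End PhragmenLindelof.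

(** * Constancy of entire functions satisfying Hardy's growth bounds *)

Section HardyEntire.
Context {R : realType}.
Local Notation C := R[i].
Context {X : normedModType C}.
Implicit Types F : C -> X.

Lemma exists_root (r : R) (q : nat) : 0 <= r -> (0 < q)%N -> exists2 s : R, 0 <= s & s ^+ q = r.
Proof.
move=> r0 q0; exists (r `^ q%:R^-1); first exact: powR_ge0.
by rewrite -powR_mulrn ?powR_ge0 // -powRrM mulVf ?powRr1 // pnatr_eq0 -lt0n.
Qed.

(** cos 2p <= 0 gives sin^2 p >= 1/2. The cruder 1/2 for the sine is what the outer ray of
    [hardy_sector] consumes. *)
Lemma sin_ge_half (p : R) : pi / 4 <= p -> p <= pi / 2 -> 2^-1 <= sin p.
Proof.
move=> p4 p2; have pi0 := @pi_gt0 R.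
have c2 : cos (p *+ 2) <= 0.
  rewrite -(@cos_pihalf R); have -> : p *+ 2 = 2 * p by rewrite mulr_natl.
  by apply: cos_le_abs; rewrite ?ger0_norm; lra.
rewrite cos_mulr2n in c2.
have s0 : 0 <= sin p by rewrite sin_ge0_pi //; lra.
have := cos2Dsin2 p => cs.
rewrite leNgt; apply/negP => s2.
have : sin p * sin p <= 2^-1 * 2^-1 by rewrite ler_pM // ltW.
by rewrite -expr2; lra.
Qed.

(* Phragmen-Lindelof for the sector [0 <= sg * arg z <= pi / 2 - d] applied to
   [cexp (i sg kappa z^2) F z]; the substitution [z = exp(i sg (pi/2-d)/2) zeta^q]
   turns the order 2 of F into the integer order 2q on a sector of
   half-opening pi/(4(q+1)) < pi/(2(2q+1)). *)
Lemma hardy_sector F (sg A b : R) (q : nat) : entire F -> 0 <= b -> (0 < q)%N ->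
  sg = 1 \/ sg = -1 ->
  (forall x y, nrm (F (x +i* y)) <= A * expR (b * x ^+ 2)) ->
  (forall x : R, nrm (F x%:C) <= A) ->
  forall r t, 0 <= r -> 0 <= t <= pi / 2 - pi / (2 * q.+1%:R) ->
  nrm (F (r%:C * expi (sg * t))) <=
    A * expR (b * (pi / (2 * q.+1%:R)) * r ^+ 2).
Proof.
move=> Fe b0 q0 sg1 Fgrowth Freal r t r0 /andP[t0 tphi].
have pi0 := @pi_gt0 R.
have sg2 : sg * sg = 1 by case: sg1 => ->; ring.
have q1 : (0 : R) < q.+1%:R by rewrite ltr0n.
have qR : (1 : R) <= q%:R by rewrite ler1n.
(* With d (q + 1) = pi/2 the opening [phi] = pi/2 - d equals q d exactly, so zeta^q carries a sector
   of opening [d] onto one of opening [phi]. *)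
set d := pi / (2 * q.+1%:R) in tphi *.
have dE : d * (q%:R + 1) = pi / 2.
  by rewrite /d -natr1; field; lra.
have d0 : 0 < d by rewrite divr_gt0 // mulr_gt0.
have d4 : d <= pi / 4.
  have : d * 1 <= d * q%:R by rewrite ler_wpM2l // ltW.
  lra.
set phi := pi / 2 - d in tphi.
have phiE : phi = d * q%:R by rewrite /phi; lra.
have sinphi : 2^-1 <= sin phi by rewrite sin_ge_half // /phi; lra.
have cphi : 0 <= cos phi <= d.
  by rewrite /phi -cosN opprB cosBpihalf sin_ge0_pi ?sin_le //= ?(ltW d0) //; lra.
case/andP: cphi => cphi0 cphid.
(* On the outer ray kap sin(2 phi) = 2 b sin(phi) cos^2(phi) >= b cos^2(phi), so the factor absorbs
   the growth of [F]; and cos phi <= d keeps the price of removing it small. *)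
pose kap := b * cos phi.
have kap0 : 0 <= kap by rewrite mulr_ge0.
pose c : C := (sg * kap)%:C * 'i.
pose G z := cexp (c * z ^+ 2) *: F z.
pose P : {poly C} := expi (sg * (phi / 2)) *: 'X^q.
pose H z := G P.[z].
have He : entire H by apply: entire_comp; apply: entire_cexpM.
have modE (u v : R) : cabs (cexp (c * (u%:C * expi (sg * v)) ^+ 2)) =
    expR (- (kap * u ^+ 2 * sin (2 * v))).
  rewrite cabs_cexp polarX /=; congr expR.
  have -> : sin (2%:R * (sg * v)) = sg * sin (2 * v).
    by case: sg1 => ->; rewrite ?mul1r // mulN1r mulrN sinN mulN1r.
  have -> : kap * u ^+ 2 * sin (2 * v) = sg * sg * (kap * u ^+ 2 * sin (2 * v)).
    by rewrite sg2 mul1r.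
  by rewrite -expr2; ring.
have Fgrowth' (u v : R) : nrm (F (u%:C * expi (sg * v))) <= A * expR (b * (u ^+ 2 * cos v ^+ 2)).
  have -> : u%:C * expi (sg * v) = (u * cos v) +i* (u * sin (sg * v)).
    have cv : cos (sg * v) = cos v by case: sg1 => ->; rewrite ?mul1r // mulN1r cosN.
    by apply/eqP; rewrite eq_complex /= cv; apply/andP; split; apply/eqP; ring.
  by rewrite (le_trans (Fgrowth _ _)) // exprMn.
have A0 : 0 <= A by rewrite (le_trans _ (Freal 0)) ?nrm_ge0.
have HE (s tau : R) : H (s%:C * expi tau) =
    G ((s ^+ q)%:C * expi (sg * (phi / 2 + sg * (q%:R * tau)))).
  rewrite /H /P hornerZ hornerXn polarX mulrCA -expiD; congr (G (_ * expi _)).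
  by rewrite mulrDr [sg * (sg * _)]mulrA sg2 mul1r.
have Hbound : forall s tau : R, 0 <= s -> `|tau| <= d / 2 -> nrm (H (s%:C * expi tau)) <= A.
  apply: (@phragmen_lindelof _ _ H (d / 2) A b (2 * q) He) => //.
  - by rewrite divr_gt0.
  - rewrite -natr1 natrM.
    have -> : (2 * q%:R + 1) * (d / 2) = d * (q%:R + 1) - d / 2 by field.
    by rewrite dE; lra.
  - move=> s tau s0 taud; rewrite HE nrmZ modE.
    set v := phi / 2 + _; set u := s ^+ q.
    have vb : 0 <= v <= phi.
      have : `|sg * (q%:R * tau)| <= phi / 2.
        rewrite normrM; have -> : `|sg| = 1 by case: sg1 => ->; rewrite ?normrN normr1.
        rewrite mul1r normrM ger0_norm // phiE.
        have : q%:R * `|tau| <= q%:R * (d / 2) by rewrite ler_wpM2l.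
        lra.
      by rewrite ler_norml /v => /andP[h1 h2]; apply/andP; split; lra.
    case/andP: vb => v0 vphi.
    have sv : 0 <= sin (2 * v) by rewrite sin_ge0_pi // /phi; move: vphi; rewrite /phi; lra.
    rewrite exprM -[s ^+ 2 ^+ q]exprM mulnC exprM -/u.
    rewrite -[leLHS]mulrC (le_trans (ler_wpM2r (expR_ge0 _) (Fgrowth' _ _))) //.
    rewrite -[leLHS]mulrA -expRD ler_wpM2l // ler_expR.
    have h1 : u ^+ 2 * cos v ^+ 2 <= u ^+ 2 * 1.
      apply: ler_wpM2l; first exact: sqr_ge0.
      have -> : 1 = cos v ^+ 2 + sin v ^+ 2 by rewrite cos2Dsin2.
      by rewrite lerDl sqr_ge0.
    have h2 : b * (u ^+ 2 * cos v ^+ 2) <= b * (u ^+ 2 * 1) by rewrite ler_wpM2l.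
    have h3 : 0 <= kap * u ^+ 2 * sin (2 * v) by rewrite mulr_ge0 // mulr_ge0 // sqr_ge0.
    lra.
  - move=> s tau s0 taud; rewrite HE nrmZ modE; set u := s ^+ q.
    (* The first ray is mapped to the outer ray at angle [phi], the second to the positive real
       axis, where the factor has modulus 1. *)
    have : sg * tau = d / 2 \/ sg * tau = - (d / 2).
      have := taud; have [_ h|_ h] := ger0P tau.
        by case: sg1 => ->; rewrite h; [left|right]; ring.
      by case: sg1 => ->; rewrite -h; [right|left]; ring.
    rewrite [sg * (q%:R * tau)]mulrCA => -[] ->.
      have -> : phi / 2 + q%:R * (d / 2) = phi by rewrite phiE; field.
      rewrite mulrC (le_trans (ler_wpM2r (expR_ge0 _) (Fgrowth' _ _))) //.
      rewrite -[leLHS]mulrA -expRD -[leRHS]mulr1 ler_wpM2l // -[leRHS]expR0 ler_expR.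
      have -> : sin (2 * phi) = 2 * sin phi * cos phi.
        by rewrite mulr_natl mulr2n sinD; ring.
      have : 0 <= b * u ^+ 2 * cos phi ^+ 2 * (2 * sin phi - 1).
        apply: mulr_ge0; last lra.
        by apply: mulr_ge0; [apply: mulr_ge0 => //|]; exact: sqr_ge0.
      by rewrite /kap; lra.
    have -> : phi / 2 + q%:R * - (d / 2) = 0 by rewrite phiE; field.
    rewrite !mulr0 sin0 expi0 mulr1 mulr0 oppr0 expR0 mul1r.
    exact: Freal.
have [s s0 sq] := exists_root r0 q0.
pose tau := sg * ((t - phi / 2) / q%:R).
have q0' : (q%:R : R) != 0 by rewrite pnatr_eq0 -lt0n.
have := Hbound s tau s0.
rewrite HE sq.
have -> : phi / 2 + sg * (q%:R * tau) = t.
  have -> : sg * (q%:R * tau) = (sg * sg) * (t - phi / 2) by rewrite /tau; field.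
  by rewrite sg2; lra.
rewrite nrmZ modE => h.
have {h} : expR (- (kap * r ^+ 2 * sin (2 * t))) * nrm (F (r%:C * expi (sg * t))) <= A.
  apply: h; rewrite /tau normrM; have -> : `|sg| = 1 by case: sg1 => ->; rewrite ?normrN normr1.
  rewrite mul1r normrM normfV [`|q%:R|]ger0_norm // ler_pdivrMr ?ltr0n //.
  rewrite ler_norml; apply/andP; split; move: tphi; rewrite phiE; lra.
rewrite mulrC -ler_pdivlMr ?expR_gt0 // expRN invrK => h.
rewrite (le_trans h) // ler_wpM2l // ler_expR.
have : kap * r ^+ 2 * sin (2 * t) <= kap * r ^+ 2 * 1.
  by rewrite ler_wpM2l ?sin_le1 // mulr_ge0 // sqr_ge0.
have : kap * r ^+ 2 <= b * d * r ^+ 2.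
  by rewrite ler_wpM2r ?sqr_ge0 // ler_wpM2l.
lra.
Qed.

(** Any angle below pi/2 lies in the sectors of [hardy_sector] once [q] is large, and their error
    exponent tends to 0. The imaginary axis is read off the growth bound at x = 0. *)
Lemma hardy_quadrant F (sg A b : R) : entire F -> 0 <= b ->
  sg = 1 \/ sg = -1 ->
  (forall x y, nrm (F (x +i* y)) <= A * expR (b * x ^+ 2)) ->
  (forall x : R, nrm (F x%:C) <= A) ->
  forall r t, 0 <= r -> 0 <= t <= pi / 2 -> nrm (F (r%:C * expi (sg * t))) <= A.
Proof.
move=> Fe b0 sg1 Fgrowth Freal r t r0 /andP[t0 tpi]; have pi0 := @pi_gt0 R.
have [tE|tN] := eqVneq t (pi / 2).
  have := Fgrowth 0 (r * sin (sg * t)); rewrite expr0n mulr0 expR0 mulr1.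
  suff -> : r%:C * expi (sg * t) = 0 +i* (r * sin (sg * t)) by [].
  have cv : cos (sg * t) = 0.
    by rewrite tE; case: sg1 => ->; rewrite ?mul1r ?mulN1r ?cosN cos_pihalf.
  by apply/eqP; rewrite eq_complex /= cv; apply/andP; split; apply/eqP; ring.
have tlt : t < pi / 2 by rewrite lt_neqAle tN.
apply: (@le_of_exp_le _ _ A 1); first exact: nrm_ge0.
move=> e e0; rewrite mulr1.
have n0 : 0 < b * r ^+ 2 + 1 by rewrite ltr_wpDl // mulr_ge0 // sqr_ge0.
(* The first bound keeps [t] inside the sector, the second makes the error exponent at most [e]. *)
pose dl := Num.min (pi / 2 - t) (e / (b * r ^+ 2 + 1)).
have dl0 : 0 < dl by rewrite lt_min subr_gt0 tlt divr_gt0.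
pose q := (Num.truncn (pi / (2 * dl))).+1.
have dq : pi / (2 * q.+1%:R) <= dl.
  rewrite ler_pdivrMr ?mulr_gt0 //.
  have : pi / (2 * dl) < q%:R by exact: truncnS_gt.
  rewrite ltr_pdivrMr ?mulr_gt0 // => h.
  have : dl * q%:R <= dl * q.+1%:R by rewrite ler_wpM2l ?(ltW dl0) // ler_nat.
  lra.
have dq0 : 0 < pi / (2 * q.+1%:R) :> R by rewrite divr_gt0 // mulr_gt0.
have A0 : 0 <= A by rewrite (le_trans _ (Freal 0)) ?nrm_ge0.
have dl1 : dl <= pi / 2 - t by rewrite ge_min lexx.
have dl2 : dl <= e / (b * r ^+ 2 + 1) by rewrite ge_min lexx orbT.
have tq : 0 <= t <= pi / 2 - pi / (2 * q.+1%:R) by rewrite t0 lerBrDl -lerBrDr (le_trans dq).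
apply: le_trans (@hardy_sector F sg A b q Fe b0 isT sg1 Fgrowth Freal r t r0 tq) _.
rewrite ler_wpM2l // ler_expR.
set d := pi / _ in dq dq0 *.
have h1 : d * (b * r ^+ 2 + 1) <= e by rewrite -ler_pdivlMr // (le_trans dq).
have : b * d * r ^+ 2 = d * (b * r ^+ 2) by ring.
lra.
Qed.

(** [F] is bounded by [A] on the whole plane, hence constant: [sg] covers the upper and lower
    quadrants on the right, and composition with [- 'X] brings the left half-plane there. *)
Lemma hardy_entire F (A b : R) : entire F -> 0 <= b ->
  (forall x y, nrm (F (x +i* y)) <= A * expR (b * x ^+ 2)) ->
  (forall x : R, nrm (F x%:C) <= A) ->
  forall z, F z = F 0.
Proof.
move=> Fe b0 Fgrowth Freal; have pi0 := @pi_gt0 R.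
have half F' x y : entire F' ->
    (forall x y, nrm (F' (x +i* y)) <= A * expR (b * x ^+ 2)) ->
    (forall x : R, nrm (F' x%:C) <= A) -> 0 <= x -> nrm (F' (x +i* y)) <= A.
  move=> F'e F'growth F'real; rewrite le_eqVlt => /predU1P[<-|x0].
    by have := F'growth 0 y; rewrite expr0n mulr0 expR0 mulr1.
  have [t [t2 _] [r xr ->]] := polar y x0.
  have r0 : 0 <= r by rewrite (le_trans _ xr) // ltW.
  have [sg sg1 ->] : exists2 sg : R, sg = 1 \/ sg = -1 & t = sg * `|t|.
    have [_|_] := ger0P t; [exists 1|exists (-1)]; rewrite ?mul1r ?mulN1r ?opprK //.
      by left.
    by right.
  by apply: (hardy_quadrant F'e b0 sg1 F'growth F'real r0); rewrite normr_ge0 ltW.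
apply: (@liouville _ _ F A) => // -[x y].
have [x0|x0] := leP 0 x; first exact: half.
have -> : F (x +i* y) = F (- 'X).[(- x) +i* (- y)].
  by rewrite hornerN hornerX; congr F; apply/eqP; rewrite eq_complex /= !opprK !eqxx.
apply: (half (fun z => F (- 'X).[z])).
- exact: entire_comp.
- move=> u v; rewrite hornerN hornerX.
  by have := Fgrowth (- u) (- v); rewrite sqrrN.
- by move=> u; rewrite hornerN hornerX; have := Freal (- u); rewrite rmorphN.
by rewrite oppr_ge0 ltW.
Qed.

End HardyEntire.

(** * Bochner integrals *)

Section BochnerIntegral.
Context {R : realType}.
Local Notation C := R[i].
Context {X : normedModType C} {d : measure_display} {T : measurableType d}.
Variable mu : {measure set T -> \bar R}.
Implicit Types (f g : T -> X) (u v y z : X).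

(** Measurability through distances to fixed vectors, so that X carries no sigma-algebra. It
    survives subtraction of simple functions, which is what the error integrals need. *)
Definition dist_measurable f := forall v, measurable_fun setT (fun x => nrm (f x - v)).

Lemma indicZ (A : set T) (x : T) v : ((\1_A x : R)%:C *: v) = if x \in A then v else 0.
Proof. by rewrite indicE; case: (x \in A); rewrite ?scale1r ?scale0r. Qed.

Lemma dist_measurable_sfun f k (A : 'I_k -> set T) (c : 'I_k -> X) :
  dist_measurable f -> (forall i, measurable (A i)) ->
  dist_measurable (fun x => f x - sfun_eval A c x).
Proof.
move=> mf; elim: k A c => [|k ih] A c mA v.
  under eq_fun do rewrite /sfun_eval big_ord0 subr0.
  exact: mf.
pose A' i := A (widen_ord (leqnSn k) i); pose c' i := c (widen_ord (leqnSn k) i).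
have mA' i : measurable (A' i) by exact: mA.
have E : (fun x => nrm (f x - sfun_eval A c x - v)) =
    (fun x => \1_(A ord_max) x * nrm (f x - sfun_eval A' c' x - (v + c ord_max))
      + (1 - \1_(A ord_max) x) * nrm (f x - sfun_eval A' c' x - v)).
  apply/funext => x; rewrite /sfun_eval big_ord_recr /= indicZ indicE.
  case: (x \in A ord_max).
    rewrite mul1r subrr mul0r addr0 !opprD !addrA.
    by congr nrm; exact: addrAC.
  by rewrite mul0r add0r subr0 mul1r addr0.
rewrite E; apply: measurable_funD; apply: measurable_funM.
- exact: measurable_indic.
- exact: (ih A' c').
- by apply: measurable_funB => //; exact: measurable_indic.
- exact: (ih A' c').
Qed.

Lemma dist_measurable_cst u : dist_measurable (fun=> u).
Proof. by move=> v; exact: measurable_cst. Qed.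

Lemma dist_measurable_nrm f : dist_measurable f -> measurable_fun setT (fun x => nrm (f x)).
Proof. by move=> /(_ 0); under eq_fun do rewrite subr0. Qed.

Lemma sfun_measurable k (A : 'I_k -> set T) (c : 'I_k -> X) v :
  (forall i, measurable (A i)) ->
  measurable_fun setT (fun x => nrm (v + sfun_eval A c x)).
Proof.
move=> mA; have := @dist_measurable_sfun (fun=> 0) k A c (dist_measurable_cst 0) mA v.
by under eq_fun do rewrite sub0r -opprD nrmN addrC.
Qed.

Definition sfun_ok k (A : 'I_k -> set T) :=
  forall i, measurable (A i) /\ (mu (A i) < +oo)%E.

(** The sets may overlap, so the inequality cannot be read off piece by piece. Induction on their
    number splits [B] along the last set; the offset [v] collects the values of the sets already
    split off. *)
Lemma sfun_int_le_on k (A : 'I_k -> set T) (c : 'I_k -> X) (B : set T) v :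
  sfun_ok A -> measurable B -> (mu B < +oo)%E ->
  ((nrm ((fine (mu B))%:C *: v + \sum_(i < k) (fine (mu (A i `&` B)))%:C *: c i))%:E
   <= \int[mu]_(x in B) (nrm (v + sfun_eval A c x))%:E)%E.
Proof.
have fineK' D : (mu D < +oo)%E -> mu D \is a fin_num by move=> ?; rewrite ge0_fin_numE.
elim: k A c B v => [|k ih] A c B v okA mB Boo.
  under eq_integral do rewrite /sfun_eval big_ord0 addr0.
  rewrite big_ord0 addr0 integral_cst // nrmZR ger0_norm ?fine_ge0 //.
  by rewrite EFinM fineK ?fineK' // muleC.
pose A' i := A (widen_ord (leqnSn k) i); pose c' i := c (widen_ord (leqnSn k) i).
have okA' : sfun_ok A' by move=> i; exact: okA.
set Am := A ord_max; set cm := c ord_max.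
have [mAm Amoo] : measurable Am /\ (mu Am < +oo)%E := okA ord_max.
have mI : measurable (B `&` Am) by exact: measurableI.
have mD : measurable (B `\` Am) by exact: measurableD.
have Ioo : (mu (B `&` Am) < +oo)%E.
  by rewrite (le_lt_trans _ Boo) // le_measure ?inE //; exact: subIsetl.
have Doo : (mu (B `\` Am) < +oo)%E.
  by rewrite (le_lt_trans _ Boo) // le_measure ?inE //; exact: subDsetl.
have dIJ : [disjoint B `&` Am & B `\` Am].
  by apply/disj_setPS => x [[_ ?] [_ ?]].
have BE : B = (B `&` Am) `|` (B `\` Am) by rewrite setUIDK.
have splitmu D : measurable D -> (mu D < +oo)%E ->
    fine (mu (D `&` B)) = fine (mu (D `&` (B `&` Am))) + fine (mu (D `&` (B `\` Am))).
  move=> mDD Dfin; have fin E : measurable E -> mu (D `&` E) \is a fin_num.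
    move=> mE; apply/fineK'/(le_lt_trans _ Dfin)/le_measure; rewrite ?inE //.
    exact: measurableI.
  rewrite {1}BE setIUr measureU; [|exact: measurableI|exact: measurableI|].
    by rewrite fineD // fin.
  by apply/seteqP; split => x // -[[_ [_ ?]] [_ [_ ?]]].
have mF : measurable_fun (B `&` Am `|` B `\` Am) (fun x => (nrm (v + sfun_eval A c x))%:E).
  by apply/measurable_EFinP/measurable_funTS/sfun_measurable => i; case: (okA i).
rewrite [X in integral _ X _]BE (ge0_integral_setU mu mI mD mF _ dIJ); last first.
  by move=> x _; rewrite lee_fin nrm_ge0.
have E1 : (\int[mu]_(x in B `&` Am) (nrm (v + sfun_eval A c x))%:E =
   \int[mu]_(x in B `&` Am) (nrm ((v + cm) + sfun_eval A' c' x))%:E)%E.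
  apply: eq_integral => x; rewrite inE => -[_ xA]; rewrite /sfun_eval big_ord_recr /=.
  by rewrite indicZ mem_set // -addrA [cm + _]addrC.
have E2 : (\int[mu]_(x in B `\` Am) (nrm (v + sfun_eval A c x))%:E =
   \int[mu]_(x in B `\` Am) (nrm (v + sfun_eval A' c' x))%:E)%E.
  apply: eq_integral => x; rewrite inE => -[_ xA]; rewrite /sfun_eval big_ord_recr /=.
  by rewrite indicZ memNset // addr0.
rewrite E1 E2; apply: le_trans (leeD (ih _ _ _ _ okA' mI Ioo) (ih _ _ _ _ okA' mD Doo)).
rewrite -EFinD lee_fin (le_trans _ (nrmD _ _)) // le_eqVlt; apply/orP; left; apply/eqP.
congr nrm; rewrite addrACA -big_split /= big_ord_recr /= -/cm -/Am.
have -> : \sum_(i < k) ((fine (mu (A' i `&` (B `&` Am))))%:C *: c' i +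
     (fine (mu (A' i `&` (B `\` Am))))%:C *: c' i) =
   \sum_(i < k) (fine (mu (A' i `&` B)))%:C *: c' i.
  apply: eq_bigr => i _; rewrite -scalerDl -rmorphD -splitmu //; first by case: (okA' i).
  by case: (okA' i).
have -> : fine (mu B) = fine (mu (B `&` Am)) + fine (mu (B `\` Am)).
  have := splitmu B mB Boo; rewrite setIid setIA setIid => ->; congr (_ + fine (mu _)).
  by rewrite setIDA setIid.
rewrite setIC rmorphD scalerDl scalerDr -!addrA; congr (_ + _).
by rewrite [RHS]addrCA; congr (_ + _); exact: addrC.
Qed.

Lemma sfun_int_le k (A : 'I_k -> set T) (c : 'I_k -> X) : sfun_ok A ->
  ((nrm (sfun_int mu A c))%:E <= \int[mu]_x (nrm (sfun_eval A c x))%:E)%E.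
Proof.
move=> okA; pose B := \big[setU/set0]_(i < k) A i.
have mA i : measurable (A i) by case: (okA i).
have [mB Boo] : measurable B /\ (mu B < +oo)%E.
  apply: (big_ind (fun S => measurable S /\ (mu S < +oo)%E)) => //.
    by split; rewrite ?measure0.
  move=> S S' [mS Soo] [mS' S'oo]; split; first exact: measurableU.
  by rewrite (le_lt_trans (measureU2 _ mS mS')) // lte_add_pinfty.
have := sfun_int_le_on c (0 : X) okA mB Boo; rewrite scaler0 add0r.
have -> : \sum_(i < k) (fine (mu (A i `&` B)))%:C *: c i = sfun_int mu A c.
  apply: eq_bigr => i _; congr ((fine (mu _))%:C *: _).
  by apply: setIidl; rewrite /B (bigD1 i) //=; exact: subsetUl.
move=> h; apply: (le_trans h); under eq_integral do rewrite add0r.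
apply: ge0_subset_integral => //.
  apply/measurable_EFinP; have := sfun_measurable c (0 : X) mA.
  by under eq_fun do rewrite add0r.
by move=> x _; rewrite lee_fin nrm_ge0.
Qed.

(** Since the sets of a simple function may overlap, sums and differences of simple functions are
    plain concatenations, with no common refinement. *)
Definition cat_fun (S : Type) k l (A : 'I_k -> S) (B : 'I_l -> S) (i : 'I_(k + l)) : S :=
  match fintype.split i with inl j => A j | inr j => B j end.

Lemma cat_funl S k l (A : 'I_k -> S) (B : 'I_l -> S) i : cat_fun A B (lshift l i) = A i.
Proof. by rewrite /cat_fun (unsplitK (inl i)). Qed.

Lemma cat_funr S k l (A : 'I_k -> S) (B : 'I_l -> S) i : cat_fun A B (rshift k i) = B i.
Proof. by rewrite /cat_fun (unsplitK (inr i)). Qed.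

Lemma sfun_ok_cat k l (A : 'I_k -> set T) (B : 'I_l -> set T) :
  sfun_ok A -> sfun_ok B -> sfun_ok (cat_fun A B).
Proof. by move=> okA okB i; rewrite /cat_fun; case: (fintype.split i). Qed.

Lemma sfun_eval_cat k l (A : 'I_k -> set T) (B : 'I_l -> set T) c e x :
  sfun_eval (cat_fun A B) (cat_fun c e) x = sfun_eval A c x + sfun_eval B e x :> X.
Proof.
rewrite /sfun_eval big_split_ord /=.
by congr (_ + _); apply: eq_bigr => i _; rewrite ?cat_funl ?cat_funr.
Qed.

Lemma sfun_int_cat k l (A : 'I_k -> set T) (B : 'I_l -> set T) c e :
  sfun_int mu (cat_fun A B) (cat_fun c e) = sfun_int mu A c + sfun_int mu B e :> X.
Proof.
rewrite /sfun_int big_split_ord /=.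
by congr (_ + _); apply: eq_bigr => i _; rewrite ?cat_funl ?cat_funr.
Qed.

Lemma sfun_evalZ k (A : 'I_k -> set T) (c : 'I_k -> X) (a : C) x :
  sfun_eval A (fun i => a *: c i) x = a *: sfun_eval A c x.
Proof. by rewrite /sfun_eval scaler_sumr; apply: eq_bigr => i _; rewrite !scalerA mulrC. Qed.

Lemma sfun_intZ k (A : 'I_k -> set T) (c : 'I_k -> X) (a : C) :
  sfun_int mu A (fun i => a *: c i) = a *: sfun_int mu A c.
Proof. by rewrite /sfun_int scaler_sumr; apply: eq_bigr => i _; rewrite !scalerA mulrC. Qed.

Lemma sfun_int_dist_le k l (A : 'I_k -> set T) (B : 'I_l -> set T) (c : 'I_k -> X)
    (e : 'I_l -> X) : sfun_ok A -> sfun_ok B ->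
  ((nrm (sfun_int mu A c - sfun_int mu B e))%:E <=
   \int[mu]_x (nrm (sfun_eval A c x - sfun_eval B e x))%:E)%E.
Proof.
move=> okA okB; have := sfun_int_le (cat_fun c (fun i => (-1) *: e i)) (sfun_ok_cat okA okB).
rewrite sfun_int_cat sfun_intZ scaleN1r.
by under eq_integral do rewrite sfun_eval_cat sfun_evalZ scaleN1r.
Qed.

(* Unlike [is_bochner_integral] this asks for no a.e. convergence, so it passes to
   sums, multiples and translates without extracting subsequences. *)
Definition bochner_approx f y := forall e : R, 0 < e ->
  exists k (A : 'I_k -> set T) (c : 'I_k -> X), [/\ sfun_ok A,
    (\int[mu]_x (nrm (f x - sfun_eval A c x))%:E <= e%:E)%E &
    nrm (sfun_int mu A c - y) <= e].

Lemma is_bochner_approx f y : is_bochner_integral mu f y -> bochner_approx f y.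
Proof.
move=> [k [A [c [okA [_ [fA /nrm_cvgP Ay]]]]]] e e0.
have h1 : \forall m \near \oo, (\int[mu]_x (nrm (f x - sfun_eval (A m) (c m) x))%:E <= e%:E)%E.
  have e0' : ((0%:E : \bar R) < e%:E)%E by rewrite lte_fin.
  have /(_ `]-oo, e%:E[%classic) := fA.
  case.
    apply: open_nbhs_nbhs; split; first exact: open_ereal_lt_ereal.
    by rewrite /= in_itv.
  move=> N _ h; exists N => // m /h /=; rewrite in_itv /= => /ltW; exact.
have h2 : \forall m \near \oo, nrm (sfun_int mu (A m) (c m) - y) <= e.
  move/cvgrPdist_le : Ay => /(_ e e0); apply: filterS => m.
  by rewrite sub0r normrN ger0_norm ?nrm_ge0.
near \oo => m.
exists (k m), (A m), (c m); split; first exact: okA.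
  by near: m.
by near: m.
Unshelve. all: by end_near. Qed.

Let adde_shuffle (a b : \bar R) : (a + (a + (b + a) + a) = b + (a + (a + (a + a))))%E.
Proof. by rewrite !addeA (addeC (a + a)%E b) !addeA. Qed.

(** Source of both uniqueness (g = f) and the norm bound (g = 0). Two L1 errors and two errors on
    the integrals, each at most e/4, add up to [e]. *)
Lemma bochner_approx_dist f g y z : dist_measurable f -> dist_measurable g ->
  measurable_fun setT (fun x => nrm (f x - g x)) ->
  bochner_approx f y -> bochner_approx g z ->
  ((nrm (y - z))%:E <= \int[mu]_x (nrm (f x - g x))%:E)%E.
Proof.
move=> mf mg mfg fy gz; set J := integral _ _ _.
apply/lee_addgt0Pr => e e0; have e4 : 0 < e / 4 by rewrite divr_gt0.
have [k [A [c [okA fA Ay]]]] := fy _ e4.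
have [l [B [b [okB gB Bz]]]] := gz _ e4.
have mfA := dist_measurable_nrm (dist_measurable_sfun c mf (fun i => (okA i).1)).
have mgB := dist_measurable_nrm (dist_measurable_sfun b mg (fun i => (okB i).1)).
have h : ((nrm (sfun_int mu A c - sfun_int mu B b))%:E <= (e / 4)%:E + (J + (e / 4)%:E))%E.
  apply: (le_trans (sfun_int_dist_le c b okA okB)).
  apply: (@le_trans _ _ (\int[mu]_x ((nrm (f x - sfun_eval A c x))%:E +
     ((nrm (f x - g x))%:E + (nrm (g x - sfun_eval B b x))%:E)))%E).
    apply: ge0_le_integral => //.
    - by move=> x _; rewrite lee_fin nrm_ge0.
    - apply/measurable_EFinP.
      have := sfun_measurable (cat_fun c (fun i => (-1) *: b i)) (0 : X)
         (fun i => (sfun_ok_cat okA okB i).1).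
      by under eq_fun do rewrite sfun_eval_cat sfun_evalZ scaleN1r add0r.
    - apply: emeasurable_funD; first exact/measurable_EFinP.
      by apply: emeasurable_funD; exact/measurable_EFinP.
    - move=> x _; rewrite -!EFinD lee_fin.
      rewrite (le_trans (nrm_triangle (f x) _ _)) // (nrmB _ (f x)) lerD2l.
      exact: nrm_triangle.
  rewrite ge0_integralD //; last 4 first.
  - by move=> x _; rewrite lee_fin nrm_ge0.
  - exact/measurable_EFinP.
  - by move=> x _; rewrite -EFinD lee_fin addr_ge0 ?nrm_ge0.
  - by apply: emeasurable_funD; exact/measurable_EFinP.
  rewrite ge0_integralD //; last 4 first.
  - by move=> x _; rewrite lee_fin nrm_ge0.
  - exact/measurable_EFinP.
  - by move=> x _; rewrite lee_fin nrm_ge0.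
  - exact/measurable_EFinP.
  by rewrite leeD // leeD2l.
have h' : nrm (y - z) <= e / 4 + (nrm (sfun_int mu A c - sfun_int mu B b) + e / 4).
  rewrite (le_trans (nrm_triangle (sfun_int mu A c) _ _)) // lerD //.
    by rewrite nrmB.
  by rewrite (le_trans (nrm_triangle (sfun_int mu B b) _ _)) // lerD2l.
rewrite -lee_fin in h'; apply: (le_trans h').
rewrite !EFinD; apply: (le_trans (leeD2l _ (leeD2r _ h))).
have -> : ((e / 4)%:E + ((e / 4)%:E + (J + (e / 4)%:E) + (e / 4)%:E) = J + e%:E)%E.
  have -> : (e%:E = (e / 4)%:E + ((e / 4)%:E + ((e / 4)%:E + (e / 4)%:E)))%E.
    by rewrite -!EFinD; congr EFin; field.
  exact: adde_shuffle.
by [].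
Qed.

Lemma bochner_approx_unique f y z : dist_measurable f ->
  bochner_approx f y -> bochner_approx f z -> y = z.
Proof.
move=> mf fy fz; apply/eqP; rewrite -subr_eq0; apply/eqP/nrm_eq0.
apply: le_anti; rewrite nrm_ge0 andbT -lee_fin.
have := bochner_approx_dist mf mf _ fy fz.
under eq_fun do rewrite subrr nrm0; under eq_integral do rewrite subrr nrm0.
by rewrite integral0; apply; exact: measurable_cst.
Qed.

Lemma bochner_approx0 : bochner_approx (fun=> 0) 0.
Proof.
move=> e e0; exists 0%N, (fun=> set0), (fun=> 0); split.
- by case.
- under eq_integral do rewrite /sfun_eval big_ord0 subr0 nrm0.
  by rewrite integral0 lee_fin ltW.
- by rewrite /sfun_int big_ord0 subr0 nrm0 ltW.
Qed.

Lemma bochner_approx_le f y : dist_measurable f -> bochner_approx f y ->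
  ((nrm y)%:E <= \int[mu]_x (nrm (f x))%:E)%E.
Proof.
move=> mf fy; have := bochner_approx_dist mf (dist_measurable_cst 0) (mf 0) fy bochner_approx0.
by under eq_integral do rewrite subr0; rewrite subr0.
Qed.

Lemma bochner_approxD f g y z : dist_measurable f -> dist_measurable g ->
  dist_measurable (fun x => f x + g x) ->
  bochner_approx f y -> bochner_approx g z -> bochner_approx (fun x => f x + g x) (y + z).
Proof.
move=> mf mg mfg fy gz e e0; have e2 : 0 < e / 2 by rewrite divr_gt0.
have [k [A [c [okA fA Ay]]]] := fy _ e2.
have [l [B [b [okB gB Bz]]]] := gz _ e2.
exists (k + l)%N, (cat_fun A B), (cat_fun c b); split; first exact: sfun_ok_cat.
  rewrite (@le_trans _ _ (\int[mu]_x ((nrm (f x - sfun_eval A c x))%:E +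
     (nrm (g x - sfun_eval B b x))%:E))%E) //; last first.
    rewrite ge0_integralD //.
    - have -> : e = e / 2 + e / 2 by field.
      by rewrite EFinD leeD.
    - by move=> x _; rewrite lee_fin nrm_ge0.
    - apply/measurable_EFinP/dist_measurable_nrm/dist_measurable_sfun => // i.
      exact: (okA i).1.
    - by move=> x _; rewrite lee_fin nrm_ge0.
    - apply/measurable_EFinP/dist_measurable_nrm/dist_measurable_sfun => // i.
      exact: (okB i).1.
  have E x : f x + g x - sfun_eval (cat_fun A B) (cat_fun c b) x =
     (f x - sfun_eval A c x) + (g x - sfun_eval B b x).
    by rewrite sfun_eval_cat opprD addrACA.
  have mfA := dist_measurable_nrm (dist_measurable_sfun c mf (fun i => (okA i).1)).
  have mgB := dist_measurable_nrm (dist_measurable_sfun b mg (fun i => (okB i).1)).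
  apply: ge0_le_integral => //.
  - by move=> x _; rewrite lee_fin nrm_ge0.
  - apply/measurable_EFinP/dist_measurable_nrm/dist_measurable_sfun => // i.
    exact: (sfun_ok_cat okA okB i).1.
  - by apply: emeasurable_funD; exact/measurable_EFinP.
  - by move=> x _; rewrite E -EFinD lee_fin nrmD.
rewrite sfun_int_cat opprD addrACA (le_trans (nrmD _ _)) //.
have -> : e = e / 2 + e / 2 by field.
exact: lerD.
Qed.

Lemma bochner_approxZ f y (a : C) : dist_measurable f ->
  bochner_approx f y -> bochner_approx (fun x => a *: f x) (a *: y).
Proof.
move=> mf fy e e0; have a1 : 0 < cabs a + 1 by rewrite ltr_wpDl // cabs_ge0.
have [k [A [c [okA fA Ay]]]] := fy _ (divr_gt0 e0 a1).
have ae : cabs a * (e / (cabs a + 1)) <= e.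
  rewrite mulrA ler_pdivrMr // mulrC ler_wpM2l ?(ltW e0) //; lra.
exists k, A, (fun i => a *: c i); split => //.
  under eq_integral do rewrite sfun_evalZ -scalerBr nrmZ EFinM.
  rewrite ge0_integralZl //.
  - rewrite (le_trans _ (_ : (cabs a * (e / (cabs a + 1)))%:E <= e%:E)%E) ?lee_fin //.
    by rewrite EFinM lee_wpmul2l // lee_fin cabs_ge0.
  - apply/measurable_EFinP/dist_measurable_nrm/dist_measurable_sfun => // i.
    exact: (okA i).1.
  - by move=> x _; rewrite lee_fin nrm_ge0.
  - by rewrite lee_fin cabs_ge0.
rewrite sfun_intZ -scalerBr nrmZ (le_trans _ ae) // ler_wpM2l ?cabs_ge0 //.
Qed.

End BochnerIntegral.

(** * Lebesgue measure on n-tuples *)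

Section LebesgueTuple.
Context {R : realType} {n : nat}.
Local Notation T := (n.-tuple R).
Implicit Types (a b s : 'I_n -> R).

Definition obox a b : set T := [set t | forall i, a i < tnth t i <= b i].

Definition shift s (t : T) : T := [tuple tnth t i + s i | i < n].

Lemma measurable_obox a b : measurable (obox a b).
Proof.
have -> : obox a b = \big[setI/setT]_(i < n) ((fun t : T => tnth t i) @^-1` `]a i, b i]).
  rewrite -bigcap_seq; apply/seteqP; split => t /=.
    by move=> tab i _ /=; rewrite in_itv /= tab.
  by move=> tab i; have := tab i (mem_index_enum i); rewrite /= in_itv.
apply: bigsetI_measurable => i _; rewrite -[X in measurable X]setTI.
by apply: measurable_tnth => //; exact: measurable_itv.
Qed.

Lemma measurable_shift s : measurable_fun setT (shift s).
Proof.
apply/measurable_fun_tnthP => i /=.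
have -> : (fun t => tnth t i) \o shift s = (fun t : T => tnth t i + s i).
  by apply/funext => t /=; rewrite tnth_mktuple.
by apply: measurable_funD => //; exact: measurable_tnth.
Qed.

Definition boxes : set (set T) := [set A | exists a b, A = obox a b].

(** The product sigma-algebra is generated by the coordinates, and the preimage of an interval under
    one coordinate is a countable union of boxes whose other sides are ]-k, k]. The identity from
    the copy [S] carrying the box sigma-algebra is therefore measurable. *)
Lemma boxes_generate (A : set T) : measurable A -> <<s boxes >> A.
Proof.
pose S := g_sigma_algebraType boxes.
have mid : measurable_fun [set: S] (fun t : S => t : T).
  apply/measurable_fun_tnthP => i.
  apply: (@measurability _ _ S _ setT _ (@ocitv R)) => // _ [_ [[x y] _ <-] <-].
  rewrite setTI /=.
  have -> : ((fun t : T => tnth t i) \o (fun t : S => t : T)) @^-1` `]x, y]%classic =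
      \bigcup_k (obox (fun j => if j == i then x else - k%:R)
                      (fun j => if j == i then y else k%:R) : set S).
    apply/seteqP; split => t /=; rewrite in_itv /=.
      move=> txy; pose B := \sum_(j < n) `|tnth t j|.
      exists (Num.truncn B).+1 => // j; case: eqVneq => [->//|_].
      have tB : `|tnth t j| < (Num.truncn B).+1%:R.
        by rewrite (le_lt_trans _ (truncnS_gt B)) // /B (bigD1 j) //= lerDl sumr_ge0.
      by move: tB; rewrite ltr_norml => /andP[-> /ltW].
    by move=> [k _ /(_ i)]; rewrite eqxx.
  apply: bigcupT_measurable => k; apply: sub_sigma_algebra.
  by eexists; eexists.
by move=> mA; have := mid measurableT _ mA; rewrite setTI.
Qed.

Lemma boxes_setI : setI_closed boxes.
Proof.
move=> _ _ [a [b ->]] [a' [b' ->]].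
exists (fun i => Num.max (a i) (a' i)), (fun i => Num.min (b i) (b' i)).
apply/seteqP; split => t /=.
  move=> [tab tab'] i; case/andP: (tab i) => h1 h2; case/andP: (tab' i) => h3 h4.
  by rewrite gt_max le_min h1 h2 h3 h4.
by move=> tab; split => i; have := tab i; rewrite gt_max le_min => /andP[/andP[h1 h2] /andP[h3 h4]];
  apply/andP.
Qed.

Lemma shift_obox s a b : shift s @^-1` obox a b = obox (fun i => a i - s i) (fun i => b i - s i).
Proof.
by apply/seteqP; split => t tab i; have := tab i; rewrite /= tnth_mktuple ltrBlDr lerBrDr.
Qed.

Variable mu : {measure set T -> \bar R}.
Hypothesis leb : is_lebesgue_Rn mu.

Lemma mu_obox a b : (forall i, a i <= b i) -> mu (obox a b) = (\prod_(i < n) (b i - a i))%:E.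
Proof.
move=> ab; have := @leb [tuple a i | i < n] [tuple b i | i < n].
have -> : [set t | forall i, tnth [tuple a i | i < n] i < tnth t i <= tnth [tuple b i | i < n] i]
   = obox a b.
  by apply/seteqP; split => t tab i; have := tab i; rewrite !tnth_mktuple.
move=> -> => [|i]; last by rewrite !tnth_mktuple.
by congr EFin; apply: eq_bigr => i _; rewrite !tnth_mktuple.
Qed.

Lemma mu_obox_fin a b : (mu (obox a b) < +oo)%E.
Proof.
have [ab|/existsNP[i /negP]] := pselect (forall i, a i <= b i); first by rewrite mu_obox // ltry.
rewrite -ltNge => ba; have -> : obox a b = set0; last by rewrite measure0.
apply/seteqP; split => t //= /(_ i) /andP[h1 h2].
by have := lt_le_trans h1 h2; rewrite ltNge (ltW ba).
Qed.

(** The pushforward of [mu] agrees with [mu] on boxes, which are stable under intersection, generate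
    the sigma-algebra and exhaust the space with finite measure. *)
Lemma mu_shift s (A : set T) : measurable A -> mu (shift s @^-1` A) = mu A.
Proof.
move=> mA; have ms := measurable_shift s.
pose nu := measure_function_pushforward__canonical__measure_function_Measure mu ms.
rewrite -[LHS]/(nu A).
apply: (@g_sigma_algebra_measure_unique _ R _ boxes _
  (fun k => obox (fun=> - k%:R) (fun=> k%:R))).
- by move=> _ [a [b ->]]; exact: measurable_obox.
- by move=> k; eexists; eexists.
- apply/seteqP; split => // t _; pose B := \sum_(j < n) `|tnth t j|.
  exists (Num.truncn B).+1 => // j.
  have tB : `|tnth t j| < (Num.truncn B).+1%:R.
    by rewrite (le_lt_trans _ (truncnS_gt B)) // /B (bigD1 j) //= lerDl sumr_ge0.
  by move: tB; rewrite ltr_norml => /andP[-> /ltW].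
- exact: boxes_setI.
- move=> _ [a [b ->]]; rewrite /nu /= /pushforward shift_obox.
  (* The volume formula is assumed for ordered bounds only; with inverted bounds the box and its
     translate are empty. *)
  have [ab|/existsNP[i /negP]] := pselect (forall i, a i <= b i).
    rewrite !mu_obox // => [|i]; last by rewrite lerB.
    by congr EFin; apply: eq_bigr => i _; rewrite opprB addrA subrK.
  rewrite -ltNge => ba.
  have e0 (a' b' : 'I_n -> R) : b' i < a' i -> obox a' b' = set0.
    move=> ba'; apply/seteqP; split => t //= /(_ i) /andP[h1 h2].
    by have := lt_le_trans h1 h2; rewrite ltNge (ltW ba').
  by rewrite !e0 // ltrD2r.
- by move=> k; rewrite /nu /= /pushforward shift_obox; exact: mu_obox_fin.
- exact: boxes_generate.
Qed.

Lemma integral_shift s (F : T -> \bar R) : measurable_fun setT F -> (forall t, (0 <= F t)%E) ->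
  (\int[mu]_t F (shift s t) = \int[mu]_t F t)%E.
Proof.
move=> mF F0; have ms := measurable_shift s.
have := @ge0_integral_pushforward _ _ _ _ R _ ms mu setT F measurableT mF (fun t _ => F0 t).
rewrite preimage_setT => <-.
by apply: eq_measure_integral => A mA _; exact: mu_shift.
Qed.

End LebesgueTuple.

(** * Grid step functions, measurability of continuous functions, integrability of Gaussians *)

Section Grid.
Context {R : realType} {n : nat}.
Local Notation T := (n.-tuple R).
Local Notation V := 'rV[R]_n.
Implicit Types (x y : V) (t : T).

Lemma sqnorm_ge0 x : 0 <= sqnorm x.
Proof. by apply: sumr_ge0 => i _; rewrite -expr2 sqr_ge0. Qed.

Lemma sqr_coord_le x i : x ord0 i ^+ 2 <= sqnorm x.
Proof.
rewrite /sqnorm /dotR (bigD1 i) //= -expr2 lerDl.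
by apply: sumr_ge0 => j _; rewrite -expr2 sqr_ge0.
Qed.

Lemma sqnorm_near x y : (forall i, `|x ord0 i - y ord0 i| <= 1) ->
  sqnorm y <= 2 * sqnorm x + 2 * n%:R.
Proof.
move=> xy; have -> : 2 * sqnorm x + 2 * n%:R = \sum_(i < n) (2 * x ord0 i ^+ 2 + 2).
  rewrite big_split /= -mulr_sumr sumr_const card_ord -[2 *+ n]mulr_natr.
  by congr (2 * _ + _); apply: eq_bigr => i _; rewrite expr2.
apply: ler_sum => i _; rewrite -expr2.
have : `|x ord0 i - y ord0 i| ^+ 2 <= 1 by rewrite expr_le1.
rewrite real_normK ?num_real // => h.
have := sqr_ge0 (2 * x ord0 i - y ord0 i).
by move: h; rewrite !expr2; lra.
Qed.

(** Half-open cubes of side 1/(m+1) tile ]-(m+1), m+1]^n, hence 2 (m+1)^2 intervals per axis. *)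
Definition grid_index (m : nat) := {ffun 'I_n -> 'I_(2 * m.+1 * m.+1)}.

Definition lower m (j : grid_index m) (i : 'I_n) : R :=
  - m.+1%:R + (j i)%:R / m.+1%:R.
Definition upper m (j : grid_index m) (i : 'I_n) : R :=
  - m.+1%:R + (j i).+1%:R / m.+1%:R.

Definition cell m (j : grid_index m) : set T := obox (lower j) (upper j).
Definition corner m (j : grid_index m) : V := \row_i upper j i.

Lemma cellP m (j : grid_index m) t : cell j t <->
  forall i, (j i)%:R < (tnth t i + m.+1%:R) * m.+1%:R <= (j i).+1%:R.
Proof.
have m0 : (0 : R) < m.+1%:R by rewrite ltr0n.
by split => H i; have := H i; rewrite /lower /upper -ltrBrDl -lerBlDl opprK
  ltr_pdivrMr // ler_pdivlMr.
Qed.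

Lemma cell_disjoint m (j j' : grid_index m) t : cell j t -> cell j' t -> j = j'.
Proof.
move=> /cellP H /cellP H'; apply/ffunP => i; apply/val_inj/eqP; rewrite eqn_leq.
have /andP[h1 h2] := H i; have /andP[h3 h4] := H' i.
have := lt_le_trans h1 h4; have := lt_le_trans h3 h2.
by rewrite !ltr_nat !ltnS => -> ->.
Qed.

Lemma cell_exists m t : (forall i, `|tnth t i| < m.+1%:R) -> exists j : grid_index m, cell j t.
Proof.
move=> tm; have m0 : (0 : R) < m.+1%:R by rewrite ltr0n.
pose u i := (tnth t i + m.+1%:R) * m.+1%:R.
have u0 i : 0 < u i.
  by rewrite mulr_gt0 //; have := tm i; rewrite ltr_norml => /andP[]; rewrite -ltrBlDr sub0r.
have uM i : u i < (2 * m.+1 * m.+1)%:R.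
  rewrite /u !natrM ltr_pM2r //; have := tm i; rewrite ltr_norml => /andP[_].
  by rewrite mulr_natl mulr2n ltrD2r.
have ex i : exists k : 'I_(2 * m.+1 * m.+1), k%:R < u i <= k.+1%:R.
  have exN : exists N : nat, u i <= N%:R.
    by exists (2 * m.+1 * m.+1)%N; rewrite ltW.
  (* [N] is the ceiling of [u i]; as cells are open on the left, the cell index is N - 1. *)
  have [N uN Nmin] := ex_minnP exN.
  case: N uN Nmin => [|k] uN Nmin; first by have := u0 i; rewrite ltNge uN.
  have kM : (k < 2 * m.+1 * m.+1)%N by apply: Nmin; rewrite ltW.
  exists (Ordinal kM) => /=; rewrite uN andbT ltNge; apply/negP => /Nmin.
  by rewrite ltnn.
have [k kP] := choice ex.
exists [ffun i => k i]; apply/cellP => i; rewrite ffunE; exact: kP.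
Qed.

Lemma corner_near m (j : grid_index m) t i : cell j t ->
  `|corner j ord0 i - tnth t i| <= m.+1%:R^-1.
Proof.
move=> /(_ i) /andP[h1 h2]; rewrite mxE.
have E : upper j i = lower j i + m.+1%:R^-1.
  by rewrite /upper /lower -addrA -[(j i).+1%:R]natr1 mulrDl mul1r.
by rewrite ger0_norm ?subr_ge0 // lerBlDl E -lerBlDr -addrA subrr addr0 ltW.
Qed.

Lemma cell_eventually t : \forall m \near \oo, exists j : grid_index m, cell j t.
Proof.
pose B := \sum_(j < n) `|tnth t j|.
near=> m; apply: cell_exists => i.
have tB : `|tnth t i| <= B by rewrite /B (bigD1 i) //= lerDl sumr_ge0.
apply: (le_lt_trans tB); apply: (@le_lt_trans _ _ m%:R); last by rewrite ltr_nat.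
near: m; exact: nbhs_infty_ger.
Unshelve. all: by end_near. Qed.

Lemma measurable_cell m (j : grid_index m) : measurable (cell j).
Proof. exact: measurable_obox. Qed.

Lemma rvE t i : rv_of_tuple t ord0 i = tnth t i.
Proof. by rewrite mxE. Qed.

Definition gridR (phi : V -> R) m t : R :=
  \sum_(j : grid_index m) \1_(cell j) t * phi (corner j).

Lemma gridR_cell phi m (j : grid_index m) t : cell j t -> gridR phi m t = phi (corner j).
Proof.
move=> jt; rewrite /gridR (bigD1 j) //= big1 ?addr0 => [|i ij].
  by rewrite indicE mem_set // mul1r.
rewrite indicE memNset ?mul0r // => it; move/negP: ij; apply.
by apply/eqP; exact: cell_disjoint it jt.
Qed.

Lemma cont_corner (phi : V -> R) t (e : R) : {for rv_of_tuple t, continuous phi} -> 0 < e ->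
  \forall m \near \oo, forall j : grid_index m, cell j t ->
    `|phi (corner j) - phi (rv_of_tuple t)| < e.
Proof.
move=> /cvgrPdist_lt pc e0; have := pc e e0.
rewrite -nbhs_ballE => -[d /= d0 dP].
have := near_infty_natSinv_lt (PosNum d0).
apply: filterS => m md j jt.
rewrite distrC; apply: dP; split => // i k; rewrite ord1 /ball /= rvE distrC.
exact: le_lt_trans (corner_near k jt) md.
Qed.

Lemma gridR_cvg (phi : V -> R) t : {for rv_of_tuple t, continuous phi} ->
  gridR phi m t @[m --> \oo] --> phi (rv_of_tuple t).
Proof.
move=> pc; apply/cvgrPdist_lt => e e0.
near=> m.
have [j jt] : exists j : grid_index m, cell j t by near: m; exact: cell_eventually.
rewrite (gridR_cell phi jt) distrC.
have H : forall j : grid_index m, cell j t -> `|phi (corner j) - phi (rv_of_tuple t)| < e.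
  by near: m; exact: cont_corner.
exact: H.
Unshelve. all: by end_near. Qed.

Lemma measurable_gridR phi m : measurable_fun setT (gridR phi m).
Proof.
apply: measurable_sum => j; apply: measurable_funM => //.
exact: measurable_indic (measurable_cell j).
Qed.

(** A pointwise limit of grid step functions, which spares any comparison of the product
    sigma-algebra on tuples with the topology of row vectors. *)
Lemma measurable_continuous (phi : V -> R) : continuous phi ->
  measurable_fun setT (fun t => phi (rv_of_tuple t)).
Proof.
move=> pc; apply: (@measurable_fun_cvg _ _ _ _ (gridR phi)) => [m|t _].
  exact: measurable_gridR.
exact: gridR_cvg (pc _).
Qed.

Lemma continuous_dotR (v : V) : continuous (fun x => dotR v x).
Proof.
rewrite /dotR; apply: continuous_big => [|i _ x].
  exact: add_continuous.
by apply: continuousM; [exact: cst_continuous|exact: coord_continuous].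
Qed.

Lemma continuous_sqnorm : continuous (@sqnorm R n).
Proof.
apply: continuous_big => [|i _ x].
  exact: add_continuous.
by apply: continuousM; exact: coord_continuous.
Qed.

Lemma continuous_expR_comp (u : V -> R) : continuous u -> continuous (fun x => expR (u x)).
Proof. by move=> uc x; apply: continuous_comp; [exact: uc|exact: continuous_expR]. Qed.

Variable mu : {measure set T -> \bar R}.
Hypothesis leb : is_lebesgue_Rn mu.

(** No Fubini: with [k] the integer part of the largest |t_i|, the Gaussian at [t] is at most exp(-
    a k^2), and [t] lies in the cube [B k]. Summing over [k] the values times the volumes leaves a
    series dominated by a geometric one. *)
Lemma integrable_gauss (D a : R) : 0 < a ->
  mu.-integrable setT (fun t => (D * expR (- a * sqnorm (rv_of_tuple t)))%:E).
Proof.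
move=> a0.
have mg (b : R) : measurable_fun setT (fun t => (expR (- b * sqnorm (rv_of_tuple t)))%:E).
  have c : continuous (fun x : V => expR (- b * sqnorm x)).
    apply: continuous_expR_comp => x.
    exact: (@continuousM R V (fun=> - b) (@sqnorm R n) x (@cst_continuous _ _ _ x)
      (@continuous_sqnorm x)).
  by apply/measurable_EFinP; exact: (measurable_continuous c).
suff H : (\int[mu]_t (expR (- a * sqnorm (rv_of_tuple t)))%:E < +oo)%E.
  under eq_fun do rewrite EFinM.
  apply: integrableZl => //; apply/integrableP; split => //.
  by under eq_integral do rewrite gee0_abs ?lee_fin ?expR_ge0 //.
pose B k := obox (fun _ : 'I_n => - k.+1%:R) (fun _ => k.+1%:R : R).
pose f k t := ((expR (- a * k%:R ^+ 2))%:E * (\1_(B k) t)%:E)%E.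
have mB k : measurable (B k) by exact: measurable_obox.
have f0 k t : (0 <= f k t)%E by rewrite mule_ge0 // lee_fin ?expR_ge0.
have mI k : measurable_fun [set: T] (fun t => (\1_(B k) t)%:E : \bar R).
  by apply/measurable_EFinP; exact: measurable_indic (mB k).
have mf k : measurable_fun [set: T] (f k).
  exact: emeasurable_funM (measurable_cst _) (mI k).
apply: (@le_lt_trans _ _ (\int[mu]_t (\sum_(0 <= k <oo) f k t))%E).
  have ms : measurable_fun [set: T] (fun t => \sum_(0 <= k <oo) f k t)%E.
    exact: ge0_emeasurable_sum.
  have e0 t : (0 <= (expR (- a * sqnorm (rv_of_tuple t)))%:E)%E by rewrite lee_fin expR_ge0.
  apply: (ge0_le_integral mu measurableT (fun t _ => e0 t) (mg a) ms) => t _.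
  pose M := \big[Num.max/0]_(i < n) `|tnth t i|.
  have M0 : 0 <= M by exact: bigmax_ge_id.
  pose k := Num.truncn M.
  have kM : k%:R <= M by rewrite truncn_le.
  have Mk : M < k.+1%:R by exact: truncnS_gt.
  have tB : B k t.
    move=> i; have : `|tnth t i| < k.+1%:R.
      by rewrite (le_lt_trans _ Mk) //; exact: (le_bigmax _ (fun i => `|tnth t i|)).
    by rewrite ltr_norml => /andP[-> /ltW ->].
  apply: (@le_trans _ _ (\sum_(0 <= l < k.+1) f l t)%E); last first.
    by apply: nneseries_lim_ge => l _ _; exact: f0.
  rewrite big_nat_recr //= -[leLHS]add0e leeD //.
    by apply: sume_ge0 => l _; exact: f0.
  rewrite /f indicE mem_set // mule1 lee_fin ler_expR ler_wnM2l //.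
    by rewrite oppr_le0 ltW.
  have M2 : M ^+ 2 <= sqnorm (rv_of_tuple t).
    have [->|[i ->]] : M = 0 \/ exists i, M = `|tnth t i|.
      rewrite /M; elim/big_ind: _ => [|u v [->|[i ->]] [->|[i' ->]]|i _]; first by left.
      - by left; rewrite maxxx.
      - by right; exists i'; rewrite max_r.
      - by right; exists i; rewrite max_l.
      - by right; have [_|_] := leP `|tnth t i| `|tnth t i'|; [exists i'|exists i].
      by right; exists i.
    by rewrite expr0n sqnorm_ge0.
  by rewrite real_normK ?num_real // -rvE sqr_coord_le.
  by rewrite (le_trans _ M2) // lerXn2r ?nnegrE.
rewrite integral_nneseries //.
(* The exponent is the maximum of - a k^2 + 2 n (k + 1) + k over real k: 2 n (k + 1) bounds the
   volume of [B k], and the extra k pays for the factor 2^k. *)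
pose K := expR (2 * n%:R + (2 * n%:R + 1) ^+ 2 / (4 * a)).
have K0 : 0 <= K by exact: expR_ge0.
have fK k : (\int[mu]_t f k t <= (2 * K / (2 ^ (k + 1))%:R)%:E)%E.
  have e0 : (0 <= (expR (- a * k%:R ^+ 2))%:E)%E by rewrite lee_fin expR_ge0.
  have i0 t : (0 <= (\1_(B k) t)%:E :> \bar R)%E by rewrite lee_fin.
  rewrite (ge0_integralZl mu measurableT (mI k) (fun t _ => i0 t) e0).
  have kk : - k.+1%:R <= k.+1%:R :> R by rewrite (@le_trans _ _ 0) // oppr_le0.
  rewrite integral_indic // setIT mu_obox //.
  have -> : \prod_(i < n) (k.+1%:R - - k.+1%:R) = (2 * k.+1%:R) ^+ n :> R.
    by rewrite prodr_const card_ord opprK -mulr2n mulr_natl.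
  have p2 : (0 : R) < (2 ^ (k + 1))%:R by rewrite ltr0n expn_gt0.
  rewrite -EFinM lee_fin ler_pdivlMr // addn1 expnS natrM [leLHS]mulrCA ler_wpM2l //.
  have h1 : (2 * k.+1%:R : R) ^+ n <= expR (n%:R * (2 * k.+1%:R)).
    rewrite expRM_natl lerXn2r ?nnegrE ?mulr_ge0 ?expR_ge0 //.
    by rewrite (le_trans _ (expR_ge1Dx _)) // lerDr.
  have h2 : ((2 ^ k)%:R : R) <= expR (k%:R).
    rewrite -[k%:R]mulr1 expRM_natl natrX lerXn2r ?nnegrE ?expR_ge0 //.
    by rewrite (le_trans _ (expR_ge1Dx _)).
  rewrite -mulrA (le_trans (ler_wpM2l (expR_ge0 _) (ler_pM _ _ h1 h2))) ?exprn_ge0 ?mulr_ge0 //.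
  rewrite -!expRD ler_expR -[k.+1%:R]natr1.
  have -> : - a * k%:R ^+ 2 + (n%:R * (2 * (k%:R + 1)) + k%:R) =
     2 * n%:R + (2 * n%:R + 1) ^+ 2 / (4 * a) - (2 * a * k%:R - (2 * n%:R + 1)) ^+ 2 / (4 * a).
    by field; rewrite gt_eqF.
  by rewrite gerBl divr_ge0 ?sqr_ge0 // mulr_ge0 // ltW.
apply: (@le_lt_trans _ _ (\sum_(0 <= k <oo) (2 * K / (2 ^ (k + 1))%:R)%:E)%E).
  by apply: lee_nneseries => // k _; rewrite integral_ge0.
have -> : (\sum_(0 <= k <oo) (2 * K / (2 ^ (k + 1))%:R)%:E = (2 * K / 2 ^+ 0)%:E)%E.
  by apply/cvg_lim => //; exact: cvg_geometric_eseries_half.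
exact: ltry.
Qed.

End Grid.

(** * Gaussian-dominated functions *)

Section GaussianClass.
Context {R : realType} {n : nat} {X : normedModType R[i]}.
Local Notation T := (n.-tuple R).
Local Notation V := 'rV[R]_n.
Local Notation C := R[i].
Implicit Types (x y s : V) (t : T) (g h : V -> X) (v : X).

(* Continuity phrased with the real norm, as ['rV[R]_n] is metrized over [R] but [X] over [R[i]]. *)
Definition ncontinuous g := forall x, {for x, continuous (fun y => nrm (g y - g x))}.

(** The rate is existential because most operations, such as multiplication by an exponential of a
    linear form, consume part of it. *)
Definition gauss_bounded g :=
  exists c a : R, 0 < a /\ forall x, nrm (g x) <= c * expR (- a * sqnorm x).

Definition gauss_class g := ncontinuous g /\ gauss_bounded g.

Lemma continuous_forP (u : V -> R) x : {for x, continuous u} <->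
  forall e : R, 0 < e -> \forall y \near x, `|u x - u y| < e.
Proof. exact: (@cvgrPdist_lt _ R _ (nbhs x) _). Qed.

Lemma ncontinuousP g : ncontinuous g <-> forall x (e : R), 0 < e ->
  \forall y \near x, nrm (g y - g x) < e.
Proof.
split=> gc x.
  move=> e e0; have := gc x => /continuous_forP /(_ e e0); apply: filterS => y.
  by rewrite subrr nrm0 sub0r normrN ger0_norm ?nrm_ge0.
apply/continuous_forP => e e0; have := gc x e e0; apply: filterS => y.
by rewrite subrr nrm0 sub0r normrN ger0_norm ?nrm_ge0.
Qed.

Lemma continuous_ncontinuous g : continuous g -> ncontinuous g.
Proof.
move=> gc; apply/ncontinuousP => x e e0.
have e0C : 0 < e%:C :> C by rewrite ltcR.
have := gc x => /cvgrPdist_lt /(_ _ e0C); apply: filterS => y.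
by rewrite normX ltcR nrmB.
Qed.

Lemma ncontinuous_dist g v : ncontinuous g -> continuous (fun x => nrm (g x - v)).
Proof.
move=> /ncontinuousP gc x; apply/continuous_forP => e e0; have := gc x e e0.
apply: filterS => y ye.
have := nrm_triangle (g x) (g y) v; have := nrm_triangle (g y) (g x) v.
by rewrite (nrmB (g x) (g y)) ltr_norml => *; apply/andP; split; lra.
Qed.

Lemma ncontinuousD g h : ncontinuous g -> ncontinuous h -> ncontinuous (fun x => g x + h x).
Proof.
move=> /ncontinuousP gc /ncontinuousP hc; apply/ncontinuousP => x e e0.
have e2 : 0 < e / 2 by rewrite divr_gt0.
near=> y; have h1 : nrm (g y - g x) < e / 2 by near: y; exact: gc.
have h2 : nrm (h y - h x) < e / 2 by near: y; exact: hc.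
by rewrite opprD addrACA (le_lt_trans (nrmD _ _)) // (splitr e) ltrD.
Unshelve. all: by end_near. Qed.

Lemma ncontinuousZ (a : V -> C) g :
  continuous (fun x => complex.Re (a x)) -> continuous (fun x => complex.Im (a x)) ->
  ncontinuous g -> ncontinuous (fun x => a x *: g x).
Proof.
move=> ra ia /ncontinuousP gc; apply/ncontinuousP => x e e0.
pose M := cabs (a x) + nrm (g x) + 1.
have M1 : 1 <= M by rewrite lerDr addr_ge0 ?cabs_ge0 ?nrm_ge0.
have M0 : 0 < M by lra.
pose d := Num.min 1 (e / (4 * M)).
have eM : 0 < e / (4 * M) by rewrite divr_gt0 // mulr_gt0.
have d0 : 0 < d by rewrite lt_min ltr01 eM.
have d1 : d <= 1 by rewrite ge_min lexx.
have dM : d * M <= e / 4.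
  have : d <= e / (4 * M) by rewrite ge_min lexx orbT.
  by rewrite ler_pdivlMr ?mulr_gt0 //; lra.
have ra' : \forall y \near x, `|complex.Re (a x) - complex.Re (a y)| < d / 2.
  by have := ra x => /continuous_forP; apply; rewrite divr_gt0.
have ia' : \forall y \near x, `|complex.Im (a x) - complex.Im (a y)| < d / 2.
  by have := ia x => /continuous_forP; apply; rewrite divr_gt0.
near=> y.
have h1 : nrm (g y - g x) < d by near: y; exact: gc.
have h2 : `|complex.Re (a x) - complex.Re (a y)| < d / 2 by near: y.
have h3 : `|complex.Im (a x) - complex.Im (a y)| < d / 2 by near: y.
have h4 : cabs (a y - a x) < d.
  rewrite (le_lt_trans (cabs_le_ReIm _)) // !raddfB /= distrC (distrC (complex.Im _)).
  by rewrite (splitr d) ltrD.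
have -> : a y *: g y - a x *: g x = (a y - a x) *: (g y - g x) +
    (a x *: (g y - g x) + (a y - a x) *: g x).
  by rewrite addrCA -scalerDr subrK scalerBr scalerBl addrC addrA subrK.
have := nrmD ((a y - a x) *: (g y - g x)) (a x *: (g y - g x) + (a y - a x) *: g x).
have := nrmD (a x *: (g y - g x)) ((a y - a x) *: g x).
rewrite !nrmZ.
have e1 : cabs (a y - a x) * nrm (g y - g x) <= d * 1.
  by rewrite ler_pM ?cabs_ge0 ?nrm_ge0 // ?(ltW h4) // (le_trans (ltW h1)).
have e2 : cabs (a x) * nrm (g y - g x) <= cabs (a x) * d.
  by rewrite ler_wpM2l ?cabs_ge0 // ltW.
have e3 : cabs (a y - a x) * nrm (g x) <= d * nrm (g x).
  by rewrite ler_wpM2r ?nrm_ge0 // ltW.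
have e4 : d * 1 + (cabs (a x) * d + d * nrm (g x)) = d * M by rewrite /M; ring.
lra.
Unshelve. all: by end_near. Qed.

Lemma ncontinuousZR (a : V -> R) g : continuous a -> ncontinuous g ->
  ncontinuous (fun x => (a x)%:C *: g x).
Proof. by move=> ac; apply: ncontinuousZ => //= x; exact: (@cst_continuous _ _ _ x). Qed.

Lemma ncontinuous_cst v : ncontinuous (fun=> v).
Proof.
by apply/ncontinuousP => x e e0; near=> y; rewrite subrr nrm0.
Unshelve. all: by end_near. Qed.

Lemma ncontinuous_shift g s : ncontinuous g -> ncontinuous (fun x => g (x + s)).
Proof.
move=> /ncontinuousP gc; apply/ncontinuousP => x e e0.
have /nbhs_ballP[d d0 dP] := gc (x + s) e e0; apply/nbhs_ballP.
exists d => // y [d0' xy].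
apply: dP; split => // i j; have := xy i j.
by rewrite !mxE /ball /= opprD addrACA subrr addr0.
Qed.

Lemma dist_measurable_rv g : ncontinuous g -> dist_measurable (fun t => g (rv_of_tuple t)).
Proof. by move=> gc v; exact: (measurable_continuous (@ncontinuous_dist g v gc)). Qed.

Lemma gauss_classD g h : gauss_class g -> gauss_class h -> gauss_class (fun x => g x + h x).
Proof.
move=> [gc [c [a [a0 gb]]]] [hc [d [b [b0 hb]]]]; split; first exact: ncontinuousD.
have c0 : 0 <= c by have := le_trans (nrm_ge0 _) (gb 0); rewrite pmulr_lge0 ?expR_gt0.
have d0 : 0 <= d by have := le_trans (nrm_ge0 _) (hb 0); rewrite pmulr_lge0 ?expR_gt0.
exists (c + d), (Num.min a b); split; first by rewrite lt_min a0.
move=> x; rewrite (le_trans (nrmD _ _)) // mulrDl lerD //.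
  rewrite (le_trans (gb x)) // ler_wpM2l // ler_expR ler_wpM2r ?sqnorm_ge0 // lerN2.
  by rewrite ge_min lexx.
rewrite (le_trans (hb x)) // ler_wpM2l // ler_expR ler_wpM2r ?sqnorm_ge0 // lerN2.
by rewrite ge_min lexx orbT.
Qed.

Lemma gauss_classZ (a : C) g : gauss_class g -> gauss_class (fun x => a *: g x).
Proof.
move=> [gc [c [b [b0 gb]]]]; split.
  by apply: (@ncontinuousZ (fun=> a)) => // x; exact: (@cst_continuous _ _ _ x).
exists (cabs a * c), b; split => // x; rewrite nrmZ -mulrA ler_wpM2l ?cabs_ge0 //.
Qed.

Definition index_cell m (i : 'I_#|{: grid_index (n := n) m}|) : set T := cell (enum_val i).
Definition index_value g m (i : 'I_#|{: grid_index (n := n) m}|) : X := g (corner (enum_val i)).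

Lemma grid_evalE g m t : sfun_eval (@index_cell m) (@index_value g m) t =
  \sum_(j : grid_index m) ((\1_(cell j) t : R)%:C *: g (corner j)).
Proof. by rewrite big_enum_val. Qed.

Lemma grid_eval_cell g m (j : grid_index m) t : cell j t ->
  sfun_eval (@index_cell m) (@index_value g m) t = g (corner j).
Proof.
move=> jt; rewrite grid_evalE (bigD1 j) //= big1 ?addr0 => [|i ij].
  by rewrite indicZ mem_set.
rewrite indicZ memNset // => it; move/negP: ij; apply.
by apply/eqP; exact: cell_disjoint it jt.
Qed.

Lemma grid_eval_out g m t : ~ (exists j : grid_index m, cell j t) ->
  sfun_eval (@index_cell m) (@index_value g m) t = 0.
Proof.
move=> nt; rewrite grid_evalE big1 // => i _; rewrite indicZ memNset // => it.
by apply: nt; exists i.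
Qed.

Lemma grid_eval_cvg g t : ncontinuous g ->
  nrm (g (rv_of_tuple t) - sfun_eval (@index_cell m) (@index_value g m) t) @[m --> \oo] --> (0 : R).
Proof.
move=> gc; apply/cvgrPdist_lt => e e0; near=> m.
rewrite sub0r normrN ger0_norm ?nrm_ge0 //.
have [j jt] : exists j : grid_index m, cell j t by near: m; exact: cell_eventually.
rewrite (grid_eval_cell g jt).
have H : forall j : grid_index m, cell j t ->
   `|nrm (g (corner j) - g (rv_of_tuple t)) - nrm (g (rv_of_tuple t) - g (rv_of_tuple t))| < e.
  near: m; exact: (@cont_corner _ _ (fun x => nrm (g x - g (rv_of_tuple t))) t e
    (@ncontinuous_dist g _ gc _) e0).
by have := H j jt; rewrite subrr nrm0 subr0 ger0_norm ?nrm_ge0 // nrmB.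
Unshelve. all: by end_near. Qed.

(** A majorant independent of [m]: a corner is within 1 of [t] in each coordinate, so [sqnorm_near]
    trades half of the rate for the factor exp(a n). Off the grid the step function is 0. *)
Lemma grid_eval_bound g (c a : R) m t : 0 < a ->
  (forall x, nrm (g x) <= c * expR (- a * sqnorm x)) ->
  nrm (g (rv_of_tuple t) - sfun_eval (@index_cell m) (@index_value g m) t) <=
    c * (1 + expR (a * n%:R)) * expR (- (a / 2) * sqnorm (rv_of_tuple t)).
Proof.
move=> a0 gb; have c0 : 0 <= c.
  by have := le_trans (nrm_ge0 _) (gb 0); rewrite pmulr_lge0 ?expR_gt0.
have s0 := sqnorm_ge0 (rv_of_tuple t).
have h1 : nrm (g (rv_of_tuple t)) <= c * expR (- (a / 2) * sqnorm (rv_of_tuple t)).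
  rewrite (le_trans (gb _)) // ler_wpM2l // ler_expR ler_wpM2r //; lra.
rewrite mulrDr mulr1 mulrDl.
have [[j jt]|nj] := pselect (exists j : grid_index m, cell j t); last first.
  by rewrite grid_eval_out // subr0 (le_trans h1) // lerDl !mulr_ge0 ?expR_ge0.
rewrite (grid_eval_cell g jt) (le_trans (nrmD _ _)) // lerD // nrmN.
rewrite (le_trans (gb _)) // -mulrA ler_wpM2l // -expRD ler_expR.
have := @sqnorm_near _ _ (corner j) (rv_of_tuple t).
have near1 i : `|corner j ord0 i - rv_of_tuple t ord0 i| <= 1.
  rewrite rvE (le_trans (corner_near i jt)) // invf_le1 ?ltr0n // ler1n //.
move=> /(_ near1) h.
have := ler_wpM2l (ltW (divr_gt0 a0 (ltr0n R 2))) h.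
lra.
Qed.

Variable mu : {measure set T -> \bar R}.
Hypothesis leb : is_lebesgue_Rn mu.

Lemma grid_ok m : sfun_ok mu (@index_cell m).
Proof. by move=> i; split; [exact: measurable_cell|exact: mu_obox_fin]. Qed.

Lemma grid_L1 g : gauss_class g ->
  (\int[mu]_t (nrm (g (rv_of_tuple t) - sfun_eval (@index_cell m) (@index_value g m) t))%:E)%E
    @[m --> \oo] --> (0%:E)%E.
Proof.
move=> [gc [c [a [a0 gb]]]].
pose F m t := (nrm (g (rv_of_tuple t) - sfun_eval (@index_cell m) (@index_value g m) t))%:E.
have mF m : measurable_fun [set: T] (F m).
  apply/measurable_EFinP.
  exact: dist_measurable_nrm (dist_measurable_sfun _ (dist_measurable_rv gc)
     (fun i => (grid_ok i).1)).
have a2 : 0 < a / 2 by rewrite divr_gt0.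
pose bd t := (c * (1 + expR (a * n%:R)) * expR (- (a / 2) * sqnorm (rv_of_tuple t)))%:E.
have ig : mu.-integrable setT bd := integrable_gauss leb _ a2.
have bdfin t : [set: T] t -> bd t \is a fin_num by [].
have Fc t : [set: T] t -> F m t @[m --> \oo] --> (0%:E : \bar R).
  move=> _; apply: cvg_EFin; first by near=> m.
  exact: (grid_eval_cvg t gc).
have Fb m t : [set: T] t -> (`|F m t| <= bd t)%E.
  by move=> _; rewrite gee0_abs lee_fin ?nrm_ge0 // grid_eval_bound.
have := dominated_cvg measurableT mF Fc bdfin ig Fb.
by rewrite integral0.
Unshelve. all: by end_near. Qed.

End GaussianClass.

(** * Integrals of nonnegative Gaussian-dominated functions *)

Section RealGaussian.
Context {R : realType} {n : nat}.
Local Notation T := (n.-tuple R).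
Local Notation V := 'rV[R]_n.
Implicit Types (x y s : V) (t : T) (phi psi : V -> R).
Variable mu : {measure set T -> \bar R}.
Hypothesis leb : is_lebesgue_Rn mu.

Definition gauss_dominated phi := [/\ continuous phi, forall x, 0 <= phi x &
  exists c a : R, 0 < a /\ forall x, phi x <= c * expR (- a * sqnorm x)].

Definition intR phi : R := fine (\int[mu]_t (phi (rv_of_tuple t))%:E)%E.

Lemma measurable_rv phi : continuous phi ->
  measurable_fun [set: T] (fun t => (phi (rv_of_tuple t))%:E).
Proof. by move=> pc; apply/measurable_EFinP; exact: measurable_continuous. Qed.

Lemma intRE phi : gauss_dominated phi -> (\int[mu]_t (phi (rv_of_tuple t))%:E = (intR phi)%:E)%E.
Proof.
move=> [pc p0 [c [a [a0 pb]]]]; rewrite fineK // ge0_fin_numE; last first.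
  by apply: integral_ge0 => t _; rewrite lee_fin.
have /integrableP[mg] := integrable_gauss leb c a0.
apply: le_lt_trans; apply: ge0_le_integral => //.
- by move=> t _; rewrite lee_fin.
- exact: measurable_rv.
- exact: measurableT_comp.
- by move=> t _; rewrite /= lee_fin (le_trans (pb _)) // ler_norm.
Qed.

Lemma intR_ge0 phi : (forall x, 0 <= phi x) -> 0 <= intR phi.
Proof. by move=> p0; rewrite fine_ge0 // integral_ge0 // => t _; rewrite lee_fin. Qed.

Lemma gauss_dominatedD phi psi : gauss_dominated phi -> gauss_dominated psi ->
  gauss_dominated (fun x => phi x + psi x).
Proof.
move=> [pc p0 [c [a [a0 pb]]]] [qc q0 [d [b [b0 qb]]]]; split.
- by move=> x; exact: (continuousD (pc x) (qc x)).
- by move=> x; rewrite addr_ge0.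
have c0 : 0 <= c by have := le_trans (p0 _) (pb 0); rewrite pmulr_lge0 ?expR_gt0.
have d0 : 0 <= d by have := le_trans (q0 _) (qb 0); rewrite pmulr_lge0 ?expR_gt0.
exists (c + d), (Num.min a b); split; first by rewrite lt_min a0.
move=> x; rewrite mulrDl lerD //.
  rewrite (le_trans (pb x)) // ler_wpM2l // ler_expR ler_wpM2r ?sqnorm_ge0 // lerN2.
  by rewrite ge_min lexx.
rewrite (le_trans (qb x)) // ler_wpM2l // ler_expR ler_wpM2r ?sqnorm_ge0 // lerN2.
by rewrite ge_min lexx orbT.
Qed.

Lemma gauss_dominatedZ (k : R) phi : 0 <= k -> gauss_dominated phi ->
  gauss_dominated (fun x => k * phi x).
Proof.
move=> k0 [pc p0 [c [a [a0 pb]]]]; split.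
- by move=> x; exact: (continuousM (@cst_continuous _ _ k x) (pc x)).
- by move=> x; rewrite mulr_ge0.
by exists (k * c), a; split => // x; rewrite -mulrA ler_wpM2l.
Qed.

Lemma intRD phi psi : gauss_dominated phi -> gauss_dominated psi ->
  intR (fun x => phi x + psi x) = intR phi + intR psi.
Proof.
move=> gp gq; have [pc p0 _] := gp; have [qc q0 _] := gq.
apply: EFin_inj; rewrite EFinD -!intRE //; last exact: gauss_dominatedD.
under eq_integral do rewrite EFinD.
by rewrite ge0_integralD //; [move=> t _; rewrite lee_fin|exact: measurable_rv|
  move=> t _; rewrite lee_fin|exact: measurable_rv].
Qed.

Lemma intRZ (k : R) phi : 0 <= k -> gauss_dominated phi ->
  intR (fun x => k * phi x) = k * intR phi.
Proof.
move=> k0 gp; have [pc p0 _] := gp.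
apply: EFin_inj; rewrite EFinM -!intRE //; last exact: gauss_dominatedZ.
under eq_integral do rewrite EFinM.
by rewrite ge0_integralZl //; [exact: measurable_rv|move=> t _; rewrite lee_fin].
Qed.

Lemma rv_shift s t : rv_of_tuple (shift (fun i => s ord0 i) t) = rv_of_tuple t + s.
Proof. by apply/rowP => i; rewrite !mxE tnth_mktuple. Qed.

Lemma intR_shift s phi : continuous phi -> (forall x, 0 <= phi x) ->
  intR (fun x => phi (x + s)) = intR phi.
Proof.
move=> pc p0; congr fine.
rewrite -(integral_shift leb (fun i => s ord0 i) (measurable_rv pc)) => [|t];
  last by rewrite lee_fin.
by apply: eq_integral => t _; rewrite rv_shift.
Qed.

Definition gauss (a : R) x := expR (- a * sqnorm x).

Lemma continuous_gauss (a : R) : continuous (gauss a).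
Proof.
apply: continuous_expR_comp => x.
exact: (@continuousM R V (fun=> - a) (@sqnorm R n) x (@cst_continuous _ _ _ x)
  (@continuous_sqnorm _ _ x)).
Qed.

Lemma gauss_dominated_gauss (a : R) : 0 < a -> gauss_dominated (gauss a).
Proof.
move=> a0; split; [exact: continuous_gauss|by move=> x; exact: expR_ge0|].
by exists 1, a; split => // x; rewrite mul1r.
Qed.

End RealGaussian.

(** * Bochner integrals of Gaussian-dominated functions *)

Section VectorGaussian.
Context {R : realType} {n : nat} {X : completeNormedModType R[i]}.
Local Notation T := (n.-tuple R).
Local Notation V := 'rV[R]_n.
Local Notation C := R[i].
Implicit Types (x y s : V) (t : T) (g h : V -> X) (v : X).
Variable mu : {measure set T -> \bar R}.
Hypothesis leb : is_lebesgue_Rn mu.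

(** Completeness of X enters here: two grid sums differ by at most the sum of their L1 errors, so
    they form a Cauchy sequence. *)
Lemma grid_int_cvg g : gauss_class g ->
  cvg (sfun_int mu (@index_cell R n m) (@index_value R n X g m) @[m --> \oo]).
Proof.
move=> gg; have gc := gg.1; apply: cauchy_cvg; apply: cauchy_exP => e e0.
have [a a0 ->] : exists2 a : R, 0 < a & e = a%:C.
  by case: e e0 => a b; rewrite ltcE /= => /andP[/eqP -> ?]; exists a.
pose L m := (\int[mu]_t (nrm (g (rv_of_tuple t) -
  sfun_eval (@index_cell R n m) (@index_value R n X g m) t))%:E)%E.
have Ls : \forall m \near \oo, (L m < (a / 2)%:E)%E.
  have := grid_L1 leb gg => /(_ `]-oo, (a / 2)%:E[%classic).
  case.
    apply: open_nbhs_nbhs; split; first exact: open_ereal_lt_ereal.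
    by rewrite /= in_itv /= lte_fin divr_gt0.
  by move=> N _ h; exists N => // m /h /=; rewrite in_itv.
have [m0 _ Lm0] := Ls.
exists (sfun_int mu (@index_cell R n m0) (@index_value R n X g m0)).
suff H : \forall m \near \oo, nrm (sfun_int mu (@index_cell R n m0) (@index_value R n X g m0) -
    sfun_int mu (@index_cell R n m) (@index_value R n X g m)) < a.
  by apply: filterS H => m h; rewrite /= -ball_normE /= normX ltcR.
near=> m.
have Lm : (L m < (a / 2)%:E)%E by near: m; exact: Ls.
have Lm0' := Lm0 m0 (leqnn m0).
have mfm k : measurable_fun [set: T] (fun t => (nrm (g (rv_of_tuple t) -
    sfun_eval (@index_cell R n k) (@index_value R n X g k) t))%:E).
  apply/measurable_EFinP.
  exact: dist_measurable_nrm (dist_measurable_sfun _ (dist_measurable_rv gc)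
     (fun i => (grid_ok leb i).1)).
rewrite -lte_fin.
apply: le_lt_trans (sfun_int_dist_le _ _ (grid_ok leb (m:=m0)) (grid_ok leb (m:=m))) _.
have : (L m0 + L m < a%:E)%E by rewrite (splitr a) EFinD lteD.
apply: le_lt_trans; rewrite /L -ge0_integralD //; last 2 first.
- by move=> t _; rewrite lee_fin nrm_ge0.
- by move=> t _; rewrite lee_fin nrm_ge0.
apply: ge0_le_integral => //.
- by move=> t _; rewrite lee_fin nrm_ge0.
- apply/measurable_EFinP.
  have := sfun_measurable (cat_fun (@index_value R n X g m0)
     (fun i => (-1) *: @index_value R n X g m i)) (0 : X)
     (fun i => (sfun_ok_cat (grid_ok leb (m:=m0)) (grid_ok leb (m:=m)) i).1).
  by under eq_fun do rewrite sfun_eval_cat sfun_evalZ scaleN1r add0r.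
- exact: emeasurable_funD.
move=> t _; rewrite -EFinD lee_fin.
by rewrite (le_trans (nrm_triangle (g (rv_of_tuple t)) _ _)) // lerD2r nrmB.
Unshelve. all: by end_near. Qed.

Definition intX g : X := bochner_integral mu (fun t => g (rv_of_tuple t)).

(** [intX] is 0 by default, so an integral must first be shown to exist: the grid step functions are
    the required witness. *)
Lemma intX_approx g : gauss_class g -> bochner_approx mu (fun t => g (rv_of_tuple t)) (intX g).
Proof.
move=> gg; apply: is_bochner_approx.
suff [y gy] : exists y : X, is_bochner_integral mu (fun t => g (rv_of_tuple t)) y.
  by rewrite /intX /bochner_integral; exact: (@xgetPex _ 0 [set y | _] (ex_intro _ y gy)).
exists (lim (sfun_int mu (@index_cell R n m) (@index_value R n X g m) @[m --> \oo])).
exists (fun m => #|{: grid_index (n := n) m}|), (@index_cell R n), (@index_value R n X g).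
split; first by move=> m i; exact: grid_ok.
split; first by apply: aeW => t; apply/nrm_cvgP;
  have := grid_eval_cvg t gg.1; under eq_fun do rewrite nrmB.
by split; [exact: grid_L1|exact: grid_int_cvg].
Qed.

Lemma intX_eq g (y : X) : gauss_class g ->
  bochner_approx mu (fun t => g (rv_of_tuple t)) y -> intX g = y.
Proof.
move=> gg; apply: bochner_approx_unique; last exact: intX_approx.
exact: dist_measurable_rv gg.1.
Qed.

Lemma intXD g h : gauss_class g -> gauss_class h -> intX (fun x => g x + h x) = intX g + intX h.
Proof.
move=> gg gh; have ggh := gauss_classD gg gh; apply: intX_eq => //.
by apply: bochner_approxD; by [exact: dist_measurable_rv gg.1|exact: dist_measurable_rv gh.1|
  exact: dist_measurable_rv ggh.1|exact: intX_approx].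
Qed.

Lemma intXZ (a : C) g : gauss_class g -> intX (fun x => a *: g x) = a *: intX g.
Proof.
move=> gg; apply: intX_eq; first exact: gauss_classZ.
by apply: bochner_approxZ; [exact: dist_measurable_rv gg.1|exact: intX_approx].
Qed.

Lemma gauss_class0 : gauss_class (fun _ : V => 0 : X).
Proof.
split; first exact: ncontinuous_cst.
by exists 1, 1; split => // x; rewrite nrm0 mul1r expR_ge0.
Qed.

Lemma intX0 : intX (fun=> 0) = 0.
Proof. by apply: intX_eq; [exact: gauss_class0|exact: bochner_approx0]. Qed.

Lemma gauss_class_sum I (r : seq I) (g_ : I -> V -> X) : (forall i, gauss_class (g_ i)) ->
  gauss_class (fun x => \sum_(i <- r) g_ i x).
Proof.
move=> gg; elim: r => [|i r ih].
  by under eq_fun do rewrite big_nil; exact: gauss_class0.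
by under eq_fun do rewrite big_cons; exact: gauss_classD.
Qed.

Lemma intX_sum I (r : seq I) (g_ : I -> V -> X) : (forall i, gauss_class (g_ i)) ->
  intX (fun x => \sum_(i <- r) g_ i x) = \sum_(i <- r) intX (g_ i).
Proof.
move=> gg; elim: r => [|i r ih].
  by under eq_fun do rewrite big_nil; rewrite big_nil intX0.
under eq_fun do rewrite big_cons.
by rewrite intXD // ?ih ?big_cons //; exact: gauss_class_sum.
Qed.

Lemma intX_le g (phi : V -> R) : gauss_class g -> gauss_dominated phi ->
  (forall x, nrm (g x) <= phi x) -> nrm (intX g) <= intR mu phi.
Proof.
move=> gg gp gphi; rewrite -lee_fin -intRE //.
have mg := dist_measurable_rv gg.1.
apply: le_trans (bochner_approx_le mg (intX_approx gg)) _.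
apply: ge0_le_integral => //.
- by move=> t _; rewrite lee_fin nrm_ge0.
- by apply/measurable_EFinP; exact: dist_measurable_nrm mg.
- by case: gp => pc _ _; exact: measurable_rv.
- by move=> t _; rewrite lee_fin.
Qed.

(** Pulling back the sets of an approximating simple function along the shift preserves their
    measures, hence its integral. *)
Lemma intX_shift s g : gauss_class g -> gauss_class (fun x => g (x + s)) ->
  intX (fun x => g (x + s)) = intX g.
Proof.
move=> gg ggs; apply: intX_eq => // e e0.
have [k [A [c [okA gA Ay]]]] := intX_approx gg e0.
pose sh : T -> T := shift (fun i => s ord0 i).
have ms : measurable_fun setT sh := measurable_shift _.
have shm (B : set T) : measurable B -> measurable (sh @^-1` B).
  by move=> mB; rewrite -[X in measurable X]setTI; exact: ms.
exists k, (fun i => sh @^-1` A i), c; split.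
- by move=> i; have [mA Aoo] := okA i; split; [exact: shm|rewrite mu_shift].
- pose F t := (nrm (g (rv_of_tuple t) - sfun_eval A c t))%:E.
  have mF : measurable_fun [set: T] F.
    apply/measurable_EFinP.
    exact: dist_measurable_nrm (dist_measurable_sfun _ (dist_measurable_rv gg.1)
      (fun i => (okA i).1)).
  have F0 t : (0 <= F t)%E by rewrite lee_fin nrm_ge0.
  have E := integral_shift leb (fun i => s ord0 i) mF F0.
  apply: le_trans gA; rewrite -[leRHS]E le_eqVlt; apply/orP; left; apply/eqP.
  by apply: eq_integral => t _; rewrite /F rv_shift.
- have -> : sfun_int mu (fun i => sh @^-1` A i) c = sfun_int mu A c; last by [].
  by apply: eq_bigr => i _; rewrite mu_shift //; case: (okA i).
Qed.

Lemma gauss_class_vec (phi : V -> R) v : gauss_dominated phi ->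
  gauss_class (fun x => (phi x)%:C *: v).
Proof.
move=> [pc p0 [c [a [a0 pb]]]]; split.
  by apply: ncontinuousZR => //; exact: ncontinuous_cst.
exists (c * nrm v), a; split => // x; rewrite nrmZR ger0_norm // mulrAC.
by rewrite ler_wpM2r ?nrm_ge0.
Qed.

(** The same grid approximates both sides: its vector integral is [S%:C *: v], with [S] the grid sum
    for [phi], and the L1 error controls |S - intR phi| times the norm of [v]. *)
Lemma intX_vec (phi : V -> R) v : gauss_dominated phi ->
  intX (fun x => (phi x)%:C *: v) = (intR mu phi)%:C *: v.
Proof.
move=> gp; have gv := gauss_class_vec v gp; have [pc p0 _] := gp.
apply: intX_eq => // e e0.
have := grid_L1 leb gv => /(_ `]-oo, e%:E[%classic).
case.
  apply: open_nbhs_nbhs; split; first exact: open_ereal_lt_ereal.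
  by rewrite /= in_itv /= lte_fin.
move=> m _ /(_ m (leqnn m)) /=; rewrite in_itv /=; set L := integral _ _ _ => Le.
exists #|{: grid_index (n := n) m}|, (@index_cell R n m),
  (@index_value R n X (fun x => (phi x)%:C *: v) m).
split; [exact: grid_ok|exact: ltW|].
pose S := \sum_(j : grid_index m) fine (mu (cell j)) * phi (corner j).
have -> : sfun_int mu (@index_cell R n m) (@index_value R n X (fun x => (phi x)%:C *: v) m) =
    S%:C *: v.
  rewrite /S raddf_sum scaler_suml big_enum_val; apply: eq_bigr => i _.
  by rewrite /index_value scalerA -rmorphM.
rewrite -scalerBl -rmorphB nrmZR.
pose r := nrm v; have r0 : 0 <= r := nrm_ge0 v.
have nE t : nrm ((phi (rv_of_tuple t))%:C *: v -
    sfun_eval (@index_cell R n m) (@index_value R n X (fun x => (phi x)%:C *: v) m) t) =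
    `|phi (rv_of_tuple t) - gridR phi m t| * r.
  have E : (gridR phi m t)%:C =
      \sum_(j : grid_index m) (\1_(cell j) t * phi (corner j))%:C :> C.
    by rewrite /gridR raddf_sum.
  rewrite grid_evalE -nrmZR rmorphB /= E scalerBl scaler_suml.
  by congr (nrm (_ - _)); apply: eq_bigr => j _; rewrite scalerA -rmorphM.
pose G t := (gridR phi m t * r)%:E; pose P t := (phi (rv_of_tuple t) * r)%:E.
pose D t := (`|phi (rv_of_tuple t) - gridR phi m t| * r)%:E.
have g0 t : 0 <= gridR phi m t.
  by apply: sumr_ge0 => j _; rewrite mulr_ge0.
have mG : measurable_fun [set: T] G.
  by apply/measurable_EFinP; apply: measurable_funM => //; exact: measurable_gridR.
have mP : measurable_fun [set: T] P.
  by apply/measurable_EFinP; apply: measurable_funM => //; exact: measurable_continuous.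
have mD : measurable_fun [set: T] D.
  apply/measurable_EFinP; apply: measurable_funM => //; apply: measurableT_comp => //.
  by apply: measurable_funB; [exact: measurable_continuous|exact: measurable_gridR].
have G0 t : (0 <= G t)%E by rewrite lee_fin mulr_ge0.
have P0 t : (0 <= P t)%E by rewrite lee_fin mulr_ge0.
have D0 t : (0 <= D t)%E by rewrite lee_fin mulr_ge0.
have LE : L = (\int[mu]_t D t)%E by apply: eq_integral => t _; rewrite nE.
have PE : (\int[mu]_t P t = (intR mu phi * r)%:E)%E.
  rewrite EFinM -intRE // muleC -ge0_integralZl //; last 2 first.
  - exact: measurable_rv.
  - by move=> t _; rewrite lee_fin.
  by apply: eq_integral => t _; rewrite /P EFinM muleC.
have GE : (\int[mu]_t G t = (S * r)%:E)%E.
  have -> : G = fun t => (\sum_(j : grid_index m) (phi (corner j) * r)%:E * (\1_(cell j) t)%:E)%E.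
    apply/funext => t; rewrite /G /gridR mulr_suml -sumEFin; apply: eq_bigr => j _.
    by rewrite -EFinM; congr EFin; ring.
  rewrite ge0_integral_sum //; last 2 first.
  - move=> j; apply: emeasurable_funM; first exact: measurable_cst.
    by apply/measurable_EFinP; exact: measurable_indic (measurable_cell j).
  - by move=> j t _; rewrite -EFinM lee_fin !mulr_ge0.
  rewrite /S mulr_suml -sumEFin; apply: eq_bigr => j _.
  have mI : measurable_fun [set: T] (fun t => (\1_(cell j) t)%:E : \bar R).
    by apply/measurable_EFinP; exact: measurable_indic (measurable_cell j).
  have i0 t : (0 <= (\1_(cell j) t)%:E :> \bar R)%E by rewrite lee_fin.
  have c0 : (0 <= (phi (corner j) * r)%:E)%E by rewrite lee_fin mulr_ge0.
  rewrite (ge0_integralZl mu measurableT mI (fun t _ => i0 t) c0).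
  rewrite integral_indic ?setIT //; last exact: measurable_cell.
  rewrite -{1}(@fineK _ (mu (cell j))) -?EFinM; last first.
    by rewrite ge0_fin_numE //; exact: mu_obox_fin.
  by congr EFin; ring.
have h1 : (\int[mu]_t P t <= \int[mu]_t G t + L)%E.
  rewrite LE -ge0_integralD //; apply: ge0_le_integral => //.
    exact: emeasurable_funD.
  move=> t _; rewrite /P /G /D -EFinD lee_fin -mulrDl ler_wpM2r //.
  by rewrite -lerBlDl ler_norm.
have h2 : (\int[mu]_t G t <= \int[mu]_t P t + L)%E.
  rewrite LE -ge0_integralD //; apply: ge0_le_integral => //.
    exact: emeasurable_funD.
  move=> t _; rewrite /P /G /D -EFinD lee_fin -mulrDl ler_wpM2r //.
  by rewrite -lerBlDl distrC ler_norm.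
rewrite PE GE in h1 h2.
have L0 : (0 <= L)%E by rewrite LE integral_ge0.
have Lfin : L \is a fin_num by rewrite ge0_fin_numE // (lt_trans Le) // ltry.
rewrite -(fineK Lfin) -EFinD lee_fin in h1; rewrite -(fineK Lfin) -EFinD lee_fin in h2.
rewrite -(fineK Lfin) lte_fin in Le.
rewrite -[nrm v](ger0_norm r0) -normrM mulrBl ler_norml -/r.
by apply/andP; split; lra.
Qed.

End VectorGaussian.

(** * Moments of f *)

Section Multipliers.
Context {R : realType} {n : nat}.
Local Notation V := 'rV[R]_n.
Local Notation C := R[i].
Implicit Types (x y s v : V) (u w : V -> R).

(** Young's inequality in each coordinate. It makes the exponential of a linear form negligible
    against a Gaussian of any rate. *)
Lemma dotR_le (b e : R) v x : 0 < e -> 0 <= b ->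
  b * `|dotR v x| <= e * sqnorm x + b ^+ 2 / (4 * e) * sqnorm v.
Proof.
move=> e0 b0; rewrite /sqnorm /dotR.
rewrite (le_trans (ler_wpM2l b0 (ler_norm_sum _ _ _))) //.
rewrite !mulr_sumr -big_split /=; apply: ler_sum => i _.
set p := v ord0 i; set q := x ord0 i; rewrite normrM.
have -> : q * q = `|q| ^+ 2 by rewrite real_normK ?num_real // expr2.
have -> : p * p = `|p| ^+ 2 by rewrite real_normK ?num_real // expr2.
have : 0 <= (2 * e * `|q| - b * `|p|) ^+ 2 / (4 * e).
  by rewrite divr_ge0 ?sqr_ge0 // mulr_ge0 // ltW.
have -> : (2 * e * `|q| - b * `|p|) ^+ 2 / (4 * e) =
  e * `|q| ^+ 2 + b ^+ 2 / (4 * e) * `|p| ^+ 2 - b * (`|p| * `|q|).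
  by field; rewrite gt_eqF.
by rewrite subr_ge0.
Qed.

(** Multipliers that preserve [gauss_class]: asking for every rate [e] makes the class stable under
    products. *)
Definition tame u := continuous u /\
  forall e : R, 0 < e -> exists K : R, forall x, `|u x| <= K * expR (e * sqnorm x).

Lemma tameM u w : tame u -> tame w -> tame (fun x => u x * w x).
Proof.
move=> [uc ub] [wc wb]; split; first by move=> x; exact: (continuousM (uc x) (wc x)).
move=> e e0; have e2 : 0 < e / 2 by rewrite divr_gt0.
have [K uK] := ub _ e2; have [L wL] := wb _ e2.
exists (K * L) => x; rewrite normrM (le_trans (ler_pM _ _ (uK x) (wL x))) //.
by rewrite mulrACA -expRD -mulrDl -splitr.
Qed.

Lemma tame_cst (c : R) : tame (fun _ : V => c).
Proof.
split; first exact: cst_continuous.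
move=> e e0; exists `|c| => x; rewrite ler_peMr // -[leLHS]expR0 ler_expR.
by rewrite mulr_ge0 ?(ltW e0) // sqnorm_ge0.
Qed.

Lemma tameX u k : tame u -> tame (fun x => u x ^+ k).
Proof.
move=> ut; elim: k => [|k ih].
  by under eq_fun do rewrite expr0; exact: tame_cst.
by under eq_fun do rewrite exprS; exact: tameM.
Qed.

Lemma exp_dot_bound (b e : R) v : 0 < e -> 0 <= b ->
  exists2 K : R, 0 <= K & forall x, expR (b * `|dotR v x|) <= K * expR (e * sqnorm x).
Proof.
move=> e0 b0; exists (expR (b ^+ 2 / (4 * e) * sqnorm v)); first exact: expR_ge0.
by move=> x; rewrite -expRD ler_expR addrC dotR_le.
Qed.

Lemma tame_exp v : tame (fun x => expR (dotR v x)).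
Proof.
split; first by apply: continuous_expR_comp; exact: continuous_dotR.
move=> e e0; have [K _ Kb] := exp_dot_bound v e0 ler01.
exists K => x; rewrite ger0_norm ?expR_ge0 // (le_trans _ (Kb x)) // ler_expR mul1r.
exact: ler_norm.
Qed.

Lemma tame_dot v : tame (fun x => dotR v x).
Proof.
split; first exact: continuous_dotR.
move=> e e0; have [K _ Kb] := exp_dot_bound v e0 ler01.
exists K => x; rewrite (le_trans _ (Kb x)) // mul1r.
by rewrite (le_trans _ (expR_ge1Dx _)) // lerDr.
Qed.

Lemma dotR_coord i x : dotR (\row_j (j == i)%:R) x = x ord0 i.
Proof.
rewrite /dotR (bigD1 i) //= mxE eqxx mul1r big1 ?addr0 // => j ji.
by rewrite mxE (negbTE ji) mul0r.
Qed.

Lemma sqnormD x y : sqnorm (x + y) = sqnorm x + 2 * dotR x y + sqnorm y.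
Proof.
rewrite /sqnorm /dotR mulr_sumr -!big_split /=; apply: eq_bigr => i _.
by rewrite mxE; ring.
Qed.

Lemma dotRDl v y x : dotR (v + y) x = dotR v x + dotR y x.
Proof. by rewrite /dotR -big_split /=; apply: eq_bigr => i _; rewrite mxE mulrDl. Qed.

Lemma dotRDr v x y : dotR v (x + y) = dotR v x + dotR v y.
Proof. by rewrite /dotR -big_split /=; apply: eq_bigr => i _; rewrite mxE mulrDr. Qed.

Lemma dotRZl (c : R) v x : dotR (c *: v) x = c * dotR v x.
Proof. by rewrite /dotR mulr_sumr; apply: eq_bigr => i _; rewrite mxE mulrA. Qed.

Lemma dotRC x y : dotR x y = dotR y x.
Proof. by apply: eq_bigr => i _; rewrite mulrC. Qed.

Lemma sqnormZ (c : R) x : sqnorm (c *: x) = c ^+ 2 * sqnorm x.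
Proof. by rewrite /sqnorm dotRZl dotRC dotRZl mulrA expr2. Qed.

Lemma sqnormN x : sqnorm (- x) = sqnorm x.
Proof. by rewrite -scaleN1r sqnormZ sqrrN expr1n mul1r. Qed.

Lemma gauss_dominated_shift (a : R) s : 0 < a -> gauss_dominated (fun x => gauss a (x + s)).
Proof.
move=> a0; split; last 2 first.
- by move=> x; exact: expR_ge0.
- exists (expR (a * sqnorm s)), (a / 2); split; first by rewrite divr_gt0.
  move=> x; rewrite -expRD ler_expR.
  (* |x + s|^2 - |x|^2 / 2 + |s|^2 equals half of |x + 2 s|^2. *)
  have := sqnorm_ge0 (x + 2 *: s); rewrite !sqnormD sqnormZ.
  have -> : dotR x (2 *: s) = 2 * dotR x s by rewrite dotRC dotRZl dotRC.
  have a2 : 0 <= a / 2 by rewrite divr_ge0 // ltW.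
  by move=> /(mulr_ge0 a2); rewrite expr2; lra.
apply: continuous_expR_comp => x.
have -> : (fun y => - a * sqnorm (y + s)) =
    (fun y => - a * (sqnorm y + 2 * dotR s y + sqnorm s)).
  by apply/funext => y; rewrite sqnormD (dotRC y).
apply: (@continuousM R V (fun=> - a)); first exact: (@cst_continuous _ _ _ x).
apply: (@continuousD _ _ _ (fun y => sqnorm y + 2 * dotR s y) (fun=> sqnorm s));
  last exact: (@cst_continuous _ _ _ x).
apply: (@continuousD _ _ _ (@sqnorm R n) (fun y => 2 * dotR s y)).
  exact: continuous_sqnorm.
apply: (@continuousM R V (fun=> 2)); first exact: (@cst_continuous _ _ _ x).
exact: continuous_dotR.
Qed.

Context {X : completeNormedModType C}.
Implicit Types g : V -> X.

Lemma gauss_class_mul (m : V -> C) g :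
  continuous (fun x => complex.Re (m x)) -> continuous (fun x => complex.Im (m x)) ->
  (forall e : R, 0 < e -> exists K : R, forall x, cabs (m x) <= K * expR (e * sqnorm x)) ->
  gauss_class g -> gauss_class (fun x => m x *: g x).
Proof.
move=> rm im mb [gc [c [a [a0 gb]]]]; split; first exact: ncontinuousZ.
have a2 : 0 < a / 2 by rewrite divr_gt0.
have [K mK] := mb _ a2.
exists (K * c), (a / 2); split => // x.
rewrite nrmZ (le_trans (ler_pM (cabs_ge0 _) (nrm_ge0 _) (mK x) (gb x))) //.
rewrite mulrACA -expRD; have -> : a / 2 * sqnorm x + - a * sqnorm x = - (a / 2) * sqnorm x.
  by field.
by [].
Qed.

Lemma gauss_class_tame u g : tame u -> gauss_class g -> gauss_class (fun x => (u x)%:C *: g x).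
Proof.
move=> [uc ub]; apply: gauss_class_mul => //=; first exact: cst_continuous.
by move=> e /ub[K uK]; exists K => x; rewrite cabsR.
Qed.

Lemma gauss_class_cexp (w : C) v g : gauss_class g ->
  gauss_class (fun x => cexp (w * (dotR v x)%:C) *: g x).
Proof.
have dc := @continuous_dotR R n v.
have wE x : w * (dotR v x)%:C =
    (complex.Re w * dotR v x) +i* (complex.Im w * dotR v x).
  case: w => a b; apply/eqP; rewrite eq_complex /=.
  by apply/andP; split; apply/eqP; ring.
have ReE x : complex.Re (cexp (w * (dotR v x)%:C)) =
    expR (complex.Re w * dotR v x) * cos (complex.Im w * dotR v x).
  by rewrite wE /cexp /= !mul0r subr0.
have ImE x : complex.Im (cexp (w * (dotR v x)%:C)) =
    expR (complex.Re w * dotR v x) * sin (complex.Im w * dotR v x).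
  by rewrite wE /cexp /= !mul0r addr0.
have lin (c : R) : continuous (fun x : V => c * dotR v x).
  by move=> x; exact: (continuousM (@cst_continuous _ _ c x) (dc x)).
have hexp : continuous (fun x : V => expR (complex.Re w * dotR v x)).
  by apply: continuous_expR_comp; exact: lin.
have hcos : continuous (fun x : V => cos (complex.Im w * dotR v x)).
  by move=> x; apply: continuous_comp; [exact: lin|exact: continuous_cos].
have hsin : continuous (fun x : V => sin (complex.Im w * dotR v x)).
  by move=> x; apply: continuous_comp; [exact: lin|exact: continuous_sin].
apply: gauss_class_mul.
- by under eq_fun do rewrite ReE; move=> x; exact: (continuousM (hexp x) (hcos x)).
- by under eq_fun do rewrite ImE; move=> x; exact: (continuousM (hexp x) (hsin x)).
move=> e e0; have [K _ Kb] := exp_dot_bound v e0 (cabs_ge0 w).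
exists K => x; rewrite cabs_cexp (le_trans _ (Kb x)) // ler_expR.
rewrite (le_trans (ler_norm _)) // (le_trans (Re_le_cabs _)) //.
by rewrite cabsM cabsR.
Qed.

End Multipliers.

(** * The entire transform and the exponential moments of [f] *)

Section Moments.
Context {R : realType} {n : nat} {X : completeNormedModType R[i]}.
Local Notation T := (n.-tuple R).
Local Notation V := 'rV[R]_n.
Local Notation C := R[i].
Variable mu : {measure set T -> \bar R}.
Hypothesis leb : is_lebesgue_Rn mu.
Variable f : V -> X.
Hypothesis fc : ncontinuous f.
Hypothesis fgauss : forall x, nrm (f x) <= expR (- pi * sqnorm x).

Lemma gauss_class_f : gauss_class f.
Proof. by split => //; exists 1, pi; split => [|x]; rewrite ?pi_gt0 ?mul1r. Qed.

Let J := intR mu (gauss (n := n) pi).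

Let J_ge0 : 0 <= J.
Proof. by apply: intR_ge0 => x; exact: expR_ge0. Qed.

Lemma square_exp_le (u : R) : 0 <= u -> u ^+ 2 <= expR (2 * u).
Proof.
move=> u0; rewrite expRM_natl lerXn2r ?nnegrE ?expR_ge0 //.
by rewrite (le_trans _ (expR_ge1Dx _)) // lerDr.
Qed.

(** Replacing the exponential under the integral by (1 + y/(N+1))^(N+1) gives a polynomial in [z]
    whose coefficients are multiples of the moments of [f] along [v]. The error is uniform for |z|
    <= r because the Gaussian absorbs it. *)
Lemma entire_laplace (w : C) (v : V) :
  entire (fun z => intX mu (fun x => cexp (w * z * (dotR v x)%:C) *: f x)).
Proof.
move=> r e e0; have gf := gauss_class_f.
pose b := cabs w * Num.max r 0.
have r0 : 0 <= Num.max r 0 by rewrite le_max lexx orbT.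
have b0 : 0 <= b by rewrite mulr_ge0 ?cabs_ge0.
have p2 : (0 : R) < pi / 2 by rewrite divr_gt0 ?pi_gt0.
(* The error |y|^2 exp(2 |y|) of [cexp_approx] is at most exp(4 |y|), whence the 4; half of the rate
   [pi] is spent on it. *)
have [K K0 Kb] := exp_dot_bound v p2 (mulr_ge0 (ler0n R 4) b0).
pose J2 := intR mu (gauss (n := n) (pi / 2)).
have gJ2 : gauss_dominated (gauss (n := n) (pi / 2)) := gauss_dominated_gauss p2.
have J20 : 0 <= J2 by apply: intR_ge0 => x; exact: expR_ge0.
pose N := Num.truncn (4 * K * J2 / e).
have N0 : (0 : R) < N.+1%:R by rewrite ltr0n.
have NE : 4 * K / N.+1%:R * J2 <= e.
  have h : 4 * K * J2 / e < N.+1%:R by exact: truncnS_gt.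
  rewrite mulrAC ler_pdivrMr //; move: h.
  by rewrite ltr_pdivrMr // [_ * e]mulrC => /ltW.
have gk k : gauss_class (fun x => ((dotR v x) ^+ k)%:C *: f x).
  by apply: gauss_class_tame => //; apply: tameX; exact: tame_dot.
exists (fun z => intX mu (fun x => (1 + w * z * (dotR v x)%:C / N.+1%:R) ^+ N.+1 *: f x)).
  exists N.+2, (fun k => ('C(N.+1, k)%:R * (w / N.+1%:R) ^+ k) *: 'X^k),
    (fun k => intX mu (fun x => ((dotR v x) ^+ k)%:C *: f x)) => z.
  have -> : (fun x => (1 + w * z * (dotR v x)%:C / N.+1%:R) ^+ N.+1 *: f x) =
     (fun x => \sum_(k < N.+2) (('C(N.+1, k)%:R * (w / N.+1%:R) ^+ k) *: 'X^k).[z] *: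
         (((dotR v x) ^+ k)%:C *: f x)).
    apply/funext => x; rewrite exprDn scaler_suml; apply: eq_bigr => k _.
    rewrite scalerA; congr (_ *: _); rewrite expr1n mul1r hornerZ hornerXn rmorphXn /=.
    rewrite -mulr_natl; rewrite -!mulrA; congr (_ * _).
    by rewrite mulrA -!exprMn; congr (_ ^+ _); ring.
  rewrite intX_sum //; last by move=> k; exact: gauss_classZ.
  by apply: eq_bigr => k _; rewrite intXZ.
move=> z zr.
have gcx := gauss_class_cexp (w * z) v gf.
have gp : gauss_class (fun x => (1 + w * z * (dotR v x)%:C / N.+1%:R) ^+ N.+1 *: f x).
  have -> : (fun x => (1 + w * z * (dotR v x)%:C / N.+1%:R) ^+ N.+1 *: f x) =
     (fun x => \sum_(k < N.+2) ('C(N.+1, k)%:R * (w * z / N.+1%:R) ^+ k) *: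
         (((dotR v x) ^+ k)%:C *: f x)).
    apply/funext => x; rewrite exprDn scaler_suml; apply: eq_bigr => k _.
    rewrite scalerA; congr (_ *: _); rewrite expr1n mul1r rmorphXn /=.
    rewrite -mulr_natl -[RHS]mulrA; congr (_ * _).
    by rewrite -exprMn; congr (_ ^+ _); ring.
  by apply: gauss_class_sum => k; exact: gauss_classZ.
have gm := gauss_classZ (-1) gp.
rewrite -scaleN1r -intXZ // -intXD //.
apply: (le_trans _ NE).
have K4 : 0 <= 4 * K / N.+1%:R by rewrite divr_ge0 // mulr_ge0.
rewrite -(intRZ leb K4 gJ2).
apply: intX_le => //; [exact: gauss_classD|exact: gauss_dominatedZ|].
move=> x; rewrite scaleN1r -scalerBl nrmZ.
set y := w * z * _.
have yb : cabs y <= b * `|dotR v x|.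
  rewrite cabsM cabsR ler_wpM2r // cabsM ler_wpM2l ?cabs_ge0 // le_max zr //.
have h1 : 4 * cabs y ^+ 2 * expR (2 * cabs y) <= 4 * (K * expR (pi / 2 * sqnorm x)).
  rewrite -mulrA ler_wpM2l // (le_trans _ (Kb x)) //.
  apply: (@le_trans _ _ (expR (2 * cabs y) * expR (2 * cabs y))).
    by rewrite ler_wpM2r ?expR_ge0 // square_exp_le ?cabs_ge0.
  by rewrite -expRD ler_expR; lra.
have h2 := ler_pM (cabs_ge0 _) (nrm_ge0 (f x)) (cexp_approx y N) (fgauss x).
rewrite (le_trans h2) //.
have h3 : 4 * cabs y ^+ 2 * expR (2 * cabs y) / N.+1%:R <=
    4 * (K * expR (pi / 2 * sqnorm x)) / N.+1%:R by rewrite ler_wpM2r // invr_ge0.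
rewrite (le_trans (ler_wpM2r (expR_ge0 _) h3)) // /gauss.
have -> : expR (- (pi / 2) * sqnorm x) = expR (pi / 2 * sqnorm x) * expR (- pi * sqnorm x).
  by rewrite -expRD; congr expR; field.
by rewrite le_eqVlt; apply/orP; left; apply/eqP; field; rewrite gt_eqF.
Qed.

Hypothesis ffourier : forall xi : V, nrm (fourier mu f xi) <= expR (- pi * sqnorm xi).

Let w : C := (- (2 * pi))%:C * 'i.

Lemma hardy_moments (v : V) :
  intX mu (fun x => (expR (dotR ((2 * pi) *: v) x))%:C *: f x) =
  (expR (pi * sqnorm v))%:C *: intX mu f.
Proof.
have gf := gauss_class_f; have pi0 := @pi_gt0 R.
pose Phi z := intX mu (fun x => cexp (w * z * (dotR v x)%:C) *: f x).
pose F z := cexp ((pi * sqnorm v)%:C * z ^+ 2) *: Phi z.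
have Fe : entire F by apply: entire_cexpM; exact: entire_laplace.
have b0 : 0 <= pi * sqnorm v by rewrite mulr_ge0 ?sqnorm_ge0 // ltW.
have Re2 (x y : R) : complex.Re ((pi * sqnorm v)%:C * (x +i* y) ^+ 2) =
    pi * sqnorm v * (x ^+ 2 - y ^+ 2) by rewrite expr2 /=; ring.
(* One constant must serve both bounds: [J] suffices on the plane and 1 on the real line. *)
have Fgrowth (x y : R) : nrm (F (x +i* y)) <= (J + 1) * expR (pi * sqnorm v * x ^+ 2).
  rewrite nrmZ cabs_cexp Re2.
  have gJ := gauss_dominated_gauss (n := n) (@pi_gt0 R).
  have gJs : gauss_dominated (fun u => gauss (n := n) pi (u + - (y *: v))).
    exact: gauss_dominated_shift.
  (* Completing the square, 2 pi y v.u - pi |u|^2 = pi y^2 |v|^2 - pi |u - y v|^2, and the Gaussian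
     integral is translation invariant. *)
  have Phib : nrm (Phi (x +i* y)) <= expR (pi * sqnorm v * y ^+ 2) * J.
    have <- : intR mu (fun u => gauss (n := n) pi (u + - (y *: v))) = J.
      apply: intR_shift => //; [exact: continuous_gauss|by move=> u; exact: expR_ge0].
    rewrite -intRZ ?expR_ge0 //; apply: intX_le => //.
    - exact: gauss_class_cexp.
    - by apply: gauss_dominatedZ => //; exact: expR_ge0.
    move=> u; rewrite nrmZ cabs_cexp.
    have -> : complex.Re (w * (x +i* y) * (dotR v u)%:C) = 2 * pi * y * dotR v u.
      by rewrite /w /=; ring.
    rewrite (le_trans (ler_wpM2l (expR_ge0 _) (fgauss u))) // /gauss -!expRD ler_expR.
    have E : dotR u (- (y *: v)) = - y * dotR v u by rewrite dotRC -scaleNr dotRZl.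
    rewrite sqnormD sqnormN sqnormZ E; lra.
  rewrite (le_trans (ler_wpM2l (expR_ge0 _) Phib)) // mulrA -expRD mulrC.
  have -> : pi * sqnorm v * (x ^+ 2 - y ^+ 2) + pi * sqnorm v * y ^+ 2 = pi * sqnorm v * x ^+ 2.
    by ring.
  by rewrite ler_wpM2r ?expR_ge0 // lerDl.
have Freal (x : R) : nrm (F x%:C) <= J + 1.
  rewrite nrmZ cabs_cexp Re2 expr0n subr0.
  have -> : Phi x%:C = fourier mu f (x *: v).
    rewrite /Phi /intX /fourier; congr bochner_integral; apply/funext => t; congr (_ *: _).
    have -> : w * x%:C * (dotR v (rv_of_tuple t))%:C =
       0 +i* (- (2 * pi) * dotR (x *: v) (rv_of_tuple t)).
      by rewrite dotRZl /w; apply/eqP; rewrite eq_complex /=; apply/andP; split; apply/eqP; ring.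
    by rewrite cexpI.
  rewrite (le_trans (ler_wpM2l (expR_ge0 _) (ffourier _))) // -expRD sqnormZ.
  have -> : pi * sqnorm v * x ^+ 2 + - pi * (x ^+ 2 * sqnorm v) = 0 by ring.
  by rewrite expR0 lerDr.
have := hardy_entire Fe b0 Fgrowth Freal 'i.
rewrite /F /Phi expr0n mulr0 cexp0 scale1r.
have -> : (fun x => cexp (w * 0 * (dotR v x)%:C) *: f x) = f.
  by apply/funext => x; rewrite mulr0 mul0r cexp0 scale1r.
move=> <-; rewrite scalerA sqr_i.
have -> : (pi * sqnorm v)%:C * -1 = (- (pi * sqnorm v))%:C :> C by rewrite mulrN1 rmorphN.
rewrite cexpR -rmorphM -expRD subrr expR0 scale1r; congr intX; apply/funext => x.
congr (_ *: _); rewrite -cexpR; congr cexp.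
rewrite dotRZl /w; apply/eqP; rewrite eq_complex /=; apply/andP; split; apply/eqP; ring.
Qed.

End Moments.

(** * Injectivity of the Laplace transform *)

Section Injectivity.
Context {R : realType} {n : nat} {X : completeNormedModType R[i]}.
Local Notation T := (n.-tuple R).
Local Notation V := 'rV[R]_n.
Local Notation C := R[i].
Implicit Types (g h : V -> X) (x y eta : V) (u : V -> R).
Variable mu : {measure set T -> \bar R}.
Hypothesis leb : is_lebesgue_Rn mu.

Definition laplace0 g := gauss_class g /\
  forall eta, intX mu (fun x => (expR (dotR eta x))%:C *: g x) = 0.

Lemma gauss_class_exp eta g : gauss_class g -> gauss_class (fun x => (expR (dotR eta x))%:C *: g x).
Proof. by apply: gauss_class_tame; exact: tame_exp. Qed.

Lemma laplace0_cst : laplace0 (fun=> 0).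
Proof.
split; first exact: gauss_class0.
by move=> eta; under eq_fun do rewrite scaler0; exact: intX0.
Qed.

Lemma laplace0D g h : laplace0 g -> laplace0 h -> laplace0 (fun x => g x + h x).
Proof.
move=> [gg gV] [gh hV]; split; first exact: gauss_classD.
move=> eta; under eq_fun do rewrite scalerDr.
by rewrite intXD ?gV ?hV ?addr0 //; exact: gauss_class_exp.
Qed.

Lemma laplace0Z (a : C) g : laplace0 g -> laplace0 (fun x => a *: g x).
Proof.
move=> [gg gV]; split; first exact: gauss_classZ.
move=> eta; have -> : (fun x => (expR (dotR eta x))%:C *: (a *: g x)) =
    (fun x => a *: ((expR (dotR eta x))%:C *: g x)).
  by apply/funext => x; rewrite !scalerA mulrC.
by rewrite intXZ ?gV ?scaler0 //; exact: gauss_class_exp.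
Qed.

Lemma laplace0_sum I (r : seq I) (g_ : I -> V -> X) : (forall i, laplace0 (g_ i)) ->
  laplace0 (fun x => \sum_(i <- r) g_ i x).
Proof.
move=> gg; elim: r => [|i r ih].
  by under eq_fun do rewrite big_nil; exact: laplace0_cst.
by under eq_fun do rewrite big_cons; exact: (laplace0D (gg i) ih).
Qed.

Lemma gauss_class_bound g (K a b : R) (v : V) : 0 <= b -> 0 < a ->
  (forall x, nrm (g x) <= K * expR (- a * sqnorm x)) ->
  exists2 L : R, 0 <= L & forall x, expR (b * `|dotR v x|) * nrm (g x) <= L * gauss (a / 2) x.
Proof.
move=> b0 a0 gb; have a2 : 0 < a / 2 by rewrite divr_gt0.
have K0 : 0 <= K by have := le_trans (nrm_ge0 _) (gb 0); rewrite pmulr_lge0 ?expR_gt0.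
have [M M0 Mb] := exp_dot_bound v a2 b0.
exists (M * K) => [|x]; first exact: mulr_ge0.
rewrite (le_trans (ler_pM (expR_ge0 _) (nrm_ge0 _) (Mb x) (gb x))) // mulrACA -expRD /gauss.
have -> // : a / 2 * sqnorm x + - a * sqnorm x = - (a / 2) * sqnorm x by field.
Qed.

(** Error of the difference quotient of exp(t s) at t = 0: of the 3 in the exponent, 2 bounds s^2
    and 1 bounds exp(|t s|). *)
Lemma exp_quotient_bound (s t : R) : 0 < t -> t <= 1 ->
  `|s + (- t^-1 * expR (t * s) + t^-1)| <= t * expR (3 * `|s|).
Proof.
move=> t0 t1; have ti : 0 <= t^-1 by rewrite invr_ge0 ltW.
have -> : s + (- t^-1 * expR (t * s) + t^-1) = - (t^-1 * (expR (t * s) - 1 - t * s)).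
  by field; rewrite gt_eqF.
rewrite normrN normrM (ger0_norm ti) mulrC ler_pdivrMr //.
rewrite (le_trans (expR_remainder _)) //.
have ts : `|t * s| <= `|s| by rewrite normrM (ger0_norm (ltW t0)) ler_piMl.
have s2 : s ^+ 2 <= expR (2 * `|s|).
  by rewrite -(real_normK (num_real s)); exact: square_exp_le.
have -> : t * expR (3 * `|s|) * t = t ^+ 2 * (expR (2 * `|s|) * expR `|s|).
  have -> : 3 * `|s| = 2 * `|s| + `|s| by ring.
  by rewrite expRD; ring.
rewrite exprMn -mulrA ler_wpM2l ?sqr_ge0 // ler_pM ?sqr_ge0 ?expR_ge0 //.
by rewrite ler_expR.
Qed.

(* Differentiate the transform along [v]. *)
Lemma laplace0_dot v g : laplace0 g -> laplace0 (fun x => (dotR v x)%:C *: g x).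
Proof.
move=> [gg gV]; split; first by apply: gauss_class_tame => //; exact: tame_dot.
move=> eta; pose G x := (expR (dotR eta x))%:C *: g x.
have gG : gauss_class G := gauss_class_exp eta gg.
have [Gc [K [a [a0 Gb]]]] := gG.
have [L L0 Lb] := gauss_class_bound v (ler0n R 3) a0 Gb.
have a2 : 0 < a / 2 by rewrite divr_gt0.
have gJ : gauss_dominated (gauss (n := n) (a / 2)) := gauss_dominated_gauss a2.
pose J := intR mu (gauss (n := n) (a / 2)).
have J0 : 0 <= J by apply: intR_ge0 => x; exact: expR_ge0.
have -> : (fun x => (expR (dotR eta x))%:C *: ((dotR v x)%:C *: g x)) =
    (fun x => (dotR v x)%:C *: G x).
  by apply/funext => x; rewrite !scalerA mulrC.
have gvG : gauss_class (fun x => (dotR v x)%:C *: G x).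
  by apply: gauss_class_tame => //; exact: tame_dot.
apply: nrm_small => e e0.
have JE : intR mu (gauss (n := n) (a / 2)) = J by [].
clearbody J; pose t := Num.min 1 (e / (L * J + 1)).
have LJ : 0 < L * J + 1 by rewrite ltr_wpDl // mulr_ge0.
have t0 : 0 < t by rewrite lt_min ltr01 divr_gt0.
have t1 : t <= 1 by rewrite ge_min lexx.
have te : t * (L * J) <= e.
  have : t <= e / (L * J + 1) by rewrite ge_min lexx orbT.
  rewrite ler_pdivlMr // => h; have : 0 <= L * J by rewrite mulr_ge0.
  by move=> ?; lra.
have I1 : intX mu (fun x => (expR (dotR (eta + t *: v) x))%:C *: g x) = 0 := gV _.
have gt : gauss_class (fun x => (expR (dotR (eta + t *: v) x))%:C *: g x) := gauss_class_exp _ gg.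
(* The two added integrals vanish, being transforms of [g] at [eta + t *: v] and at [eta]; they
   complete the difference quotient. *)
have E : intX mu (fun x => (dotR v x)%:C *: G x) =
   intX mu (fun x => (dotR v x)%:C *: G x +
     ((- t^-1)%:C *: ((expR (dotR (eta + t *: v) x))%:C *: g x)
     + (t^-1)%:C *: G x)).
  rewrite intXD //; last by apply: gauss_classD; exact: gauss_classZ.
  rewrite intXD //; [|exact: gauss_classZ|exact: gauss_classZ].
  by rewrite !intXZ // I1 gV !scaler0 !addr0.
have tL : 0 <= t * L := mulr_ge0 (ltW t0) L0.
rewrite E; apply: le_trans te.
have -> : t * (L * J) = intR mu (fun x => t * L * gauss (a / 2) x).
  by rewrite (intRZ leb tL gJ) JE mulrA.
have gT := gauss_classD (gauss_classZ (- t^-1)%:C gt) (gauss_classZ (t^-1)%:C gG).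
apply: (intX_le leb (gauss_classD gvG gT) (gauss_dominatedZ tL gJ)).
move=> x; pose s := dotR v x.
have -> : (expR (dotR (eta + t *: v) x))%:C *: g x = (expR (t * s))%:C *: G x.
  by rewrite /G scalerA -rmorphM -expRD dotRDl dotRZl addrC.
have -> : (dotR v x)%:C *: G x + ((- t^-1)%:C *: ((expR (t * s))%:C *: G x) + (t^-1)%:C *: G x) =
    (s + (- t^-1 * expR (t * s) + t^-1))%:C *: G x.
  by rewrite scalerA -rmorphM -!scalerDl -!rmorphD.
rewrite nrmZR.
apply: le_trans (ler_wpM2r (nrm_ge0 _) (exp_quotient_bound s t0 t1)) _.
rewrite -mulrA -[leRHS]mulrA; exact: ler_wpM2l (ltW t0) _ _ (Lb x).
Qed.

Lemma laplace0_sqnorm g : laplace0 g -> laplace0 (fun x => (sqnorm x)%:C *: g x).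
Proof.
move=> gV; have -> : (fun x => (sqnorm x)%:C *: g x) =
    (fun x => \sum_(i < n) (dotR (\row_j (j == i)%:R) x)%:C *:
       ((dotR (\row_j (j == i)%:R) x)%:C *: g x)).
  apply/funext => x; rewrite /sqnorm /dotR raddf_sum scaler_suml.
  by apply: eq_bigr => i _; rewrite -/(dotR _ x) dotR_coord scalerA -rmorphM.
by apply: laplace0_sum => i; do 2!apply: laplace0_dot.
Qed.

Lemma laplace0_power (c : R) N g : laplace0 g ->
  laplace0 (fun x => ((1 + c * sqnorm x) ^+ N)%:C *: g x).
Proof.
move=> gV; elim: N => [|N ih].
  by under eq_fun do rewrite expr0 scale1r.
have -> : (fun x => ((1 + c * sqnorm x) ^+ N.+1)%:C *: g x) =
   (fun x => ((1 + c * sqnorm x) ^+ N)%:C *: g x +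
      c%:C *: ((sqnorm x)%:C *: (((1 + c * sqnorm x) ^+ N)%:C *: g x))).
  apply/funext => x; rewrite !scalerA -!rmorphM -scalerDl -rmorphD; congr (_%:C *: _).
  by rewrite exprS; ring.
exact: (laplace0D ih (laplace0Z c%:C (laplace0_sqnorm ih))).
Qed.

Lemma gauss_tame_bound (c : R) : 0 <= c -> forall x : V, expR (- c * sqnorm x) <= 1.
Proof.
by move=> c0 x; rewrite -[leRHS]expR0 ler_expR mulNr oppr_le0 mulr_ge0 // sqnorm_ge0.
Qed.

(** With s = |x|^2, [cexp_approx] leaves 4 (s/2)^2 exp(s), and 4 (s/2)^2 = 16 (s/4)^2 <= 16
    exp(s/2): hence 16 and the rate 3/2. *)
Lemma gauss_approx N x :
  `|gauss 2^-1 x - (1 + - 2^-1 / N.+1%:R * sqnorm x) ^+ N.+1| <=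
  16 * expR (3 / 2 * sqnorm x) / N.+1%:R.
Proof.
set s := sqnorm x; have s0 : 0 <= s := sqnorm_ge0 x.
have := cexp_approx ((- 2^-1 * s)%:C : C) N.
have -> : cexp (- 2^-1 * s)%:C = (gauss 2^-1 x)%:C :> C by rewrite cexpR.
have -> : 1 + (- 2^-1 * s)%:C / N.+1%:R = (1 + - 2^-1 / N.+1%:R * s)%:C :> C.
  have -> : N.+1%:R = (N.+1%:R : R)%:C :> C by rewrite rmorph_nat.
  by rewrite -fmorphV -rmorphM -[1]/(1%:C) -rmorphD mulrAC.
rewrite -rmorphXn -rmorphB cabsR => h; apply: (le_trans h).
rewrite cabsR.
have -> : `|- 2^-1 * s| = s / 2 by rewrite normrM normrN !ger0_norm // mulrC.
have sq := square_exp_le (divr_ge0 (divr_ge0 s0 (ler0n R 2)) (ler0n R 2)).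
have -> : 3 / 2 * s = 2 * (s / 2 / 2) + 2 * (s / 2) by field.
rewrite expRD [16 * _]mulrA ler_wpM2r ?invr_ge0 // ler_wpM2r ?expR_ge0 //.
have -> : 4 * (s / 2) ^+ 2 = 16 * (s / 2 / 2) ^+ 2 by field.
by rewrite ler_wpM2l.
Qed.

(* The Gaussian is the limit of the polynomials [(1 - |x|^2 / (2N))^N], whose error
   [gauss_approx] costs a factor [expR (3/2 |x|^2)]; this is why [g] must decay like
   [expR (- 2 |x|^2)]. *)
Lemma laplace0_gauss g (K : R) : laplace0 g ->
  (forall x, nrm (g x) <= K * expR (- 2 * sqnorm x)) ->
  laplace0 (fun x => (gauss 2^-1 x)%:C *: g x).
Proof.
move=> gV gb; have [gg gI] := gV.
have K0 : 0 <= K by have := le_trans (nrm_ge0 _) (gb 0); rewrite pmulr_lge0 ?expR_gt0.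
have tg : tame (gauss (n := n) 2^-1).
  split; first exact: continuous_gauss.
  move=> e e0; exists 1 => x; rewrite mul1r ger0_norm ?expR_ge0 // ler_expR.
  by rewrite ler_wpM2r ?sqnorm_ge0 //; lra.
split; first exact: gauss_class_tame.
move=> eta.
(* Rate balance: 1/4 for the exponential in [eta] and 3/2 for the approximation, against decay 2,
   leave a Gaussian of rate 1/4. *)
have q4 : (0 : R) < 4^-1 by [].
have [M M0 Mb] := exp_dot_bound eta q4 ler01.
have gJ : gauss_dominated (gauss (n := n) 4^-1) := gauss_dominated_gauss q4.
pose J := intR mu (gauss (n := n) 4^-1).
have J0 : 0 <= J by apply: intR_ge0 => x; exact: expR_ge0.
have gE : gauss_class (fun x => (expR (dotR eta x))%:C *: ((gauss 2^-1 x)%:C *: g x)).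
  by apply: gauss_class_exp; exact: gauss_class_tame.
apply: nrm_small => e e0.
have JE : intR mu (gauss (n := n) 4^-1) = J by [].
clearbody J.
have [N h] : exists N, 16 * M * K * J / e < N.+1%:R.
  by exists (Num.truncn (16 * M * K * J / e)); exact: truncnS_gt.
have N0 : (0 : R) < N.+1%:R by rewrite ltr0n.
have NE : 16 * M * K / N.+1%:R * J <= e.
  rewrite mulrAC ler_pdivrMr //; move: h.
  by rewrite ltr_pdivrMr // [_ * e]mulrC => /ltW.
have [gP PI] := laplace0_power (- 2^-1 / N.+1%:R) N.+1 gV.
have gPe := gauss_class_exp eta gP.
have E : intX mu (fun x => (expR (dotR eta x))%:C *: ((gauss 2^-1 x)%:C *: g x)) =
  intX mu (fun x => (expR (dotR eta x))%:C *: ((gauss 2^-1 x)%:C *: g x) +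
     (-1) *: ((expR (dotR eta x))%:C *: (((1 + - 2^-1 / N.+1%:R * sqnorm x) ^+ N.+1)%:C *: g x))).
  by rewrite intXD ?intXZ ?PI ?scaler0 ?addr0 //; exact: gauss_classZ.
have K4 : 0 <= 16 * M * K / N.+1%:R :=
  divr_ge0 (mulr_ge0 (mulr_ge0 (ler0n R 16) M0) K0) (ler0n R _).
rewrite E; apply: le_trans NE; rewrite -JE -(intRZ leb K4 gJ).
apply: (intX_le leb (gauss_classD gE (gauss_classZ (-1) gPe)) (gauss_dominatedZ K4 gJ)).
move=> x; set s := sqnorm x.
have s0 : 0 <= s := sqnorm_ge0 x.
rewrite scaleN1r -scalerBr -scalerBl -rmorphB nrmZR nrmZR.
rewrite (ger0_norm (expR_ge0 _)).
have h1 : expR (dotR eta x) <= M * expR (4^-1 * s).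
  apply: le_trans (Mb x); rewrite ler_expR mul1r; exact: ler_norm.
have h2 := gauss_approx N x.
have h3 := ler_pM (normr_ge0 _) (nrm_ge0 _) h2 (gb x).
apply: le_trans (ler_pM (expR_ge0 _) (mulr_ge0 (normr_ge0 _) (nrm_ge0 _)) h1 h3) _.
rewrite /gauss -/s.
have -> : M * expR (4^-1 * s) * (16 * expR (3 / 2 * s) / N.+1%:R * (K * expR (- 2 * s))) =
  16 * M * K / N.+1%:R * (expR (4^-1 * s) * expR (3 / 2 * s) * expR (- 2 * s)).
  by field; rewrite gt_eqF.
rewrite -!expRD.
have -> // : 4^-1 * s + 3 / 2 * s + - 2 * s = - 4^-1 * s by field.
Qed.

(** Gaussians are at most 1, so the bound required by [laplace0_gauss] persists with the same [K] at
    every step. *)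
Lemma laplace0_gauss_iter g (K : R) k : laplace0 g ->
  (forall x, nrm (g x) <= K * expR (- 2 * sqnorm x)) ->
  laplace0 (fun x => (gauss (k%:R / 2) x)%:C *: g x).
Proof.
move=> gV gb; elim: k => [|k ih].
  have -> // : (fun x => (gauss (0%:R / 2) x)%:C *: g x) = g.
  by apply/funext => x; rewrite /gauss mul0r oppr0 mul0r expR0 scale1r.
have -> : (fun x => (gauss (k.+1%:R / 2) x)%:C *: g x) =
   (fun x => (gauss 2^-1 x)%:C *: ((gauss (k%:R / 2) x)%:C *: g x)).
  apply/funext => x; rewrite scalerA -rmorphM /gauss -expRD -natr1.
  by congr ((expR _)%:C *: _); field.
apply: (laplace0_gauss (K := K) ih) => x; apply: le_trans (gb x).
rewrite nrmZR ger0_norm ?expR_ge0 // ler_piMl ?nrm_ge0 //.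
by rewrite gauss_tame_bound // divr_ge0.
Qed.

(** Expanding the square, a Gaussian centred at [y] is a constant times the centred Gaussian times
    exp(k y.x): the integral is a transform taken at eta = k y. *)
Lemma laplace0_heat g (K : R) k y : laplace0 g ->
  (forall x, nrm (g x) <= K * expR (- 2 * sqnorm x)) ->
  gauss_class (fun x => (gauss (k%:R / 2) (x + - y))%:C *: g x) /\
  intX mu (fun x => (gauss (k%:R / 2) (x + - y))%:C *: g x) = 0.
Proof.
move=> gV gb; have [gk Ik] := laplace0_gauss_iter k gV gb.
have -> : (fun x => (gauss (k%:R / 2) (x + - y))%:C *: g x) =
   (fun x => (gauss (k%:R / 2) y)%:C *: ((expR (dotR (k%:R *: y) x))%:C *:
      ((gauss (k%:R / 2) x)%:C *: g x))).
  apply/funext => x; rewrite !scalerA -!rmorphM /gauss -!expRD.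
  congr ((expR _)%:C *: _).
  have E : dotR x (- y) = - dotR y x by rewrite dotRC -scaleN1r dotRZl mulN1r.
  by rewrite sqnormD sqnormN dotRZl E; field.
have ge := gauss_class_exp (k%:R *: y) gk.
split; first exact: gauss_classZ.
by rewrite intXZ // Ik scaler0.
Qed.

(** Integrate over a cube contained in |x|^2 <= r. That [m] does not depend on [k] is what the final
    comparison uses. *)
Lemma intR_gauss_lower (r : R) : 0 < r ->
  exists2 m : R, 0 < m & forall k : R, 0 < k -> expR (- k * r) * m <= intR mu (gauss (n := n) k).
Proof.
move=> r0; pose d := Num.min 1 r / (n.+1%:R).
have n0 : (0 : R) < n.+1%:R by rewrite ltr0n.
have m1 : 0 < Num.min 1 r by rewrite lt_min ltr01.
have d0 : 0 < d by rewrite divr_gt0.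
pose B := obox (fun _ : 'I_n => - d) (fun _ => d).
have mB : measurable B by exact: measurable_obox.
have muB : mu B = ((2 * d) ^+ n)%:E.
  rewrite mu_obox // => [|i]; last by lra.
  by congr EFin; rewrite prodr_const card_ord; congr (_ ^+ _); ring.
exists ((2 * d) ^+ n); first by rewrite exprn_gt0 // mulr_gt0.
move=> k k0; rewrite -lee_fin -(intRE leb (gauss_dominated_gauss k0)) EFinM -muB.
have mI : measurable_fun [set: T] (fun t => (\1_B t)%:E : \bar R).
  by apply/measurable_EFinP; exact: measurable_indic mB.
have i0 t : (0 <= (\1_B t)%:E :> \bar R)%E by rewrite lee_fin.
have c0 : (0 <= (expR (- k * r))%:E)%E by rewrite lee_fin expR_ge0.
rewrite -[B]setIT -(integral_indic mu measurableT mB).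
rewrite -(ge0_integralZl mu measurableT mI (fun t _ => i0 t) c0).
apply: ge0_le_integral => //.
- exact: (emeasurable_funM (measurable_cst _) mI).
- exact: (measurable_rv (@continuous_gauss R n k)).
move=> t _; rewrite indicE; case: (boolP (t \in B)) => [|_]; last first.
  by rewrite mule0 lee_fin expR_ge0.
rewrite inE mule1 lee_fin ler_expR => tB.
rewrite ler_wnM2l ?oppr_le0 ?(ltW k0) //.
have coord (i : 'I_n) : rv_of_tuple t ord0 i * rv_of_tuple t ord0 i <= r / n.+1%:R.
  have ti : `|tnth t i| <= d by rewrite ler_norml; have /andP[h1 h2] := tB i; rewrite (ltW h1).
  rewrite rvE -expr2 -[_ ^+ 2]real_normK ?num_real //.
  apply: (@le_trans _ _ (d * d)); first by rewrite expr2 ler_pM.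
  have dr : d <= r / n.+1%:R by rewrite ler_wpM2r ?invr_ge0 // ge_min lexx orbT.
  have d1 : d <= 1.
    rewrite ler_pdivrMr // mul1r (le_trans _ (_ : 1 <= _)) ?ler1n //.
    by rewrite ge_min lexx.
  by rewrite (le_trans _ dr) // ler_piMl // ltW.
apply: (@le_trans _ _ (\sum_(i < n) r / n.+1%:R)); first exact: ler_sum.
rewrite sumr_const card_ord -[_ *+ n]mulr_natr mulrAC ler_pdivrMr //.
by rewrite ler_wpM2l ?(ltW r0) // ler_nat.
Qed.

(* The kernels [expR (- k/2 |x - y|^2)] concentrate at [y]. *)
Lemma heat_concentration g (K d : R) k y : laplace0 g ->
  (forall x, nrm (g x) <= K * expR (- 2 * sqnorm x)) ->
  (forall x, sqnorm (x + - y) < d ^+ 2 -> nrm (g x - g y) <= nrm (g y) / 2) ->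
  nrm (g y) / 2 * intR mu (gauss (n := n) (k.+1%:R / 2)) <=
  2 * K * expR (- (k%:R / 2) * d ^+ 2) * intR mu (gauss (n := n) (1%:R / 2)).
Proof.
move=> gV gb dP; set v := g y in dP *.
have K0 : 0 <= K by have := le_trans (nrm_ge0 _) (gb 0); rewrite pmulr_lge0 ?expR_gt0.
have gK x : nrm (g x) <= K.
  apply: le_trans (gb x) _; rewrite ler_piMr //.
  by apply: gauss_tame_bound; exact: ler0n.
have vK : nrm v <= K := gK y.
pose G (k : nat) x := gauss (k%:R / 2) (x + - y).
have G0 j x : 0 <= G j x := expR_ge0 _.
pose c := 2 * K * expR (- (k%:R / 2) * d ^+ 2).
have c0 : 0 <= c := mulr_ge0 (mulr_ge0 (ler0n R 2) K0) (expR_ge0 _).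
have v0 : 0 <= nrm v / 2 := divr_ge0 (nrm_ge0 v) (ler0n R 2).
(* Near [y], continuity leaves half of the norm of [v]. Far away, [k] of the [k.+1] units of rate
   give the small constant and the remaining one keeps the majorant integrable. *)
have bound x : nrm ((G k.+1 x)%:C *: v + -1 *: ((G k.+1 x)%:C *: g x)) <=
    nrm v / 2 * G k.+1 x + c * G 1 x.
  rewrite scaleN1r -scalerBr nrmZR (ger0_norm (G0 _ _)).
  have [xd|xd] := ltP (sqnorm (x + - y)) (d ^+ 2).
    rewrite nrmB mulrC; apply: le_trans (ler_wpM2r (G0 _ _) (dP x xd)) _.
    by rewrite lerDl; exact: mulr_ge0 c0 (G0 _ _).
  have h1 : nrm (v - g x) <= 2 * K.
    apply: le_trans (nrmD _ _) _; rewrite nrmN mulr_natl mulr2n; exact: lerD.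
  have h2 : G k.+1 x <= expR (- (k%:R / 2) * d ^+ 2) * G 1 x.
    rewrite /G /gauss -expRD ler_expR -natr1.
    have k2 : (0 : R) <= k%:R / 2 := divr_ge0 (ler0n R k) (ler0n R 2).
    have := ler_wpM2l k2 xd.
    by lra.
  apply: le_trans (ler_pM (G0 _ _) (nrm_ge0 _) h2 h1) _.
  have -> : expR (- (k%:R / 2) * d ^+ 2) * G 1 x * (2 * K) = c * G 1 x.
    by rewrite /c mulrC mulrA.
  by rewrite lerDr; exact: mulr_ge0 v0 (G0 _ _).
have Gd j : gauss_dominated (G j.+1).
  exact: gauss_dominated_shift (- y) (divr_gt0 (ltr0n R j.+1) (ltr0n R 2)).
have Gint j : intR mu (G j.+1) = intR mu (gauss (n := n) (j.+1%:R / 2)).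
  exact: (intR_shift leb (- y) (@continuous_gauss R n _) (fun x => expR_ge0 _)).
have [gcl I0] := laplace0_heat k.+1 y gV gb.
have gvec := gauss_class_vec v (Gd k).
have gneg := gauss_classZ (-1) gcl.
have := intX_le leb (gauss_classD gvec gneg)
  (gauss_dominatedD (gauss_dominatedZ v0 (Gd k)) (gauss_dominatedZ c0 (Gd 0%N))) bound.
rewrite (intXD leb gvec gneg) (intXZ leb _ gcl) I0 scaler0 addr0 (intX_vec leb v (Gd k)).
rewrite (intRD leb (gauss_dominatedZ v0 (Gd k)) (gauss_dominatedZ c0 (Gd 0%N))).
rewrite (intRZ leb v0 (Gd k)) (intRZ leb c0 (Gd 0%N)) (Gint k) (Gint 0%N) nrmZR.
have Jk0 : 0 <= intR mu (gauss (n := n) (k.+1%:R / 2)).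
  by apply: intR_ge0 => x; exact: expR_ge0.
rewrite (ger0_norm Jk0) -/c; move: Jk0; set Jk := intR mu _; set J1 := intR mu _ => Jk0.
clearbody Jk J1 c; clear -Jk0; lra.
Qed.

(** If g y is nonzero, [heat_concentration] bounds the Gaussian integrals by a constant times exp(-
    k d^2 / 2), while [intR_gauss_lower] with r = d^2/2 gives a slower exponential decay from below;
    the two are incompatible for large [k]. *)
Lemma laplace0_eq0 g (K : R) : laplace0 g ->
  (forall x, nrm (g x) <= K * expR (- 2 * sqnorm x)) -> forall y, g y = 0.
Proof.
move=> gV gb y; have [[gc _] _] := gV.
have K0 : 0 <= K by have := le_trans (nrm_ge0 _) (gb 0); rewrite pmulr_lge0 ?expR_gt0.
set v := g y; apply: nrm_eq0; apply: le_anti; rewrite nrm_ge0 andbT leNgt.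
apply/negP => v0.
have v2 : 0 < nrm v / 2 by rewrite divr_gt0.
have [d d0 dP] : exists2 d : R, 0 < d & forall x, sqnorm (x + - y) < d ^+ 2 ->
    nrm (g x - v) <= nrm v / 2.
  have /nbhs_ballP[d d0 dP] := (ncontinuousP g).1 gc y _ v2.
  exists d => // x xy; apply: ltW; apply: dP; split => // i j.
  rewrite ord1 /ball /= distrC -(@ltr_pXn2r _ 2) ?nnegrE ?(ltW d0) //.
  rewrite real_normK ?num_real // (le_lt_trans _ xy) //.
  by have := sqr_coord_le (x + - y) j; rewrite !mxE.
have d2 : 0 < d ^+ 2 by rewrite exprn_gt0.
have [m m0 mlow] := intR_gauss_lower (divr_gt0 d2 (ltr0n R 2)).
have key k := heat_concentration k gV gb dP.
pose J1 := intR mu (gauss (n := n) (1%:R / 2)).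
have kp k : (0 : R) < k.+1%:R / 2 := divr_gt0 (ltr0n R k.+1) (ltr0n R 2).
pose A := nrm v / 2 * m; have A0 : 0 < A by rewrite mulr_gt0.
(* - (k+2) d^2 / 4 = k c - (k+1) d^2 / 2, so exp(k c) is the surplus of the lower bound; [q] is
   chosen so that k c alone exceeds what is allowed. *)
pose c := d ^+ 2 / 4; have c0 : 0 < c by rewrite divr_gt0.
pose q := 2 * K * J1 / (A * c).
have kq : q < (Num.truncn q).+1%:R by exact: truncnS_gt.
have := key (Num.truncn q).+2; set k := (Num.truncn q).+1 in kq *.
have := ler_wpM2l (ltW v2) (mlow _ (kp k.+1)) => h1 /(le_trans h1).
have -> : nrm v / 2 * (expR (- (k.+2%:R / 2) * (d ^+ 2 / 2)) * m) =
    A * expR ((k%:R) * c) * expR (- (k.+1%:R / 2) * d ^+ 2).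
  rewrite -[RHS]mulrA -expRD /A.
  have -> : - (k.+2%:R / 2) * (d ^+ 2 / 2) = k%:R * c + - (k.+1%:R / 2) * d ^+ 2.
    by rewrite -(natr1 k.+1) -(natr1 k) /c; field.
  by rewrite mulrCA mulrC.
have -> : 2 * K * expR (- (k.+1%:R / 2) * d ^+ 2) * J1 =
    2 * K * J1 * expR (- (k.+1%:R / 2) * d ^+ 2) by rewrite mulrAC.
rewrite ler_pM2r ?expR_gt0 //; apply/negP; rewrite -ltNge.
move: kq; rewrite ltr_pdivrMr ?mulr_gt0 // => /lt_le_trans; apply.
rewrite mulrCA ler_pM2l // (le_trans _ (expR_ge1Dx _)) // lerDr //.
Qed.

End Injectivity.

(** * Hardy's theorem *)

Section Translation.
Context {R : realType} {n : nat} {X : completeNormedModType R[i]}.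
Local Notation V := 'rV[R]_n.
Variable mu : {measure set (n.-tuple R) -> \bar R}.
Hypothesis leb : is_lebesgue_Rn mu.
Variable f : V -> X.
Hypothesis fc : ncontinuous f.
Hypothesis fgauss : forall x, nrm (f x) <= expR (- pi * sqnorm x).
Hypothesis ffourier : forall xi : V, nrm (fourier mu f xi) <= expR (- pi * sqnorm xi).
Implicit Types s x : V.

(* Hardy's hypotheses give [tr s] and [f] the same bound and the same Laplace transform. *)
Let tr s x := (expR (dotR ((2 * pi) *: s) x + pi * sqnorm s))%:C *: f (x + s).

Let nrm_tr s x : nrm (tr s x) <= expR (- pi * sqnorm x).
Proof.
rewrite nrmZR (ger0_norm (expR_ge0 _)).
apply: le_trans (ler_wpM2l (expR_ge0 _) (fgauss (x + s))) _.
rewrite -expRD ler_expR sqnormD dotRZl (dotRC s).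
by lra.
Qed.

Let gauss_class_tr s : gauss_class (tr s).
Proof.
split; last by exists 1, pi; split => [|x]; rewrite ?pi_gt0 ?mul1r.
apply: (ncontinuousZR (a := fun x => expR (dotR ((2 * pi) *: s) x + pi * sqnorm s))).
  apply: continuous_expR_comp => x.
  apply: (@continuousD _ _ _ (fun x => dotR ((2 * pi) *: s) x) (fun=> pi * sqnorm s)).
    exact: continuous_dotR.
  exact: (@cst_continuous _ _ _ x).
exact: ncontinuous_shift.
Qed.

(** Translating back gives the moment of [f] at s + w, and |s+w|^2 + |s|^2 - 2 (s+w).s = |w|^2, so
    [s] drops out. *)
Let intX_tr s (w : V) :
  intX mu (fun x => (expR (dotR ((2 * pi) *: w) x))%:C *: tr s x) =
  (expR (pi * sqnorm w))%:C *: intX mu f.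
Proof.
pose c := expR (pi * sqnorm s - 2 * pi * dotR (s + w) s).
pose h x := c%:C *: ((expR (dotR ((2 * pi) *: (s + w)) x))%:C *: f x).
have gh : gauss_class h.
  by apply: gauss_classZ; apply: gauss_class_tame; [exact: tame_exp|exact: gauss_class_f].
have E : (fun x => (expR (dotR ((2 * pi) *: w) x))%:C *: tr s x) = (fun x => h (x + s)).
  apply/funext => x; rewrite /h /tr !scalerA -!rmorphM -!expRD; congr ((expR _)%:C *: _).
  rewrite !dotRZl !dotRDl !dotRDr; ring.
have ghs : gauss_class (fun x => h (x + s)).
  rewrite -E; apply: (gauss_class_tame (u := fun x => expR (dotR ((2 * pi) *: w) x))) => //.
  exact: tame_exp.
rewrite E (intX_shift leb gh ghs) (intXZ leb); last first.
  by apply: gauss_class_tame; [exact: tame_exp|exact: gauss_class_f].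
rewrite (hardy_moments leb fc fgauss ffourier) scalerA -rmorphM -expRD.
congr ((expR _)%:C *: _); rewrite sqnormD dotRDl /sqnorm (dotRC s w); ring.
Qed.

Lemma hardy_gaussian s : f s = (expR (- pi * sqnorm s))%:C *: f 0.
Proof.
pose g x := tr s x + (-1) *: f x.
have gf := gauss_class_f fc fgauss.
have gV : laplace0 mu g.
  split; first by exact: (gauss_classD (gauss_class_tr s) (gauss_classZ (-1) gf)).
  move=> eta; pose w := (2 * pi)^-1 *: eta.
  have -> : eta = (2 * pi) *: w by rewrite scalerA divff ?scale1r // gt_eqF // mulr_gt0 ?pi_gt0.
  have gt := gauss_class_exp ((2 * pi) *: w) (gauss_class_tr s).
  have gfe := gauss_class_exp ((2 * pi) *: w) gf.
  have -> : (fun x => (expR (dotR ((2 * pi) *: w) x))%:C *: g x) =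
    (fun x => (expR (dotR ((2 * pi) *: w) x))%:C *: tr s x +
      (-1) *: ((expR (dotR ((2 * pi) *: w) x))%:C *: f x)).
    by apply/funext => x; rewrite scalerDr !scalerA mulrN1 mulN1r.
  rewrite (intXD leb gt (gauss_classZ (-1) gfe)) (intXZ leb _ gfe) intX_tr.
  by rewrite (hardy_moments leb fc fgauss ffourier) scaleN1r subrr.
have gb x : nrm (g x) <= 2 * expR (- 2 * sqnorm x).
  (* The rate 2 demanded by [laplace0_gauss] is available because pi >= 2. *)
  have h : expR (- pi * sqnorm x) <= expR (- 2 * sqnorm x).
    by rewrite ler_expR ler_wpM2r ?sqnorm_ge0 // lerN2 pi_ge2.
  rewrite /g scaleN1r; apply: le_trans (nrmD _ _) _; rewrite nrmN mulr_natl mulr2n.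
  by apply: lerD; apply: le_trans h; [exact: nrm_tr|exact: fgauss].
have := laplace0_eq0 leb gV gb 0; rewrite /g /tr scaleN1r => /eqP.
have -> : dotR ((2 * pi) *: s) 0 = 0 by rewrite dotRC -[0 : V](scale0r s) dotRZl mul0r.
rewrite subr_eq0 !add0r => /eqP <-; rewrite scalerA -rmorphM -expRD.
by rewrite mulNr addNr expR0 scale1r.
Qed.

End Translation.

Theorem theorem3 (R : realType) (n : nat) (X : completeNormedModType R[i])
  (mu : {measure set (n.-tuple R) -> \bar R}) (f : 'rV[R]_n -> X) :
  is_lebesgue_Rn mu ->
  smooth f ->
  (forall x : 'rV[R]_n, nrm (f x) <= expR (- pi * sqnorm x)) ->
  (forall xi : 'rV[R]_n, nrm (fourier mu f xi) <= expR (- pi * sqnorm xi)) ->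
  forall x : 'rV[R]_n, f x = (expR (- pi * sqnorm x))%:C *: f 0.
Proof.
move=> leb fsmooth fgauss ffourier.
(* The empty list of directions in [smooth] yields continuity of [f] itself. *)
have fc : ncontinuous f by apply: continuous_ncontinuous; exact: (fsmooth [::]).1.
exact: (hardy_gaussian leb fc fgauss ffourier).
Qed.
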